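(* Let $k\in\{5,6\}$ and let $p,f,h:\mathbb{N}\to\mathbb{R}$ satisfy all of the following: (1) $f(k)\ge (k-1)(1-p(k)-h(k))$; (2) $p(k)\ge \frac{3}{k-2}$; (3) $p(k)\ge h(k)+5-k$; (4) $p(k)\ge \frac{2+h(k)}{k-2}$; (5) $(k-1)p(k)+(k-3)h(k)\ge k+1$; (6) $h(k)+1+f(k)\le 0$; (7) $p(k)+(k-5)h(k)\le k+1$. If $G$ is a $k$-AT-critical graph with $G\ne K_k$, then \[d(G)\ge k-1+\frac{2-p(k)}{k+2+4h(k)-p(k)}.\]
   Context: All graphs are finite and simple; $d(G)=2|E(G)|/|V(G)|$ is the average degree. For a digraph $D$, a spanning eulerian subdigraph is a spanning subdigraph in which every vertex has equal in- and out-degree; $EE(D)$ and $EO(D)$ denote the numbers of spanning eulerian subdigraphs of $D$ with an even, respectively odd, number of arcs. For $f:V(G)\to\mathbb{N}$, a graph $G$ is $f$-AT if it has an orientation $D$ with $EE(D)\ne EO(D)$ and $f(v)\ge d^+_D(v)+1$ for all $v$. The Alon--Tarsi number $\mathrm{AT}(G)$ is the least $k$ such that $G$ is $f$-AT for the constant function $f\equiv k$. A graph $G$ is $k$-AT-critical if $\mathrm{AT}(G)=k$ and $\mathrm{AT}(H)<k$ for every proper subgraph $H$ of $G$.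
   Formalization: The formal theorem adds the hypothesis k+2+4h(k)-p(k) > 0; without it the statement fails, e.g. k=5, p=6, h=-0.26, f=-0.74 satisfy (1)-(7) but give the false bound d(G) ≥ 104. *)

(* Defs.v *)
From HB Require Import structures.
From mathcomp Require Import all_boot all_order all_algebra.
From mathcomp Require Import reals.

Set Implicit Arguments.
Unset Strict Implicit.
Unset Printing Implicit Defensive.

(* A finite simple graph whose vertices live in T. The vertex set need not be
   all of T, so that a graph and its subgraphs have the same type. *)
Record sgraph (T : finType) := SGraph {
  verts : {set T};
  edges : {set {set T}};
  edgesP : forall e, e \in edges -> e \subset verts /\ #|e| = 2
}.

Section Graphs.
Variable T : finType.
Implicit Types (G H : sgraph T) (D S : {set T * T}).

Definition subgraph H G : bool :=
  (verts H \subset verts G) && (edges H \subset edges G).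

Definition proper_subgraph H G : bool := subgraph H G && ~~ subgraph G H.

(* G is a copy of K_n, complete graphs being taken up to isomorphism. *)
Definition is_complete_graph (n : nat) G : Prop :=
  #|verts G| = n /\
  {in verts G &, forall x y, x != y -> [set x; y] \in edges G}.

Definition avg_degree (R : realType) G : R :=
  (2 * #|edges G|%:R / #|verts G|%:R)%R.

(* A digraph is given by its set of arcs; (x, y) is the arc from x to y. *)
Definition outdeg D (x : T) : nat := #|[set a in D | a.1 == x]|.
Definition indeg D (x : T) : nat := #|[set a in D | a.2 == x]|.

Definition orientation G D : bool :=
  [forall x, forall y,
     ((((x, y) \in D) || ((y, x) \in D)) == ([set x; y] \in edges G)) &&
     ~~ (((x, y) \in D) && ((y, x) \in D))].

(* A spanning subdigraph is determined by its set of arcs. Points of T that are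
   not vertices have in- and out-degree 0, so x may range over all of T. *)
Definition eulerian_sub D S : bool :=
  (S \subset D) && [forall x, outdeg S x == indeg S x].

Definition EE D : nat := #|[set S | eulerian_sub D S & ~~ odd #|S|]|.
Definition EO D : nat := #|[set S | eulerian_sub D S & odd #|S|]|.

Definition f_AT G (f : T -> nat) : bool :=
  [exists D : {set T * T},
     [&& orientation G D, EE D != EO D &
         [forall x in verts G, outdeg D x + 1 <= f x]]].

(* An acyclic orientation has only the empty eulerian subdigraph. *)
Lemma exists_AT G : exists k, f_AT G (fun=> k).
Proof.
pose D := [set a : T * T | ([set a.1; a.2] \in edges G)
                           && (enum_rank a.1 < enum_rank a.2)].
have eulD S : eulerian_sub D S = (S == set0).
  apply/idP/eqP => [/andP[SD /forallP eulS]|->]; last first.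
    rewrite /eulerian_sub sub0set; apply/forallP => x.
    by apply/eqP/eq_card => a; rewrite !inE.
  apply/eqP; apply: contraT => /set0Pn [a0 a0S].
  case: (arg_minnP (fun a : T * T => enum_rank a.1 : nat) a0S) => a aS min_a.
  have: 0 < indeg S a.1.
    rewrite -(eqP (eulS a.1)); apply/card_gt0P; exists a.
    by rewrite inE eqxx andbT.
  case/card_gt0P => b; rewrite inE => /andP[bS /eqP ba].
  have := subsetP SD b bS; rewrite inE => /andP[_].
  by rewrite ba ltnNge min_a.
exists (#|{: T * T}| + 1); apply/existsP; exists D; apply/and3P; split.
- apply/forallP => x; apply/forallP => y; rewrite !inE /= (setUC [set y]).
  rewrite -!andb_orr; apply/andP; split; last first.
    by case: ltngtP; rewrite ?andbF.
  case: (boolP (_ \in edges G)) => //= xyE.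
  have: x != y.
    by apply: contraTneq xyE => ->; apply/negP => /edgesP[_]; rewrite cards2 eqxx.
  by rewrite -(inj_eq enum_rank_inj) -(inj_eq val_inj) neq_ltn => ->.
- have -> : EE D = 1.
    rewrite -(cards1 (set0 : {set T * T})); apply: eq_card => S.
    by rewrite !inE eulD; case: eqP => [->|//]; rewrite cards0.
  have -> // : EO D = 0.
  apply/eqP; rewrite cards_eq0; apply/eqP/setP => S.
  by rewrite !inE eulD; case: eqP => [->|//]; rewrite cards0.
- by apply/forall_inP => x _; rewrite leq_add2r max_card.
Qed.

Definition AT G : nat := ex_minn (exists_AT G).

Definition AT_critical (k : nat) G : Prop :=
  AT G = k /\ forall H, proper_subgraph H G -> AT H < k.

End Graphs.

(* Main.v *)
Require Import Defs.
From mathcomp Require Import all_boot all_order all_algebra.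
From mathcomp Require Import reals.
From mathcomp Require Import zify lra.

Set Implicit Arguments.
Unset Strict Implicit.
Unset Printing Implicit Defensive.

Import GRing.Theory Num.Theory.

(** In a k-AT-critical graph no nonempty vertex set A spans an orientation with
EE <> EO in which every v in A has in-degree at least d(v) - (k - 2): gluing it
to an orientation of G - A would give AT(G) < k. Hence the low vertices (those
of degree k - 1) span no even cycle with at most one chord, so that every cycle
of low vertices is a clique or a chordless odd cycle, and the end of a longest
path exhibits an end block. Removing end blocks bounds the number of edges of a
component C of the low vertices by a linear function of |C| and of the number
of "attached" vertices of C, those lying in a K_(k-1) of C with exactly one
neighbour outside of it.

Discharging: a vertex of degree >= k sends a fixed charge to each low
neighbour and an extra charge to attached neighbours. A vertex of degree k can
only afford the extra charge four times, and a component can miss it twice. If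
this cannot be arranged, some vertices Y of degree k and components C remain
such that each y has at least five attached neighbours and each C at least
three attached vertices. Orient each C away from an attached vertex w entered
from Y, followed by a second vertex u of its clique, and all other edges
towards Y. Rerouting w -> c as w -> u -> c cancels all eulerian subdigraphs but
those crossing C along w -> u. Ordering Y, and choosing w and u in each C such
that these crossings respect the order, only the empty one survives.

For k = 5, 6 the best bound that the hypotheses allow is attained at
(p, h) = (1, 1) and (13/17, 18/17) respectively, and only these two cases have
to be discharged. *)

(* [lia] restricted to the hypotheses that are (in)equalities between natural
   numbers: its preprocessing is very slow on large boolean contexts. *)
Ltac nlia :=
  repeat match goal with
  | H : ?t |- _ =>
    lazymatch t with
    | is_true (leq _ _) => fail
    | @eq nat _ _ => fail
    | _ => clear H
    end
  end; lia.

(** In-degree at least d(v) - (k - 2) means in-degree 1 at a low vertex and 2 at a vertex of degree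
    k. Edges leaving A are all directed outwards, so no eulerian subdigraph uses them and the signed
    count of a glued orientation is a product.

    The number five reflects k <= 6. A vertex y of degree k loses one incident edge to every
    component entered from it. Each component offers two entrances, and a balanced choice among them
    limits the loss at y to three, so five attached neighbours still leave in-degree 2.

    The weights of the discharging are the quantities of the bound cleared of denominators. The
    degree sum inside a component C is at most (k - 3 + p)|C| plus h for each attached vertex, less
    a constant; so a low vertex, of degree k - 1, has 2 - p left to be covered. A vertex of degree k
    exceeds k - 1 by one unit, worth k + 4h + (2 - p): one for each possible low neighbour, h for
    each of four extra charges, and 2 - p for itself. The bound is the quotient of 2 - p by this
    unit. The constant saved in each component is worth at least 2h, which is why it can miss two
    extra charges. *)

Lemma sum_sign_involution (I : finType) (P : pred I) (F : I -> int)
    (t : I -> I) :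
  (forall i, P i -> [/\ P (t i), t (t i) = i & F (t i) = - F i]%R) ->
  (\sum_(i | P i) F i = 0)%R.
Proof.
move=> tP; set s := (\sum_(i | _) _)%R.
suff : s = (- s)%R by move=> h; lia.
rewrite {1}/s (reindex_onto t t) => [|i /tP[]//].
rewrite /s -sumrN; apply: eq_big => [i|i /andP[Pti /eqP tti]].
  apply/andP/idP => [[Pti /eqP <-]|Pi]; first by have [] := tP _ Pti.
  by have [-> -> _] := tP _ Pi.
have Pi : P i by rewrite -tti; have [] := tP _ Pti.
by have [_ _ ->] := tP _ Pi.
Qed.

(** * Signed counts of eulerian subdigraphs *)

Section Signed.
Variable T : finType.
Implicit Types (D S R : {set T * T}) (x y w u c : T).

Definition signed_eul D : int := (\sum_(S | eulerian_sub D S) (-1) ^+ #|S|)%R.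

Lemma EE_neq_EO D : (EE D != EO D) = (signed_eul D != 0%R).
Proof.
suff -> : signed_eul D = ((EE D)%:Z - (EO D)%:Z)%R by rewrite subr_eq0.
rewrite /signed_eul (bigID (fun S : {set T * T} => ~~ odd #|S|)) /= /EE /EO.
rewrite -!sum1_card.
rewrite !(big_morph _ PoszD (erefl _)) -sumrN.
congr (_ + _)%R; apply: eq_big => [S|S]; rewrite ?inE ?negbK // => /andP[_].
  by move=> oS; rewrite -signr_odd (negbTE oS).
by move=> oS; rewrite -signr_odd oS.
Qed.

(** Out-degree minus in-degree as a sum over arcs: inserting an arc becomes additive, and a total
    over a vertex set can be computed by exchanging sums. *)
Definition excess S x : int := (\sum_(a in S) ((a.1 == x)%:Z - (a.2 == x)%:Z))%R.

Lemma excE S x : excess S x = ((outdeg S x)%:Z - (indeg S x)%:Z)%R.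
Proof.
rewrite /excess sumrB /outdeg /indeg -!sum1dep_card.
rewrite !(big_morph _ PoszD (erefl _)) !big_mkcondr /=.
by congr (_ - _)%R; apply: eq_bigr => a _; case: eqP.
Qed.

Lemma eulerian_exc D S :
  eulerian_sub D S = (S \subset D) && [forall x, excess S x == 0%R].
Proof.
congr (_ && _); apply: eq_forallb => x; rewrite excE.
by rewrite subr_eq0.
Qed.

Lemma excU1 S a x : a \notin S ->
  excess (a |: S) x = ((a.1 == x)%:Z - (a.2 == x)%:Z + excess S x)%R.
Proof. by move=> aS; rewrite /excess big_setU1. Qed.

Lemma outdegP S x : reflect (exists y, (x, y) \in S) (0 < outdeg S x).
Proof.
apply: (iffP card_gt0P) => [[[z y]]|[y xyS]].
  by rewrite inE => /andP[zyS /eqP /= <-]; exists y.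
by exists (x, y); rewrite inE xyS /=.
Qed.

Lemma indegP S x : reflect (exists y, (y, x) \in S) (0 < indeg S x).
Proof.
apply: (iffP card_gt0P) => [[[y z]]|[y xyS]].
  by rewrite inE => /andP[zyS /eqP /= <-]; exists y.
by exists (y, x); rewrite inE xyS /=.
Qed.

Lemma outdeg_uniq S x y z :
  outdeg S x <= 1 -> (x, y) \in S -> (x, z) \in S -> y = z.
Proof.
move/card_le1_eqP => h xy xz.
have : (x, y) = (x, z) by apply: h; rewrite inE ?xy ?xz /=.
by case.
Qed.

Lemma indegS D S x : S \subset D -> indeg S x <= indeg D x.
Proof.
move=> /subsetP SD; apply: subset_leq_card; apply/subsetP => a.
by rewrite !inE => /andP[/SD -> ->].
Qed.

Lemma eulerian_acyclic D (phi : T -> nat) S :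
  (forall a, a \in D -> phi a.1 < phi a.2) -> eulerian_sub D S = (S == set0).
Proof.
move=> up; apply/idP/eqP => [/andP[SD /forallP eulS]|->]; last first.
  rewrite /eulerian_sub sub0set; apply/forallP => x.
  by apply/eqP/eq_card => a; rewrite !inE.
apply/eqP; apply: contraT => /set0Pn [a0 a0S].
case: (arg_minnP (fun a : T * T => phi a.1) a0S) => a aS min_a.
have /indegP[y yS] : 0 < indeg S a.1.
  by rewrite -(eqP (eulS a.1)); apply/outdegP; exists a.2; case: a aS {min_a}.
have := up _ (subsetP SD _ yS); rewrite ltnNge.
by rewrite (min_a (y, a.1)).
Qed.

Lemma signed_eul_acyclic D (phi : T -> nat) :
  (forall a, a \in D -> phi a.1 < phi a.2) -> signed_eul D = 1%R.
Proof.
move=> up; rewrite /signed_eul (eq_bigl (pred1 set0)).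
  by rewrite big_pred1_eq cards0.
by move=> S; rewrite (eulerian_acyclic S up).
Qed.

(** These are the arcs by which a walk entering at w leaves the pair towards a common out-neighbour.
    The arc w -> u is excluded, since it has to survive the cancellation. *)
Definition twin_arcs D w u : {set T * T} :=
  [set a | [&& (w, a.2) \in D, a.2 != u & (a.1 == w) || (a.1 == u)]].

(* Rerouting w -> c as w -> u -> c changes the parity of an eulerian
   subdigraph. *)
Lemma signed_eul_twin D w u :
    (forall x, (x, x) \notin D) -> indeg D w <= 1 ->
    (forall x, (x, u) \in D -> x = w) -> (w, u) \in D ->
    (forall c, (w, c) \in D -> c != u -> (u, c) \in D) ->
  signed_eul D = signed_eul (D :\: twin_arcs D w u).
Proof.
move=> irrD inw inu wuD tw; set R := twin_arcs D w u.
rewrite /signed_eul (bigID (fun S => [disjoint S & R])) /=.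
rewrite [X in (_ + X)%R](_ : _ = 0%R) ?addr0.
  apply: eq_bigl => S; rewrite /eulerian_sub subsetD.
  by rewrite andbAC.
have wu : w != u by apply: contraTneq wuD => ->.
have outw S : eulerian_sub D S -> outdeg S w <= 1.
  by case/andP => SD /forallP /(_ w) /eqP ->; apply: leq_trans (indegS _ SD) inw.
have outu S : eulerian_sub D S -> outdeg S u <= 1.
  case/andP => SD /forallP /(_ u) /eqP ->.
  apply/card_le1_eqP => -[x1 y1] [x2 y2].
  rewrite !inE /= => /andP[/(subsetP SD) h1 /eqP e1] /andP[/(subsetP SD) h2 /eqP e2].
  by move: h1 h2; rewrite e1 e2 => /inu -> /inu ->.
have outu1 S x : eulerian_sub D S -> (u, x) \in S -> (w, u) \in S.
  case/andP => SD /forallP /(_ u) /eqP eu uxS.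
  have : 0 < indeg S u by rewrite -eu; apply/outdegP; exists x.
  case/indegP => y yuS.
  by rewrite -(inu y) // (subsetP SD).
(* [cen S c] says that S leaves the pair through c by a twin arc. Such a c is unique: w and u have
   out-degree at most 1 in S, and an arc out of u forces w -> u. Hence [pick] is canonical and
   [tau], which reroutes at c, is an involution. *)
pose del c : {set T * T} := [set (w, u); (u, c); (w, c)].
pose cen S c := ((w, c) \in S :&: R) || ((u, c) \in S :&: R).
pose tau S : {set T * T} :=
  if [pick c | cen S c] is Some c then
    if (w, c) \in S then (w, u) |: ((u, c) |: (S :\: del c))
    else (w, c) |: (S :\: del c)
  else S.
have cen1 S c : eulerian_sub D S -> cen S c -> (w, c) \in S ->
   ((w, u) \notin S) /\ (forall x, (u, x) \notin S).
  move=> eS cc wcS.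
  have cu : c != u by move: cc; rewrite /cen !inE; case: (c != u); rewrite ?andbF.
  have wuS : (w, u) \notin S.
    by apply: contra cu => wuS; rewrite (outdeg_uniq (outw _ eS) wcS wuS).
  by split=> // x; apply: contra wuS => /outu1; apply.
have cenU S c c' : eulerian_sub D S -> cen S c -> cen S c' -> c = c'.
  move=> eS cc cc'.
  have hcu z : cen S z -> z != u.
    by rewrite /cen !inE; case: (z != u); rewrite ?andbF.
  have := hcu _ cc; have := hcu _ cc' => cu' cu.
  have hc z : cen S z -> (w, z) \in S \/ ((w, z) \notin S /\ (u, z) \in S).
    by rewrite /cen !inE; case: ((w, z) \in S) => /=; [left|case/andP; right].
  case: (hc _ cc) => [wc|[wc uc]]; case: (hc _ cc') => [wc'|[wc' uc']].
  - exact: outdeg_uniq (outw _ eS) wc wc'.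
  - by have [_ /(_ c')] := cen1 _ _ eS cc wc; rewrite uc'.
  - by have [_ /(_ c)] := cen1 _ _ eS cc' wc'; rewrite uc.
  - exact: outdeg_uniq (outu _ eS) uc uc'.
have cen_pick S c : eulerian_sub D S -> cen S c -> [pick c | cen S c] = Some c.
  move=> eS cc; case: pickP => [c' cc'|/(_ c)]; last by rewrite cc.
  by rewrite (cenU S c c').
apply: (@sum_sign_involution _ _ _ tau) => S /andP[eS].
case/pred0Pn => -[z c] /= /andP[zcS zcR].
have [wcD cu zwu] : [/\ (w, c) \in D, c != u & (z == w) || (z == u)].
  by move: zcR; rewrite inE => /and3P.
have ucD := tw _ wcD cu.
have ccS : cen S c.
  by rewrite /cen !in_setI; case/orP: zwu zcS zcR => /eqP -> -> ->; rewrite ?orbT.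
have wcR : (w, c) \in R by rewrite inE wcD cu eqxx.
have ucR : (u, c) \in R by rewrite inE wcD cu eqxx orbT.
have SD := proj1 (andP eS).
have bfs_dist : [/\ (w, u) != (u, c), (w, u) != (w, c) & (u, c) != (w, c)].
  by rewrite !xpair_eqE (negbTE wu) eqxx [u == w]eq_sym (negbTE wu) /= eq_sym cu.
have [d1 d2 d3] := bfs_dist.
pose S0 := S :\: del c.
have S0D : S0 \subset D by apply: subset_trans SD; apply: subsetDl.
have nwu : (w, u) \notin S0 by rewrite !inE eqxx.
have nuc : (u, c) \notin S0 by rewrite !inE eqxx orbT.
have nwc : (w, c) \notin S0 by rewrite !inE eqxx !orbT.
have nwu2 : (w, u) \notin (u, c) |: S0.
  by rewrite in_setU1 negb_or d1.
have E1 : excess ((w, c) |: S0) =1 excess ((w, u) |: ((u, c) |: S0)).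
  by move=> x; rewrite !excU1 //= [in RHS]addrA subrKA.
have eulE (A B : {set T * T}) : A \subset D -> excess A =1 excess B -> eulerian_sub D B -> eulerian_sub D A.
  rewrite !eulerian_exc => -> /= AB /andP[_ /forallP hB].
  by apply/forallP => x; rewrite AB.
case: (boolP ((w, c) \in S)) => wcS.
  have [wuS uS] := cen1 _ _ eS ccS wcS.
  have defS : S = (w, c) |: S0.
    apply/setP => a; rewrite !inE.
    case: (a =P (w, c)) => [->|_] /=; first by rewrite wcS.
    case: (a =P (w, u)) => [->|_] /=; first by rewrite (negbTE wuS).
    by case: (a =P (u, c)) => [->|_] //=; rewrite (negbTE (uS c)).
  have tS : tau S = (w, u) |: ((u, c) |: S0).
    by rewrite /tau (cen_pick S c) // wcS.
  have etS : eulerian_sub D (tau S).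
    apply: (eulE _ S) => //; last by move=> x; rewrite tS -E1 -defS.
    by rewrite tS !subUset !sub1set wuD ucD.
  have cctS : cen (tau S) c.
    by rewrite /cen !in_setI ucR tS !in_setU1 eqxx /= orbT andbT orbT.
  have wctS : (w, c) \notin tau S.
    by rewrite tS !in_setU1 !negb_or nwc eq_sym d2 eq_sym d3.
  split.
  - rewrite etS; apply/pred0Pn; exists (u, c).
    by rewrite /= ucR tS !in_setU1 eqxx orbT.
  - rewrite {1}/tau (cen_pick _ c) // (negbTE wctS) {2}defS; congr (_ |: _).
    rewrite tS; apply/setP => a; rewrite !inE.
    by do 3![case: eqP => //= _].
  by rewrite tS {1}defS !cardsU1 nuc nwu2 nwc /= !exprS !mulN1r ?opprK.
have ucS : (u, c) \in S.
  by case/orP: zwu zcS => /eqP -> // h; rewrite h in wcS.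
have wuS := outu1 _ _ eS ucS.
have defS : S = (w, u) |: ((u, c) |: S0).
  apply/setP => a; rewrite !inE.
  case: (a =P (w, u)) => [->|_] /=; first by rewrite wuS.
  case: (a =P (u, c)) => [->|_] /=; first by rewrite ucS.
  by case: (a =P (w, c)) => [->|_] //=; rewrite (negbTE wcS).
have tS : tau S = (w, c) |: S0.
  by rewrite /tau (cen_pick S c) // (negbTE wcS).
have etS : eulerian_sub D (tau S).
  apply: (eulE _ S) => //; last by move=> x; rewrite tS E1 -defS.
  by rewrite tS !subUset !sub1set wcD.
have cctS : cen (tau S) c.
  by rewrite /cen !in_setI wcR tS !in_setU1 eqxx.
have wctS : (w, c) \in tau S by rewrite tS in_setU1 eqxx.
split.
- rewrite etS; apply/pred0Pn; exists (w, c).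
  by rewrite /= wcR tS !in_setU1 eqxx.
- rewrite {1}/tau (cen_pick _ c) // wctS {2}defS; do 2!congr (_ |: _).
  rewrite tS; apply/setP => a; rewrite !inE.
  by do 3![case: eqP => //= _].
by rewrite tS {1}defS !cardsU1 nuc nwu2 nwc /= !exprS !mulN1r ?opprK.
Qed.

End Signed.

(** * Cancelling several pairs, gluing, relabelling, and even cycles *)

Section SignedCounts.
Variable T : finType.
Implicit Types (D S R X A : {set T * T}) (x y z w u c : T).

Definition twin_pair D (g : T * T) :=
  [/\ indeg D g.1 <= 1, forall x, (x, g.2) \in D -> x = g.1, g \in D &
      forall c, (g.1, c) \in D -> c != g.2 -> (g.2, c) \in D].

(** Disjoint pairs can be cancelled one after the other, because deleting the twin arcs of one pair
    removes no arc that leaves another pair. Only the arcs surviving all deletions must increase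
    [phi]. *)
Lemma signed_eul_twins (gs : seq (T * T)) D (phi : T -> nat) :
    (forall x, (x, x) \notin D) ->
    pairwise (fun g h => [&& g.1 != h.1, g.1 != h.2, g.2 != h.1 & g.2 != h.2])
      gs ->
    (forall g, g \in gs -> twin_pair D g) ->
    (forall a, a \in D -> (forall g, g \in gs -> a \notin twin_arcs D g.1 g.2) ->
       phi a.1 < phi a.2) ->
  signed_eul D = 1%R.
Proof.
elim: gs D => [|[w u] gs IH] D irrD /=.
  by move=> _ _ up; apply: (@signed_eul_acyclic _ _ phi) => a aD; apply: up.
case/andP => /allP dis pw tw up.
have [/= inw inu wuD twc] := tw _ (mem_head _ _).
rewrite (signed_eul_twin irrD inw inu wuD twc); set R := twin_arcs D w u.
have RP z x : z != w -> z != u -> ((z, x) \in D :\: R) = ((z, x) \in D).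
  by move=> zw zu; rewrite in_setD [in X in ~~ X]inE /= (negbTE zw) (negbTE zu) !andbF.
have sub : D :\: R \subset D by apply: subsetDl.
apply: IH => [x||[w' u'] g'|a aD' nota] //.
- by rewrite in_setD (negbTE (irrD x)) andbF.
- have /= /and4P[d1 d2 d3 d4] := dis _ g'; rewrite ![_ == w']eq_sym ![_ == u']eq_sym in d1 d2 d3 d4.
  have [|/= inw' inu' wuD' twc'] := tw (w', u'); first by rewrite inE g' orbT.
  split=> /=; first exact: leq_trans (indegS _ sub) inw'.
  + by move=> x /(subsetP sub) /inu'.
  + by rewrite RP.
  + by move=> c; rewrite !RP //; apply: twc'.
- have aD := subsetP sub _ aD'; apply: up => // -[w' u'] /predU1P[[-> ->]|g'] /=.
    by move: aD'; rewrite in_setD => /andP[].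
  have /= /and4P[d1 d2 d3 d4] := dis _ g'; rewrite ![_ == w']eq_sym ![_ == u']eq_sym in d1 d2 d3 d4.
  have /= := nota _ g'; apply: contra; rewrite !inE => /and3P[h -> ->].
  by move: (RP w' a.2 d1 d3); rewrite !inE h => ->.
Qed.

(** The total excess of S over B is the number of arcs of X in S. It vanishes for an eulerian S,
    which therefore splits into a part in [D1] and a part in [D2]. *)
Lemma signed_eul_glue D1 D2 X (B : {set T}) :
    (forall a, a \in D1 -> (a.1 \in B) && (a.2 \in B)) ->
    (forall a, a \in D2 -> (a.1 \notin B) && (a.2 \notin B)) ->
    (forall a, a \in X -> (a.1 \in B) && (a.2 \notin B)) ->
  signed_eul (D1 :|: D2 :|: X) = (signed_eul D1 * signed_eul D2)%R.
Proof.
move=> h1 h2 hX; set D := _ :|: X.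
have noX S : eulerian_sub D S -> S \subset D1 :|: D2.
  rewrite eulerian_exc => /andP[/subsetP SD /forallP eS].
  have : (\sum_(x in B) excess S x = 0)%R by rewrite big1 // => x _; apply/eqP.
  rewrite /excess exchange_big /= (eq_bigr (fun a : T * T => (a \in X)%:Z%R)); last first.
    move=> a aS; rewrite sumrB.
    have E z : (\sum_(x in B) (z == x)%:Z = (z \in B)%:Z)%R.
      case: (boolP (z \in B)) => zB.
        rewrite (bigD1 z) //= eqxx big1 ?addr0 // => x /andP[_ /negbTE xz].
        by rewrite eq_sym xz.
      by rewrite big1 // => x xB; case: eqP => // zx; rewrite zx xB in zB.
    rewrite !E; have := SD a aS; rewrite !in_setU.
    case: (boolP (a \in X)) => [/hX /andP[-> /negbTE ->]|_] //.
    by rewrite orbF => /orP[/h1 /andP[-> ->]|/h2 /andP[/negbTE -> /negbTE ->]]; rewrite subrr.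
  move=> s0; apply/subsetP => a aS; have := SD a aS; rewrite /D in_setU.
  case/orP => // aX; exfalso; move: s0; rewrite (bigD1 a) //= aX.
  have : (0 <= \sum_(i in S | i != a) (i \in X)%:Z)%R by apply: sumr_ge0.
  by set s := (\sum_(_ | _) _)%R; lia.
rewrite {2 3}/signed_eul big_distrlr /= pair_big /= {1}/signed_eul.
rewrite (reindex_onto (fun p : {set T * T} * {set T * T} => p.1 :|: p.2)
          (fun S => (S :&: D1, S :&: D2))) /=; last first.
  by move=> S /noX; rewrite -setIUr => /setIidPl.
have dis : [disjoint D1 & D2].
  apply/pred0P => a /=; apply/negP => /andP[/h1 /andP[a1 _] /h2 /andP[]].
  by rewrite a1.
apply: eq_big => -[S1 S2] /=; last first.
  move=> /andP[_ /eqP[e1 e2]].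
  have s1 : S1 \subset D1 by rewrite -e1 subsetIr.
  have s2 : S2 \subset D2 by rewrite -e2 subsetIr.
  rewrite -exprD -cardsUI (_ : S1 :&: S2 = set0) ?cards0 ?addn0 //.
  apply/eqP; rewrite setI_eq0; apply: disjointWl s1 _.
  exact: disjointWr s2 dis.
have degE S1' S2' : S1' \subset D1 -> S2' \subset D2 -> forall x,
   outdeg (S1' :|: S2') x = (if x \in B then outdeg S1' x else outdeg S2' x) /\
   indeg (S1' :|: S2') x = (if x \in B then indeg S1' x else indeg S2' x).
  move=> /subsetP s1 /subsetP s2 x; split; case: ifP => xB;
    rewrite /outdeg /indeg; congr #|pred_of_set _|; apply/setP => a; rewrite !inE.
  - case: eqP; rewrite ?andbF ?andbT // => ax.
    by case: (boolP (a \in S2')) => [/s2/h2/andP[]|]; rewrite ?ax ?xB ?orbF.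
  - case: eqP; rewrite ?andbF ?andbT // => ax.
    by case: (boolP (a \in S1')) => [/s1/h1/andP[]|]; rewrite ?ax ?xB ?orbF.
  - case: eqP; rewrite ?andbF ?andbT // => ax.
    by case: (boolP (a \in S2')) => [/s2/h2/andP[]|]; rewrite ?ax ?xB ?orbF.
  - case: eqP; rewrite ?andbF ?andbT // => ax.
    by case: (boolP (a \in S1')) => [/s1/h1/andP[]|]; rewrite ?ax ?xB ?orbF.
have out0 D' S (x : T) : S \subset D' -> (forall a, a \in D' -> (a.1 != x) && (a.2 != x)) ->
   outdeg S x = indeg S x.
  move=> /subsetP SD' h; rewrite /outdeg /indeg.
  rewrite !eq_card0 // => a; rewrite !inE; apply/negP => /andP[/SD' /h /andP[]].
    by move=> _ /negP.
  by move/negP.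
apply/andP/andP => [[/andP[SD /forallP eS] /eqP[e1 e2]]|[]].
  have s1 : S1 \subset D1 by rewrite -e1 subsetIr.
  have s2 : S2 \subset D2 by rewrite -e2 subsetIr.
  rewrite /eulerian_sub s1 s2 /=; split; apply/forallP => x.
    case: (boolP (x \in B)) => xB.
      by have [E1 E2] := degE _ _ s1 s2 x; have := eS x; rewrite E1 E2 xB.
    apply/eqP/(out0 D1) => // a /h1 /andP[a1 a2].
    by apply/andP; split; apply: contraNneq xB => <-.
  case: (boolP (x \in B)) => xB.
    apply/eqP/(out0 D2) => // a /h2 /andP[a1 a2].
    by apply/andP; split; apply: contraTneq xB => <-.
  by have [E1 E2] := degE _ _ s1 s2 x; have := eS x; rewrite E1 E2 (negbTE xB).
move=> /andP[s1 /forallP eS1] /andP[s2 /forallP eS2]; split.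
  apply/andP; split; first by apply: subset_trans (subsetUl _ _); apply: setUSS.
  apply/forallP => x; have [-> ->] := degE _ _ s1 s2 x.
  by case: ifP.
apply/eqP; congr (_, _); rewrite setIUl.
  rewrite (setIidPl s1) [X in _ :|: X](_ : _ = set0) ?setU0 //.
  apply/eqP; rewrite setI_eq0; apply: disjointWl s2 _; by rewrite disjoint_sym.
rewrite (setIidPl s2) [X in X :|: _](_ : _ = set0) ?set0U //.
by apply/eqP; rewrite setI_eq0; apply: disjointWl s1 _.
Qed.

(** Relabelling by an involution f, for which image and preimage agree. It will serve to exchange
    two vertices of an oriented clique. *)
Definition swap_arcs (f : T -> T) S : {set T * T} :=
  [set a | (f a.1, f a.2) \in S].

Section Swap.
Variables (f : T -> T) (fK : involutive f).

Lemma swap_arcsK : involutive (swap_arcs f).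
Proof. by move=> S; apply/setP => -[x y]; rewrite !inE /= !fK. Qed.

Lemma card_swap_arcs S : #|swap_arcs f S| = #|S|.
Proof.
pose h (a : T * T) := (f a.1, f a.2).
have hK : involutive h by case=> x y; rewrite /h /= !fK.
rewrite -(card_imset S (inv_inj hK)); congr #|pred_of_set _|.
by apply/setP => a; rewrite -{2}[a]hK (mem_imset _ _ (inv_inj hK)) inE.
Qed.

Lemma outdeg_swap S x : outdeg (swap_arcs f S) x = outdeg S (f x).
Proof.
rewrite /outdeg -(card_swap_arcs [set a in S | _]); congr #|pred_of_set _|.
by apply/setP => a; rewrite !inE /= (inj_eq (inv_inj fK)).
Qed.

Lemma indeg_swap S x : indeg (swap_arcs f S) x = indeg S (f x).
Proof.
rewrite /indeg -(card_swap_arcs [set a in S | _]); congr #|pred_of_set _|.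
by apply/setP => a; rewrite !inE /= (inj_eq (inv_inj fK)).
Qed.

Lemma signed_eul_swap D : signed_eul (swap_arcs f D) = signed_eul D.
Proof.
rewrite /signed_eul (reindex_inj (inv_inj swap_arcsK)) /=; apply: eq_big => [S|S _].
  congr (_ && _).
    apply/subsetP/subsetP => sub [x y]; have := sub (f x, f y); rewrite !inE /= ?fK; exact.
  apply/forallP/forallP => h x; have := h (f x); rewrite outdeg_swap indeg_swap ?fK //.
by rewrite card_swap_arcs.
Qed.

End Swap.

Definition cycle_arcs (s : seq T) : {set T * T} :=
  [set a | (a.1 \in s) && (a.2 == next s a.1)].

(** The empty subdigraph and the cycle are both even, so EE is at least 2. An odd subdigraph must
    use the chord. Two subdigraphs with the same chord that differ on one cycle arc differ on all of
    them, so two distinct odd ones would include one consisting of the chord alone, which is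
    unbalanced; hence EO is at most 1. *)
Lemma signed_eul_even_cycle (s : seq T) X :
    uniq s -> 0 < size s -> ~~ odd (size s) -> #|X| <= 1 ->
    (forall a, a \in X ->
      [&& a.1 \in s, a.2 \in s, a.2 != a.1 & a.2 != next s a.1]) ->
  signed_eul (cycle_arcs s :|: X) != 0%R.
Proof.
move=> us s_gt0 evs X1 hX; set D := _ :|: X.
have arith (o i : nat) (b1 b2 : bool) :
    b1 + o == 1 + i -> b2 + o == 0 + i -> b1 && ~~ b2.
  by case: b1; case: b2 => //= /eqP h1 /eqP h2; lia.
have card_cyc : #|cycle_arcs s| = size s.
  have -> : cycle_arcs s = [set (x, next s x) | x in s].
    apply/setP => -[x y]; apply/idP/imsetP => [|[z zs [-> ->]]].
      by rewrite inE /= => /andP[xs /eqP ->]; exists x.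
    by rewrite inE /= zs eqxx.
  rewrite card_imset; last by move=> x y [].
  by rewrite -(card_uniqP us).
have degD S x : S \subset D ->
   (outdeg S x = ((x \in s) && ((x, next s x) \in S)) + outdeg (S :&: X) x) /\
   (indeg S x = ((x \in s) && ((prev s x, x) \in S)) + indeg (S :&: X) x).
  move=> /subsetP SD.
  have splitS (P : pred (T * T)) :
      #|[set a in S | P a]| = #|[set a in S | P a && (a \in cycle_arcs s)]| + #|[set a in S :&: X | P a]|.
    rewrite -cardsUI [X in _ + X](_ : _ = 0) ?addn0.
      congr #|pred_of_set _|; apply/setP => a; rewrite !inE.
      case: (boolP (a \in S)) => //= /SD; rewrite !inE.
      by case: (P a) => //=; case: (_ && _) => //=; case: (a \in X).
    apply: eq_card0 => a; rewrite !inE; apply/negP.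
    move=> /andP[/andP[_ /andP[_ /andP[_ e]]] /andP[/andP[_ /hX/and4P[_ _ _]]]].
    by rewrite e.
  split; rewrite /outdeg /indeg splitS; congr (_ + _).
    case: (boolP (_ && _)) => [/andP[xs xS]|no].
      apply/eqP/cards1P; exists (x, next s x); apply/setP => -[y z].
      rewrite !inE /= xpair_eqE; case: (y =P x) => [->|_]; rewrite ?andbF //= xs /=.
      by case: eqP => [->|_]; rewrite ?andbF // xS.
    apply: eq_card0 => -[y z]; rewrite !inE /=; apply: contraNF no.
    by case/and3P => yz /eqP <- /andP[-> /eqP <-].
  case: (boolP (_ && _)) => [/andP[xs xS]|no].
    apply/eqP/cards1P; exists (prev s x, x); apply/setP => -[y z].
    rewrite !inE /= xpair_eqE; case: (z =P x) => [->|_]; rewrite ?andbF //=.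
    rewrite andbT; case: (y =P prev s x) => [->|ne].
      by rewrite xS mem_prev xs next_prev // eqxx.
    by apply/negP => /and3P[_ _ /eqP e]; apply: ne; rewrite e prev_next.
  apply: eq_card0 => -[y z]; rewrite !inE /=; apply: contraNF no.
  case/and3P => yz /eqP <- /andP[ys /eqP zE].
  by rewrite zE mem_next ys prev_next // -zE.
(* At the next vertex, S1 has one more entering arc than S2 and the same chord arcs, so it also has
   one more leaving cycle arc. *)
have step S1 S2 x : eulerian_sub D S1 -> eulerian_sub D S2 -> S1 :&: X = S2 :&: X ->
    x \in s -> (x, next s x) \in S1 -> (x, next s x) \notin S2 ->
    ((next s x, next s (next s x)) \in S1) && ((next s x, next s (next s x)) \notin S2).
  move=> /andP[SD1 /forallP e1] /andP[SD2 /forallP e2] eX xs x1 x2.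
  have [o1 i1] := degD _ (next s x) SD1; have [o2 i2] := degD _ (next s x) SD2.
  move: (e1 (next s x)) (e2 (next s x)).
  rewrite o1 i1 o2 i2 eX prev_next // mem_next xs /= x1 (negbTE x2).
  exact: arith.
have all_cyc S1 S2 x : eulerian_sub D S1 -> eulerian_sub D S2 -> S1 :&: X = S2 :&: X ->
    x \in s -> (x, next s x) \in S1 -> (x, next s x) \notin S2 ->
    forall y, y \in s -> ((y, next s y) \in S1) && ((y, next s y) \notin S2).
  move=> e1 e2 eX xs x1 x2 y.
  rewrite -(fconnect_cycle (cycle_next us) xs) => /iter_findex <-.
  elim: (findex _ x y) => [|n /andP[IH1 IH2]]; first by rewrite x1 x2.
  rewrite iterS; apply: step => //.
  by elim: (n) => //= m IHm; rewrite mem_next.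
have e0 : eulerian_sub D set0.
  rewrite /eulerian_sub sub0set; apply/forallP => x.
  by apply/eqP/eq_card => a; rewrite !inE.
have ec : eulerian_sub D (cycle_arcs s).
  rewrite /eulerian_sub subsetUl; apply/forallP => x.
  have [-> ->] := degD _ x (subsetUl (cycle_arcs s) X).
  have -> : cycle_arcs s :&: X = set0.
    apply/setP => a; rewrite !inE; apply/negP => /andP[/andP[_ e] /hX/and4P[_ _ _]].
    by rewrite e.
  rewrite !inE /= eqxx mem_prev next_prev // eqxx !andbT.
  by apply/eqP; congr (_ + _); apply: eq_card => a; rewrite !inE.
have eqSX S1 S2 : eulerian_sub D S1 -> eulerian_sub D S2 -> S1 :&: X = S2 :&: X ->
   (forall y, y \in s -> ((y, next s y) \in S1) = ((y, next s y) \in S2)) -> S1 = S2.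
  move=> /andP[/subsetP SD1 _] /andP[/subsetP SD2 _] eX h; apply/setP => a.
  have : (a \in S1 :&: X) = (a \in S2 :&: X) by rewrite eX.
  rewrite !inE; case: (boolP (a \in X)) => [_|aX _].
    by rewrite !andbT.
  case: (boolP (a \in cycle_arcs s)) => [|ac].
    by case: a {aX} => x y; rewrite inE /= => /andP[xs /eqP ->]; apply: h.
  apply/idP/idP => [/SD1|/SD2]; by rewrite in_setU (negbTE aX) (negbTE ac).
have oddX S : eulerian_sub D S -> odd #|S| -> S :&: X != set0.
  move=> eS oS; apply: contraTneq oS => SX.
  case: (boolP [exists x in s, (x, next s x) \in S]) => [/exists_inP[x xs xS]|no].
    have -> : S = cycle_arcs s; last by rewrite card_cyc.
    have SX' : S :&: X = set0 :&: X by rewrite SX set0I.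
    have := all_cyc _ _ _ eS e0 SX' xs xS; rewrite inE => /(_ isT) h.
    apply: eqSX => //.
      rewrite SX; apply/setP => a; rewrite !inE; apply/esym/negP.
      move=> /andP[/andP[_ e] /hX/and4P[_ _ _]].
      by rewrite e.
    by move=> y ys; rewrite !inE ys eqxx /=; case/andP: (h y ys).
  have -> : S = set0; last by rewrite cards0.
  apply: eqSX => //; first by rewrite SX set0I.
  move=> y ys; rewrite inE; apply/negP => yS.
  by case/exists_inP: no; exists y.
rewrite -EE_neq_EO neq_ltn; apply/orP; right.
apply: (@leq_ltn_trans 1); last first.
  rewrite /EE; have <- : #|[set set0; cycle_arcs s]| = 2.
    rewrite cards2; suff -> : set0 != cycle_arcs s by [].
    by rewrite eq_sym -cards_eq0 card_cyc -lt0n.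
  apply: subset_leq_card; apply/subsetP => S; rewrite !inE => /orP[]/eqP->.
    by rewrite e0 cards0.
  by rewrite ec card_cyc.
apply/card_le1_eqP => S1 S2; rewrite !inE => /andP[e1 o1] /andP[e2 o2].
have SXX S : eulerian_sub D S -> odd #|S| -> S :&: X = X.
  move=> eS oS; apply/eqP; rewrite eqEcard subsetIr /=.
  by apply: (leq_trans X1); rewrite card_gt0; apply: oddX.
have eX : S1 :&: X = S2 :&: X by rewrite !SXX.
have notX S : eulerian_sub D S -> odd #|S| -> ~ forall y, y \in s -> (y, next s y) \notin S.
  move=> eS oS h; have /set0Pn[a] := oddX _ eS oS.
  rewrite inE => /andP[aS aX].
  have /andP[SD /forallP/(_ a.1) eSa] := eS.
  have [oa ia] := degD _ a.1 SD; have /and4P[a1s a2s ne _] := hX _ aX.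
  have h1 : (a.1, next s a.1) \notin S by apply: h.
  have h2 : (prev s a.1, a.1) \notin S.
    by have := h (prev s a.1); rewrite next_prev // mem_prev; apply.
  move: eSa; rewrite oa ia (negbTE h1) (negbTE h2) !andbF !add0n SXX //.
  have -> : indeg X a.1 = 0.
    apply/eqP; rewrite -leqn0 leqNgt; apply/negP => /indegP[y yX].
    have E : (y, a.1) = a by apply: (card_le1_eqP X1).
    by case/negP: ne; rewrite -[in a.2]E.
  have : 0 < outdeg X a.1 by apply/outdegP; exists a.2; case: (a) aX.
  by case: outdeg.
apply/esym/eqSX => // y ys.
case: (boolP ((y, next s y) \in S1)) => y1;
  case: (boolP ((y, next s y) \in S2)) => y2 //.
  have := all_cyc _ _ _ e1 e2 eX ys y1 y2 => h.
  by exfalso; apply: (notX _ e2 o2) => z /h /andP[].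
have := all_cyc _ _ _ e2 e1 (esym eX) ys y2 y1 => h.
by exfalso; apply: (notX _ e1 o1) => z /h /andP[].
Qed.

End SignedCounts.

(** * Reducible orientations in critical graphs *)

Section Adjacency.
Variable T : finType.
Implicit Types (G : sgraph T) (D A : {set T * T}) (B : {set T}) (x y z v : T).

Definition adj G x y := [set x; y] \in edges G.

Lemma adj_sym G : symmetric (adj G).
Proof. by move=> x y; rewrite /adj setUC. Qed.

Lemma adj_irr G x : adj G x x = false.
Proof. by apply/negP => /edgesP[_]; rewrite cards2 eqxx. Qed.

Lemma adj_neq G x y : adj G x y -> x != y.
Proof. by apply: contraTneq => ->; rewrite adj_irr. Qed.

Lemma adj_verts G x y : adj G x y -> x \in verts G.
Proof. by case/edgesP => /subsetP h _; apply: h; rewrite !inE eqxx. Qed.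

Lemma handshake G :
  \sum_(v in verts G) #|[set w | adj G v w]| = 2 * #|edges G|.
Proof.
pose A := [set a : T * T | adj G a.1 a.2].
have -> : \sum_(v in verts G) #|[set w | adj G v w]| = #|A|.
  rewrite -sum1_card (partition_big (fun a : T * T => a.1) (fun v => v \in verts G)) /=; last first.
    by move=> a; rewrite inE => /adj_verts.
  apply: eq_bigr => v _; rewrite sum1dep_card -(card_imset _ (fun _ _ => @id _)).
  have inj : injective (fun w : T => (v, w)) by move=> w1 w2 [].
  rewrite -(card_imset _ inj); congr #|pred_of_set _|.
  apply/setP => -[x w]; rewrite !inE /=; apply/imsetP/andP => [[w']|[xw /eqP e]].
    by rewrite imset_id inE => vw [-> ->]; rewrite vw eqxx.
  by exists w; rewrite ?imset_id ?inE -e.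
rewrite -sum1_card (partition_big (fun a : T * T => [set a.1; a.2]) (fun e => e \in edges G)) /=; last first.
  by move=> a; rewrite inE.
rewrite (eq_bigr (fun=> 2)); first by rewrite sum_nat_const mulnC.
move=> e eG; rewrite sum1dep_card.
have [_ /eqP/cards2P[x [y [xy ee]]]] := edgesP eG; subst e.
rewrite -(_ : #|[set (x, y); (y, x)]| = 2); last first.
  by rewrite cards2 xpair_eqE (negbTE xy).
congr #|pred_of_set _|; apply/setP => -[z t]; rewrite !inE /= !xpair_eqE.
apply/andP/orP => [[zt /eqP E]|]; last first.
  case=> /andP[/eqP-> /eqP->]; first by rewrite /adj eG.
  by rewrite adj_sym setUC.
have := adj_neq zt => znt.
have : z \in [set x; y] by rewrite -E !inE eqxx.
have : t \in [set x; y] by rewrite -E !inE eqxx orbT.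
rewrite !inE => /orP[]/eqP tE /orP[]/eqP zE; subst z t; rewrite ?eqxx; auto.
  by rewrite eqxx in znt.
by rewrite eqxx in znt.
Qed.

Definition induced_edgesP G B e : e \in [set e in edges G | e \subset B] ->
  e \subset verts G :&: B /\ #|e| = 2.
Proof.
by rewrite inE => /andP[/edgesP[eV e2] eB]; rewrite subsetI eV eB.
Qed.

Definition induced G B : sgraph T :=
  SGraph (@induced_edgesP G B).

Lemma adj_induced G B x y :
  adj (induced G B) x y = [&& x \in B, y \in B & adj G x y].
Proof.
rewrite /adj inE andbC; case: (boolP (_ \in edges G)); rewrite ?andbF ?andbT //.
by rewrite subUset !sub1set.
Qed.

Lemma induced_subgraph G B : subgraph (induced G B) G.
Proof.
apply/andP; split; first by rewrite /= subsetIl.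
by apply/subsetP => e; rewrite inE => /andP[].
Qed.

Definition orients (e : rel T) B D :=
  (forall x y, ((x, y) \in D) || ((y, x) \in D) = [&& x \in B, y \in B & e x y])
  /\ (forall x y, ~~ (((x, y) \in D) && ((y, x) \in D))).

Lemma orientationP G D : reflect (orients (adj G) setT D) (orientation G D).
Proof.
apply: (iffP forallP) => [h|[h1 h2] x].
  split=> x y; have /forallP/(_ y)/andP[/eqP h1 h2] := h x; last by [].
  by rewrite h1 !inE.
by apply/forallP => y; rewrite h1 h2 !inE eqxx.
Qed.

Lemma orients_induced G B D :
  orientation (induced G B) D -> orients (adj G) B D.
Proof.
move=> /orientationP[h1 h2]; split=> // x y.
by rewrite h1 !inE adj_induced.
Qed.

Lemma orients_degree (e : rel T) B D v : symmetric e ->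
  orients e B D -> v \in B ->
  outdeg D v + indeg D v = #|[set w in B | e v w]|.
Proof.
move=> sym [h1 h2] vB.
have -> : outdeg D v = #|[set w | (v, w) \in D]|.
  have inj : injective (fun w : T => (v, w)) by move=> w1 w2 [].
  rewrite -(card_imset _ inj); congr #|pred_of_set _|.
  apply/setP => -[x w]; rewrite !inE /=; apply/andP/imsetP => [[xw /eqP e']|[w' w'D [-> ->]]].
    by exists w; rewrite ?inE -e'.
  by rewrite inE in w'D; rewrite w'D.
have -> : indeg D v = #|[set w | (w, v) \in D]|.
  have inj : injective (fun w : T => (w, v)) by move=> w1 w2 [].
  rewrite -(card_imset _ inj); congr #|pred_of_set _|.
  apply/setP => -[w x]; rewrite !inE /=; apply/andP/imsetP => [[xw /eqP e']|[w' w'D [-> ->]]].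
    by exists w; rewrite ?inE -e'.
  by rewrite inE in w'D; rewrite w'D.
rewrite -cardsUI [X in _ + X](_ : _ = 0) ?addn0.
  congr #|pred_of_set _|; apply/setP => w; rewrite !inE.
  by have := h1 v w; rewrite vB /= => ->.
by apply: eq_card0 => w; rewrite !inE; apply/negbTE.
Qed.

Lemma orients_sub (e : rel T) B D a : orients e B D -> a \in D ->
  [&& a.1 \in B, a.2 \in B & e a.1 a.2].
Proof. by case: a => x y [h _] xy; rewrite -h xy. Qed.

End Adjacency.

Lemma signed_eul0 (T : finType) : signed_eul (set0 : {set T * T}) = 1%R.
Proof. by apply: (@signed_eul_acyclic _ _ (fun=> 0)) => a; rewrite inE. Qed.

Section Critical.
Variables (T : finType) (G : sgraph T) (k : nat).
Hypothesis Gcrit : AT_critical k G.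
Local Notation e := (adj G).
Local Notation deg v := #|[set w | adj G v w]|.
Implicit Types (D : {set T * T}) (A : {set T}) (v x y : T).

Lemma proper_orientation H : proper_subgraph H G ->
  exists D, [/\ orientation H D, signed_eul D != 0%R &
     forall v, v \in verts H -> outdeg D v + 2 <= k].
Proof.
move/Gcrit.2; rewrite /AT; case: ex_minnP => m /existsP[D /and3P[oD sD /forall_inP lD]] _ mk.
exists D; rewrite -EE_neq_EO; split=> // v /lD; lia.
Qed.

(** Edges between A and the rest leave A, so the glued orientation keeps the in-degrees of D on A
    and the out-degrees of the orientation of G - A elsewhere. All out-degrees are then at most k -
    2. *)
Lemma critical_irreducible A D :
    A != set0 -> A \subset verts G -> orients e A D -> signed_eul D != 0%R ->
    (forall v, v \in A -> deg v + 2 <= indeg D v + k) -> False.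
Proof.
move=> A0 AV oD sD dD.
have [|D2 [/orients_induced oD2 sD2 lD2]] := @proper_orientation (induced G (~: A)).
  rewrite /proper_subgraph induced_subgraph /=; apply/negP => /andP[/subsetP h _].
  case/set0Pn: A0 => v vA; have := h v (subsetP AV _ vA).
  by rewrite !inE vA andbF.
pose X : {set T * T} := [set a | [&& a.1 \in A, a.2 \notin A & e a.1 a.2]].
have sub1 a : a \in D -> (a.1 \in A) && (a.2 \in A).
  by move=> /(orients_sub oD) /and3P[-> ->].
have sub2 a : a \in D2 -> (a.1 \notin A) && (a.2 \notin A).
  by move=> /(orients_sub oD2) /and3P[]; rewrite !inE => -> ->.
have subX a : a \in X -> (a.1 \in A) && (a.2 \notin A).
  by rewrite inE => /and3P[-> ->].
have := signed_eul_glue sub1 sub2 subX; set E := _ :|: X => sE.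
have oE : orients e setT E.
  have c1 x y : (x \notin A) || (y \notin A) -> ((x, y) \in D) = false.
    by apply: contraTF => /sub1 /= /andP[-> ->].
  have c2 x y : (x \in A) || (y \in A) -> ((x, y) \in D2) = false.
    by apply: contraTF => /sub2 /= /andP[/negbTE -> /negbTE ->].
  split=> x y; rewrite /E !in_setU ![(_ \in X)]inE /= ?in_setT /=.
    have := oD.1 x y; have := oD2.1 x y; rewrite !in_setC (adj_sym G y x).
    case: (boolP (x \in A)) => xA; case: (boolP (y \in A)) => yA /=.
    + by rewrite (c2 x y) ?(c2 y x) ?xA ?yA //= !orbF.
    + by rewrite (c1 x y) ?(c1 y x) ?(c2 x y) ?(c2 y x) ?xA ?yA ?orbT //= orbF.
    + by rewrite (c1 x y) ?(c1 y x) ?(c2 x y) ?(c2 y x) ?xA ?yA ?orbT.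
    + by rewrite (c1 x y) ?(c1 y x) ?xA ?yA //= !orbF.
  have := oD.2 x y; have := oD2.2 x y.
  case: (boolP (x \in A)) => xA; case: (boolP (y \in A)) => yA /=.
  + by rewrite (c2 x y) ?(c2 y x) ?xA ?yA //= !orbF.
  + by rewrite (c1 x y) ?(c1 y x) ?(c2 x y) ?(c2 y x) ?xA ?yA ?orbT //= ?andbF.
  + by rewrite (c1 x y) ?(c1 y x) ?(c2 x y) ?(c2 y x) ?xA ?yA ?orbT.
  + by rewrite (c1 x y) ?(c1 y x) ?xA ?yA //= !orbF.
suff : f_AT G (fun=> k.-1).
  have := Gcrit.1; rewrite /AT; case: ex_minnP => m fm min_m mk h.
  have := min_m _ h; rewrite mk.
  (* The predecessor [k.-1] is smaller than k only for positive k; the degree condition at a vertex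
     of A gives k >= 2. *)
  have [v vA] := set0Pn _ A0; have := dD v vA.
  have := orients_degree (adj_sym G) oD vA.
  have : #|[set w in A | e v w]| <= deg v.
    by apply: subset_leq_card; apply/subsetP => w; rewrite !inE => /andP[].
  lia.
apply/existsP; exists E; apply/and3P; split.
- exact/orientationP.
- by rewrite EE_neq_EO sE mulf_neq0.
apply/forall_inP => v vV; case: (boolP (v \in A)) => vA.
  have := orients_degree (adj_sym G) oE (in_setT v).
  have -> : [set w in setT | e v w] = [set w | e v w].
    by apply/setP => w; rewrite !inE.
  have -> : indeg E v = indeg D v.
    congr #|pred_of_set _|; apply/setP => a; rewrite !inE.
    case: eqP => [ax|]; rewrite ?andbF // !andbT ax vA andbF orbF.
    by case: (boolP (a \in D2)) => [/sub2|]; rewrite ?orbF // ax vA andbF.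
  have := dD v vA; lia.
have -> : outdeg E v = outdeg D2 v.
  congr #|pred_of_set _|; apply/setP => a; rewrite !inE.
  case: eqP => [ax|]; rewrite ?andbF // !andbT ax (negbTE vA) orbF.
  by case: (boolP (a \in D)) => [/sub1|]; rewrite //= ax (negbTE vA).
have := lD2 v; rewrite !inE vA vV => /(_ isT); lia.
Qed.

Lemma min_degree v : v \in verts G -> k <= deg v + 1.
Proof.
move=> vV; rewrite leqNgt; apply/negP => lt.
apply: (@critical_irreducible [set v] set0); rewrite ?sub1set ?signed_eul0 ?oner_neq0 //.
- by apply/set0Pn; exists v; rewrite inE.
- split=> x y; rewrite !inE //=; apply/esym/negP => /and3P[/eqP-> /eqP->].
  by rewrite adj_irr.
by move=> x; rewrite inE => /eqP ->; lia.
Qed.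

Hypothesis GnotK : ~ is_complete_graph k G.
Hypothesis k4 : 3 < k.

(** The clique is a proper subgraph, so it has an orientation with nonzero signed count and
    out-degrees at most k - 2, hence in-degrees at least 1. Only y may need in-degree 2. Some vertex
    z has it, since otherwise the number of arcs would be k counted by heads and k(k - 2) counted by
    tails; and exchanging y and z is an automorphism of the clique. *)
Lemma no_clique A y :
    A \subset verts G -> {in A &, forall x z, x != z -> e x z} -> #|A| = k ->
    y \in A -> deg y <= k -> (forall v, v \in A -> v != y -> deg v < k) -> False.
Proof.
move=> AV cl cA yA dy dA.
have [|D [/orients_induced oD sD lD]] := @proper_orientation (induced G A).
  rewrite /proper_subgraph induced_subgraph /=; apply/negP => /andP[VA _].
  apply: GnotK; rewrite /is_complete_graph; have -> : verts G = A.
    by apply/eqP; rewrite eqEsubset AV (subset_trans VA) // subsetIr.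
  by split.
have vert v : v \in A -> v \in verts (induced G A).
  by move=> vA; rewrite inE vA (subsetP AV).
have degA v : v \in A -> outdeg D v + indeg D v = k.-1.
  move=> vA; rewrite (orients_degree (adj_sym G) oD vA) -cA (cardsD1 v A) vA.
  congr #|pred_of_set _|; apply/setP => w; rewrite !inE.
  case: eqP => [->|/eqP wv]; first by rewrite adj_irr andbF.
  by case: (boolP (w \in A)) => //= wA; apply: cl; rewrite // eq_sym.
have in1 v : v \in A -> 1 <= indeg D v.
  by move=> vA; have := degA v vA; have := lD v (vert v vA); lia.
have [z zA z2] : exists2 z, z \in A & 2 <= indeg D z.
  apply/exists_inP; apply: contraT => /exists_inPn no.
  have inx v : v \in A -> indeg D v = 1.
    by move=> vA; have := no v vA; have := in1 v vA; lia.
  have sumD : forall p : T * T -> T, (forall a, a \in D -> p a \in A) ->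
     \sum_(v in A) #|[set a in D | p a == v]| = #|D|.
    move=> p hp; rewrite -sum1_card (partition_big p (fun v => v \in A)) //=.
    by apply: eq_bigr => v _; rewrite sum1dep_card.
  have h1 := sumD (fun a => a.1) (fun a aD => proj1 (andP (orients_sub oD aD))).
  have h2 : \sum_(v in A) indeg D v = #|D|.
    apply: (sumD (fun a => a.2)) => a /(orients_sub oD) /and3P[_ -> _] //.
  have h3 : \sum_(v in A) indeg D v = k.
    by rewrite (eq_bigr (fun=> 1) inx) sum1_card.
  have h4 : \sum_(v in A) outdeg D v = k * (k - 2).
    rewrite (eq_bigr (fun=> k - 2)); last first.
      by move=> v vA; have := degA v vA; rewrite inx //; lia.
    by rewrite sum_nat_const cA.
  have : k * (k - 2) = k by rewrite -h4 -h3 h2 -h1.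
  by move: k4; nia.
pose f x := if x == y then z else if x == z then y else x.
have fK : involutive f.
  move=> x; rewrite /f; case: (x =P y) => [->|xy].
    by rewrite eqxx; case: eqP => [->|].
  case: (x =P z) => [->|xz]; first by rewrite eqxx.
  by case: (x =P y) => // _; case: (x =P z).
have fA x : (f x \in A) = (x \in A).
  by rewrite /f; case: (x =P y) => [->|_]; [|case: (x =P z) => [->|//]]; rewrite yA zA.
apply: (@critical_irreducible A (swap_arcs f D)); rewrite ?signed_eul_swap //.
- by apply/set0Pn; exists y.
- split=> x w; rewrite !inE /=; last exact: oD.2.
  rewrite oD.1 !fA; case: (boolP (x \in A)) => //= xA; case: (boolP (w \in A)) => //= wA.
  case: (eqVneq x w) => [->|xw]; first by rewrite !adj_irr.
  by rewrite !cl // ?fA // (inj_eq (inv_inj fK)).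
move=> v vA; rewrite indeg_swap //.
case: (eqVneq v y) => [->|vy]; first by rewrite /f eqxx; lia.
have := dA v vA vy; have := in1 (f v); rewrite fA => /(_ vA); lia.
Qed.

Lemma next_next (s : seq T) x : uniq s -> 2 < size s -> x \in s ->
  next s (next s x) != x.
Proof.
move=> us s2 /rot_to[i s' E]; rewrite -!(next_rot i us) E.
have : uniq (x :: s') by rewrite -E rot_uniq.
have : 2 < size (x :: s') by rewrite -E size_rot.
case: s' {E} => [|a [|b r]] //= _ /andP[].
rewrite !inE !negb_or eqxx => /and3P[xa xb _] /andP[/andP[ab _] _].
by rewrite [a == x]eq_sym (negbTE xa) eqxx eq_sym.
Qed.

(** The cyclic orientation gives every vertex the in-degree 1 that a low vertex needs. The vertices
    x and y are the ends of the one permitted chord; x = y encodes that there is none. *)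
Lemma no_even_cycle (s : seq T) x y :
    ucycle e s -> 3 < size s -> ~~ odd (size s) ->
    (forall v, v \in s -> deg v < k) -> x \in s -> y \in s ->
    {in s &, forall z t, e z t ->
       [|| t == next s z, z == next s t, (z == x) && (t == y)
         | (z == y) && (t == x)]} -> False.
Proof.
case/andP=> cs us s3 evs ds xs ys chord.
pose X : {set T * T} :=
  if [&& e y x, x != next s y & y != next s x] then [set (y, x)] else set0.
pose D := cycle_arcs s :|: X.
have XP a : a \in X -> [/\ a = (y, x), e y x, x != next s y & y != next s x].
  by rewrite /X; case: ifP => [/and3P[yx n1 n2]|_]; rewrite inE // => /eqP.
have hX a : a \in X ->
      [&& a.1 \in s, a.2 \in s, a.2 != a.1 & a.2 != next s a.1].
  move=> /XP[-> yx n1 _] /=; rewrite ys xs n1 andbT /=.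
  by apply: contraTneq yx => ->; rewrite adj_irr.
have X1 : #|X| <= 1 by rewrite /X; case: ifP; rewrite ?cards1 ?cards0.
have nn z : z \in s -> next s (next s z) != z by apply: next_next => //; lia.
have en z : z \in s -> e z (next s z) by apply: next_cycle.
apply: (@critical_irreducible [set v in s] D).
- by apply/set0Pn; exists x; rewrite inE.
- apply/subsetP => v; rewrite inE => vs; exact: (adj_verts (en v vs)).
- split=> z t; rewrite ?in_setU ![(_ \in cycle_arcs _)]inE /=; last first.
    apply/negP => /andP[] /orP[/andP[zs /eqP tE]|/XP[[zE tE] yx n1 n2]] /orP[/andP[ts /eqP zE']|/XP[[tE' zE'] yx' n1' n2']].
    + by have := nn z zs; rewrite -tE -zE' eqxx.
    + by move: n2'; rewrite -zE' -tE' tE eqxx.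
    + by move: n2; rewrite -zE -tE zE' eqxx.
    + by move: yx; rewrite -zE zE' adj_irr.
  rewrite !inE; apply/idP/and3P => [|[zs ts zt]].
    case/orP => /orP[/andP[zs /eqP ->]|/XP[[-> ->] yx _ _]].
    + by rewrite mem_next zs en.
    + by rewrite ys xs yx.
    + by rewrite mem_next zs adj_sym en.
    + by rewrite ys xs adj_sym yx.
  have := chord z t zs ts zt; rewrite zs ts /=.
  case: (boolP (t == next s z)) => //= n1; case: (boolP (z == next s t)) => //= n2.
    by rewrite orbT.
  case/orP => /andP[/eqP zE /eqP tE]; subst z t; rewrite /X.
    by rewrite adj_sym zt n1 n2 !inE eqxx !orbT.
  by rewrite zt n1 n2 !inE eqxx.
- by apply: signed_eul_even_cycle => //; lia.
move=> v; rewrite inE => vs; have := ds v vs.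
have : 0 < indeg D v.
  apply/indegP; exists (prev s v); rewrite in_setU inE /=.
  by rewrite mem_prev vs next_prev // eqxx.
lia.
Qed.

End Critical.

(** * Cycles of low vertices *)

Section Cycles.
Variables (T : eqType) (e : rel T).
Hypotheses (e_sym : symmetric e) (e_irr : irreflexive e).
Implicit Types (s p : seq T) (x y z t a b c : T).

Definition clique s := {in s &, forall x y, x != y -> e x y}.
(** Used for cycles, where each vertex already sees its two cycle neighbours, so that at most two
    means no chord. *)
Definition chordless s := {in s, forall x, count (e x) s <= 2}.

Lemma clique_perm s s' : s =i s' -> clique s -> clique s'.
Proof. by move=> E cl x y; rewrite -!E; apply: cl. Qed.

Lemma chordless_perm s s' : perm_eq s s' -> chordless s -> chordless s'.
Proof. by move=> E h x; rewrite -(perm_mem E) => /h; rewrite (permP E). Qed.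

Lemma chordless3 s x a b c : chordless s -> x \in s ->
  [&& a \in s, b \in s & c \in s] -> [&& e x a, e x b & e x c] ->
  [&& a != b, a != c & b != c] -> False.
Proof.
move=> h xs /and3P[as_ bs cs] /and3P[xa xb xc] /and3P[ab ac bc].
have : size [:: a; b; c] <= size [seq z <- s | e x z].
  apply: uniq_leq_size; first by rewrite /= !inE negb_or ab ac bc.
  by move=> z; rewrite !inE mem_filter => /or3P[]/eqP->; rewrite ?as_ ?bs ?cs ?xa ?xb ?xc.
by rewrite size_filter leqNgt ltnS h.
Qed.

Lemma edge_neq x y : e x y -> x != y.
Proof. by apply: contraTneq => ->; rewrite e_irr. Qed.

Lemma next_cat u v z t : uniq (u ++ z :: t :: v) -> next (u ++ z :: t :: v) z = t.
Proof.
move=> us; have E := rot_size_cat u (z :: t :: v).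
by rewrite -(next_rot (size u) us) E /= eqxx.
Qed.

Lemma next_neq_prev s x : uniq s -> 2 < size s -> x \in s -> next s x != prev s x.
Proof.
move=> us s2 xs; apply/eqP => np; have := next_prev us x; rewrite -np.
case: (rot_to xs) => i s' E; rewrite -!(next_rot i us) E.
have : uniq (x :: s') by rewrite -E rot_uniq.
have : 2 < size (x :: s') by rewrite -E size_rot.
case: s' {E} => [|a [|b r]] //= _ /andP[].
rewrite !inE !negb_or eqxx => /and3P[xa xb _] /andP[/andP[ab _] _].
by rewrite [a == x]eq_sym (negbTE xa) eqxx => bx; rewrite bx eqxx in xb.
Qed.

Lemma cycle_split x p1 y p2 : cycle e (x :: p1 ++ y :: p2) =
  path e x (rcons p1 y) && path e y (rcons p2 x).
Proof. by rewrite /= rcons_cat -cat_rcons cat_path last_rcons. Qed.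

Lemma path_rev x p y : path e x (rcons p y) -> path e y (rcons (rev p) x).
Proof.
have := rev_path e x (rcons p y); rewrite last_rcons belast_rcons rev_cons => ->.
by under eq_path => a b do rewrite e_sym.
Qed.

Lemma rcons_nbr x p y : path e x (rcons p y) ->
  exists2 z, e x z & z \in rcons p y.
Proof.
case: p => [|z p] /= /andP[xz _]; first by exists y; rewrite ?inE.
by exists z; rewrite ?inE ?eqxx.
Qed.

Section ThetaNext.
Variables (x y : T) (p1 p2 : seq T).
Local Notation C := (x :: p1 ++ y :: p2).
Hypotheses (cyc : cycle e C) (unq : uniq C).
Hypothesis few1 : chordless (x :: rcons p1 y).

(** Both cycle neighbours of a vertex z of [p1] lie on the half x, [p1], y; any other neighbour
    there would be a third one in a chordless list. *)
Lemma theta_next z t : p2 != [::] ->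
  z \in p1 -> t \in x :: rcons p1 y -> e z t -> (t == next C z) || (z == next C t).
Proof.
move=> p20 zp tC zt; have zC : z \in C by rewrite inE mem_cat zp orbT.
have [q1 [q2 E]] : exists q1, exists q2, p1 = q1 ++ z :: q2.
  by case/splitPr: zp => q1 q2; exists q1, q2.
have CE : C = (x :: q1) ++ z :: (q2 ++ y :: p2) by rewrite E /= -catA.
have zC1 : z \in x :: rcons p1 y by rewrite inE mem_rcons inE zp !orbT.
have nC : next C z \in x :: rcons p1 y.
  rewrite CE; case: q2 E CE => [|a q2] E CE.
    by rewrite next_cat -?CE // inE mem_rcons mem_head orbT.
  by rewrite next_cat -?CE // E !(inE, mem_rcons, mem_cat) eqxx !orbT.
have pC : prev C z \in x :: rcons p1 y.
  case/lastP: q1 E CE => [|q1 a] E CE.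
    have <- : next C x = z by move: unq; rewrite CE; apply: (@next_cat [::]).
    by rewrite prev_next // mem_head.
  rewrite cat_cons cat_rcons in CE.
  have <- : next C a = z by move: unq; rewrite CE; apply: (@next_cat (x :: q1)).
  by rewrite prev_next // E !(inE, mem_rcons, mem_cat) eqxx !orbT.
have npz : next C z != prev C z.
  apply: next_neq_prev => //; rewrite /= size_cat /=.
  by move: p20; rewrite -size_eq0; nlia.
case: (eqVneq t (next C z)) => // tn.
have [tp|tp] := eqVneq t (prev C z); first by rewrite tp next_prev // eqxx orbT.
exfalso; apply: (chordless3 few1 zC1 (a := t) (b := next C z) (c := prev C z)).
- by rewrite tC nC pC.
- by rewrite zt (next_cycle cyc zC) e_sym (prev_cycle cyc zC).
- by rewrite tn tp npz.
Qed.

End ThetaNext.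

Section CliqueOrOdd.
Variable L : {pred T}.
Hypothesis no_even : forall s x y,
    ucycle e s -> 3 < size s -> ~~ odd (size s) -> {subset s <= L} ->
    x \in s -> y \in s ->
    {in s &, forall z t, e z t ->
       [|| t == next s z, z == next s t, (z == x) && (t == y)
         | (z == y) && (t == x)]} -> False.

Lemma no_even_chordless s : ucycle e s -> 3 < size s -> ~~ odd (size s) ->
  {subset s <= L} -> chordless s -> False.
Proof.
case: s => [|x s] // us s3 evs sL few.
(* There is no chord at all, so both of its ends are taken to be x. *)
apply: (no_even us s3 evs sL (mem_head x s) (mem_head x s)) => z t zs ts zt.
have [cs uns] := andP us.
case: (eqVneq t (next (x :: s) z)) => // tn.
have [->|tp] := eqVneq t (prev (x :: s) z); first by rewrite next_prev // eqxx !orbT.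
exfalso; apply: (chordless3 few zs (a := t) (b := next (x :: s) z) (c := prev (x :: s) z)).
- by rewrite ts mem_next mem_prev zs.
- by rewrite zt (next_cycle cs zs) e_sym (prev_cycle cs zs).
by rewrite tn tp next_neq_prev //; nlia.
Qed.

(** If both halves are chordless and no edge joins their interiors, the only chord left is xy, and
    the even cycle is excluded. *)
Lemma no_even_theta x p1 y p2 :
    ucycle e (x :: p1 ++ y :: p2) -> {subset x :: p1 ++ y :: p2 <= L} ->
    p1 != [::] -> p2 != [::] -> ~~ odd (size (x :: p1 ++ y :: p2)) ->
    chordless (x :: rcons p1 y) -> chordless (x :: y :: p2) ->
    (forall a b, a \in p1 -> b \in p2 -> ~~ e a b) -> False.
Proof.
set C := x :: _ => uC CL p10 p20 evC few1 few2 noab; have [cC uC'] := andP uC.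
have rotC : rot (size (x :: p1)) C = y :: p2 ++ x :: p1.
  by rewrite /C -cat_cons rot_size_cat.
have few2' : chordless (y :: rcons p2 x).
  apply: chordless_perm few2.
  by rewrite (perm_catCA [:: x] [:: y]) perm_cons -cats1 perm_sym perm_catC.
have cC' : cycle e (y :: p2 ++ x :: p1) by rewrite -rotC rot_cycle.
have uC'' : uniq (y :: p2 ++ x :: p1) by rewrite -rotC rot_uniq.
have nC' z : next (y :: p2 ++ x :: p1) z = next C z by rewrite -rotC next_rot.
have c1 z t : z \in p1 -> t \in x :: rcons p1 y -> e z t -> (t == next C z) || (z == next C t).
  exact: theta_next.
have c2 z t : z \in p2 -> t \in y :: rcons p2 x -> e z t -> (t == next C z) || (z == next C t).
  by rewrite -!nC'; apply: theta_next.
have xC : x \in C by rewrite mem_head.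
have yC : y \in C by rewrite !(inE, mem_cat) eqxx !orbT.
have sz : 3 < size C.
  by move: p10 p20; rewrite /C /= size_cat /= -!size_eq0; nlia.
apply: (no_even uC sz evC CL xC yC) => z t zC tC zt.
have key z' t' : z' \in p1 ++ p2 -> t' \in C -> e z' t' -> (t' == next C z') || (z' == next C t').
  rewrite mem_cat => /orP[] zp.
    rewrite /C inE mem_cat inE => tE zt'; apply: c1 => //.
    case: (boolP (t' \in p2)) => [tp|ntp]; first by have := noab _ _ zp tp; rewrite zt'.
    by move: tE; rewrite (negbTE ntp) orbF inE mem_rcons inE [(_ == y) || _]orbC.
  rewrite /C inE mem_cat inE => tE zt'; apply: c2 => //.
  case: (boolP (t' \in p1)) => [tp|ntp]; first by have := noab _ _ tp zp; rewrite e_sym zt'.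
  by move: tE; rewrite (negbTE ntp) /= inE mem_rcons inE orbCA.
case: (boolP (z \in p1 ++ p2)) => [zp|nz].
  by case/orP: (key _ _ zp tC zt) => ->; rewrite ?orbT.
case: (boolP (t \in p1 ++ p2)) => [tp|nt].
  by rewrite e_sym in zt; case/orP: (key _ _ tp zC zt) => ->; rewrite ?orbT.
have memC v : v \in C -> v \notin p1 ++ p2 -> (v == x) || (v == y).
  rewrite /C inE !mem_cat inE negb_or => /or3P[->|->|/orP[->|->]] //.
  - by rewrite orbT.
  - by rewrite andbF.
have zx := memC z zC nz; have tx := memC t tC nt.
case/orP: zx => /eqP zE; case/orP: tx => /eqP tE; subst z t; rewrite ?eqxx ?orbT //.
  by rewrite e_irr in zt.
by rewrite e_irr in zt.
Qed.

Definition clique_or_odd s := clique s \/ (chordless s /\ odd (size s)).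

(* Induction on the length of a cycle, split at a chord xy into two shorter
   cycles. If one of them is a clique, it absorbs the other one. Otherwise a
   chord crossing xy yields two more short cycles, one of which is even, hence
   a clique, and this contradicts the chordlessness of the first two. *)
Section Step.
Variable n : nat.
Hypothesis IH : forall s, size s < n -> 2 < size s -> ucycle e s ->
  {subset s <= L} -> clique_or_odd s.

Lemma IH_clique s : size s < n -> 2 < size s -> cycle e s -> uniq s ->
    {subset s <= L} ->
  (exists x a b c, [/\ x \in s, [&& a \in s, b \in s & c \in s],
    [&& e x a, e x b & e x c] & [&& a != b, a != c & b != c]]) ->
  clique s.
Proof.
move=> sn s2 cs us sL [x [a [b [c [xs sabc xabc nabc]]]]].
have [] // := IH sn s2 _ sL; first by rewrite /ucycle cs.
by case=> few _; case: (chordless3 few xs sabc xabc nabc).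
Qed.

(** A cycle of length n with a chord xy, cut open at x so that the chord separates [p1] from
    [p2]. *)
Definition theta x p1 y p2 :=
  [/\ size (x :: p1 ++ y :: p2) = n, ucycle e (x :: p1 ++ y :: p2),
      {subset x :: p1 ++ y :: p2 <= L}, e x y & (p1 != [::]) && (p2 != [::])].

Lemma theta_rot x p1 y p2 : theta x p1 y p2 -> theta y p2 x p1.
Proof.
case=> sz uC sL xy /andP[p10 p20].
have E : y :: p2 ++ x :: p1 = rot (size (x :: p1)) (x :: p1 ++ y :: p2).
  by rewrite -cat_cons rot_size_cat.
rewrite /theta E size_rot /ucycle rot_cycle rot_uniq; split=> //.
- by move=> z; rewrite mem_rot; apply: sL.
- by rewrite e_sym.
- by rewrite p10 p20.
Qed.

Lemma theta_rot_mem x p1 y p2 : y :: p2 ++ x :: p1 =i x :: p1 ++ y :: p2.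
Proof. by move=> z; rewrite -[RHS](mem_rot (size (x :: p1))) -cat_cons rot_size_cat. Qed.

Lemma theta_facts x p1 y p2 : theta x p1 y p2 ->
  [/\ path e x (rcons p1 y), path e y (rcons p2 x), size p1 + size p2 + 2 = n &
   [/\ x != y, (x \notin p1) && (x \notin p2), (y \notin p1) && (y \notin p2),
      uniq p1 && uniq p2 & {in p1 & p2, forall a b, a != b}]].
Proof.
case=> sz /andP[cC uC] _ xy _; move: cC; rewrite cycle_split => /andP[P1 P2].
split=> //; first by rewrite -sz /= size_cat /=; nlia.
move: uC; rewrite /= mem_cat inE !negb_or cat_uniq /= negb_or.
move=> /andP[/and3P[-> -> ->] /and3P[-> /andP[-> dis] /andP[-> ->]]]; split=> //.
move=> a b ap bp; apply: contraTneq bp => <-; apply/negP => ap2.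
by case/hasP: dis; exists a.
Qed.

Lemma clique_merge x p1 y p2 z : z \in p1 ->
  clique (x :: rcons p1 y) -> {in p1, forall z, clique (x :: z :: y :: p2)} ->
  clique (x :: p1 ++ y :: p2).
Proof.
move=> zp c1 c2 u v.
have mem1 w : (w \in x :: p1 ++ y :: p2) =
    (w \in x :: rcons p1 y) || (w \in p2).
  rewrite !(inE, mem_cat, mem_rcons).
  by case: (w == x); case: (w \in p1); case: (w == y).
rewrite !mem1 => /orP[u1|u2] /orP[v1|v2] uv.
- exact: c1.
- case: (boolP (u \in p1)) => up; last first.
    apply: (c2 z zp) => //; rewrite !inE ?v2 ?orbT //.
    by move: u1; rewrite inE mem_rcons inE (negbTE up) orbF => /orP[]->; rewrite ?orbT.
  by apply: (c2 u up) => //; rewrite !inE ?v2 ?eqxx ?orbT.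
- case: (boolP (v \in p1)) => vp; last first.
    apply: (c2 z zp) => //; rewrite !inE ?u2 ?orbT //.
    by move: v1; rewrite inE mem_rcons inE (negbTE vp) orbF => /orP[]->; rewrite ?orbT.
  by apply: (c2 v vp) => //; rewrite !inE ?u2 ?eqxx ?orbT.
- by apply: (c2 z zp) => //; rewrite !inE ?u2 ?v2 ?orbT.
Qed.

(** Each z in [p1] can stand in for the whole of [p1]: the cycle x, z, y, [p2] is shorter, and x has
    the three neighbours z, y and the last vertex of [p2] on it, so it is a clique. *)
Lemma theta_clique x p1 y p2 : theta x p1 y p2 -> 1 < size p1 ->
  clique (x :: rcons p1 y) -> clique (x :: p1 ++ y :: p2).
Proof.
move=> th sp1 c1.
have [P1 P2 sz [xney /andP[x1 x2] /andP[y1 y2] /andP[u1 u2] dis]] := theta_facts th.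
have [_ _ sL xy /andP[_ p20]] := th.
have [z0 z0p] : exists z0, z0 \in p1.
  by case: (p1) sp1 => [|z0 p] // _; exists z0; rewrite mem_head.
apply: (clique_merge z0p) => // z zp.
have xz : e x z.
  by apply: c1; rewrite ?inE ?eqxx ?mem_rcons ?inE ?zp ?orbT //; apply: contraNneq x1 => ->.
have zney : z != y by apply: contraNneq y1 => <-.
have zy : e z y by apply: c1; rewrite ?inE ?mem_rcons ?inE ?zp ?eqxx ?orbT.
have zp2 : z \notin p2 by apply/negP => zp2; have := dis z z zp zp2; rewrite eqxx.
apply: IH_clique.
- by move: sz => /=; nlia.
- by [].
- by rewrite /= xz zy.
- by rewrite /= !inE !negb_or (edge_neq xz) xney x2 zney zp2 y2.
- move=> v vin; apply: sL; move: vin; rewrite !(inE, mem_cat).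
  by case/or4P => [->|/eqP->|->|->]; rewrite ?zp ?orbT.
case/lastP: p2 p20 P2 dis y2 zp2 {sL th sz x2 u2} => [|p2 b] // _.
rewrite rcons_path last_rcons => /andP[_ bx] dis.
rewrite !mem_rcons !inE !negb_or => /andP[yb _] /andP[zb _].
exists x, z, y, b; split; rewrite ?mem_head //.
- by rewrite !(inE, mem_rcons) !eqxx !orbT.
- by rewrite xz xy e_sym bx.
- by rewrite zney zb yb.
Qed.

(** If the half x, y, [p2] is a clique on at least four vertices, it absorbs z. If it is a chordless
    odd cycle, the whole cycle is even, so xy is not its only chord and z has a neighbour b in [p2].
    This completes the clique when [p2] is a single vertex and leads to a forbidden chord
    otherwise. *)
Lemma theta_triangle x z y p2 : theta x [:: z] y p2 -> clique (x :: z :: y :: p2).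
Proof.
move=> th.
have [P1 P2 sz [xney /andP[x1 x2] /andP[y1 y2] /andP[u1 u2] dis]] := theta_facts th.
have [_ uC sL xy /andP[_ p20]] := th.
have [xz zy] : e x z /\ e z y by move: P1 => /= /and3P[-> -> _].
have zney : z != y := edge_neq zy.
have zp2 : z \notin p2.
  by apply/negP => zp2; have := dis z z (mem_head _ _) zp2; rewrite eqxx.
have few1 : chordless (x :: rcons [:: z] y).
  by move=> v; rewrite !inE => /or3P[]/eqP->; rewrite /= e_irr ?addn0 ?add0n;
    case: (e _ _); case: (e _ _).
have theta2 : chordless (x :: y :: p2) -> odd (size p2) ->
   exists2 b, b \in p2 & e z b.
  move=> few2 op2; case: (boolP (has (e z) p2)) => [/hasP[b bp zb]|/hasPn no].
    by exists b.
  exfalso; apply: (no_even_theta uC sL _ p20 _ few1 few2) => //=; first by rewrite op2.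
  by move=> a b; rewrite inE => /eqP-> /no.
case: (ltngtP (size p2) 1) => [|sp2|sp2].
- by rewrite ltnS leqn0 size_eq0 (negbTE p20).
- have [] : clique_or_odd (x :: y :: p2).
  + apply: IH => /=; [by move: sz => /=; nlia|by nlia| |].
      by rewrite /ucycle /= xy P2 !inE negb_or xney x2 y2.
    move=> v vin; apply: sL; move: vin; rewrite !(inE, mem_cat).
    by case/or3P => ->; rewrite ?orbT.
  + move=> c2; apply: clique_perm (theta_rot_mem x [:: z] y p2) _.
    apply: theta_clique (theta_rot th) sp2 _.
    apply: clique_perm c2 => v; rewrite !(inE, mem_rcons).
    by case: (v == x); case: (v == y).
  case=> few2 /=; rewrite negbK => op2.
  have [b bp zb] := theta2 few2 op2.
  have [q1 [q2 E]] : exists q1, exists q2, p2 = q1 ++ b :: q2.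
    by case/splitPr: bp => q1 q2; exists q1, q2.
  have [P3 P4] : path e y (rcons q1 b) /\ path e b (rcons q2 x).
    by move: P2; rewrite E rcons_cat -cat_rcons cat_path last_rcons => /andP.
  have xin : x \in x :: y :: p2 by rewrite mem_head.
  have yin : y \in x :: y :: p2 by rewrite !inE eqxx orbT.
  have bin : b \in x :: y :: p2 by rewrite !inE bp !orbT.
  have yb : y != b by apply: contraNneq y2 => ->.
  have xb : x != b by apply: contraNneq x2 => ->.
  have zneb : z != b by apply: contraNneq zp2 => ->.
  (* If b is the last vertex of [p2], then z, y, x, b is a 4-cycle on which x sees the three others;
     otherwise z, x, y, [q1], b is shorter than the whole cycle and y has three neighbours on it.
     Either one is a clique, and provides the chord yb or xb of the chordless half. *)
  exfalso; case: (eqVneq q2 [::]) => q20.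
    have bx : e b x by move: P4; rewrite q20 /= andbT.
    case: q1 => [|h q1] in E P3; first by rewrite E q20 in sp2.
    have hin : h \in p2 by rewrite E inE eqxx.
    have yh : e y h by move: P3 => /= /andP[].
    have hb : h != b.
      by move: u2; rewrite E /= mem_cat inE !negb_or => /andP[/and3P[]].
    have c6 : clique [:: z; y; x; b].
      apply: IH_clique => //=.
      - by rewrite -sz E /= size_cat /=; nlia.
      - by rewrite zy e_sym xy e_sym bx e_sym zb.
      - by rewrite !inE !negb_or zney (eq_sym z x) (edge_neq xz) zneb (eq_sym y x) xney yb xb.
      - move=> v; rewrite !inE => vin; apply: sL; rewrite !(inE, mem_cat).
        by case/or4P: vin => /eqP->; rewrite ?eqxx ?bp ?orbT.
      exists x, z, y, b; rewrite !inE !eqxx !orbT xz xy e_sym bx zney zneb yb.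
      by [].
    apply: (chordless3 few2 yin (a := x) (b := h) (c := b)).
    + by rewrite xin bin !inE hin !orbT.
    + rewrite e_sym xy yh c6 ?inE ?eqxx ?orbT //.
    + rewrite xb hb andbT; apply/andP; split=> //.
      by apply: contraNneq x2 => ->.
  have c5 : clique (z :: x :: y :: rcons q1 b).
    apply: IH_clique => //=.
    - by rewrite -sz E /= !size_rcons !size_cat /=; move: q20; rewrite -size_eq0; nlia.
    - by rewrite e_sym xz xy rcons_path P3 last_rcons e_sym.
    - move: u2 y2 x2 zp2; rewrite E !(mem_cat, inE, mem_rcons, cat_uniq, rcons_uniq) /= !negb_or.
      move=> /and3P[-> /andP[-> _] _] /and3P[-> -> _] /and3P[-> -> _] /and3P[-> -> _].
      by rewrite zney xney eq_sym (edge_neq xz).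
    - move=> v vin; apply: sL; move: vin; rewrite E !(inE, mem_cat, mem_rcons).
      by case/or4P => [->|->|->|/orP[->|->]]; rewrite ?orbT.
    have [h yh hin] := rcons_nbr P3.
    have hp2 : h \in p2.
      by move: hin; rewrite E !(mem_cat, mem_rcons, inE) => /orP[]->; rewrite ?orbT.
    exists y, x, z, h; split.
    + by rewrite !inE eqxx !orbT.
    + by rewrite !inE !eqxx hin !orbT.
    + by rewrite e_sym xy e_sym zy.
    + rewrite (edge_neq xz) /=; apply/andP; split.
        by apply: contraNneq x2 => ->.
      by apply: contraNneq zp2 => ->.
  case/lastP: q2 q20 E P4 => [|q2 l] // _ E.
  rewrite rcons_path last_rcons => /andP[_ lx].
  have lp2 : l \in p2 by rewrite E !(mem_cat, inE, mem_rcons) eqxx !orbT.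
  apply: (chordless3 few2 xin (a := y) (b := b) (c := l)).
  + by rewrite yin bin !inE lp2 !orbT.
  + rewrite xy (e_sym x l) lx c5 ?inE ?mem_rcons ?inE ?eqxx ?orbT //.
  + rewrite yb /=; apply/andP; split; first by apply: contraNneq y2 => ->.
    by move: u2; rewrite E cat_uniq /= mem_rcons inE !negb_or => /and3P[_ _ /andP[/andP[-> _]]].
case: p2 sp2 => [|b [|]] // _ in th P2 sz x2 y2 u2 dis uC sL p20 zp2 theta2 *.
have [yb bx] : e y b /\ e b x by move: P2 => /= /and3P[-> -> _].
have [|b' ] := theta2 _ isT.
  by move=> v; rewrite !inE => /or3P[]/eqP->; rewrite /= e_irr ?addn0 ?add0n;
    case: (e _ _); case: (e _ _).
rewrite inE => /eqP-> zb.
move=> u v; rewrite !inE => /or4P[]/eqP-> /or4P[]/eqP->; rewrite ?eqxx //;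
by rewrite e_sym.
Qed.

Definition odd_theta x p1 y p2 :=
  [/\ chordless (x :: rcons p1 y), chordless (x :: y :: p2),
      odd (size p1) /\ 2 < size p1 & odd (size p2) /\ 2 < size p2].

Lemma theta_cases x p1 y p2 : theta x p1 y p2 ->
  clique (x :: p1 ++ y :: p2) \/ odd_theta x p1 y p2.
Proof.
move=> th.
have [P1 P2 sz [xney /andP[x1 x2] /andP[y1 y2] /andP[u1 u2] dis]] := theta_facts th.
have [_ uC sL xy /andP[p10 p20]] := th.
have th' := theta_rot th.
have toC : clique (y :: p2 ++ x :: p1) -> clique (x :: p1 ++ y :: p2).
  exact: clique_perm (theta_rot_mem _ _ _ _).
have size1 (p : seq T) : size p = 1 -> exists z, p = [:: z].
  by case: p => [|z [|]] // _; exists z.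
case: (ltngtP (size p1) 1) => [|sp1|sp1].
- by rewrite ltnS leqn0 size_eq0 (negbTE p10).
- case: (ltngtP (size p2) 1) => [|sp2|sp2].
  + by rewrite ltnS leqn0 size_eq0 (negbTE p20).
  + have [] : clique_or_odd (x :: rcons p1 y).
    * apply: IH; rewrite /= ?size_rcons; [by nlia|by nlia| |].
        rewrite /ucycle /= rcons_path P1 last_rcons e_sym xy /=.
        by rewrite mem_rcons inE negb_or xney x1 rcons_uniq y1.
      move=> v vin; apply: sL; move: vin; rewrite !(inE, mem_cat, mem_rcons).
      by case/or3P => ->; rewrite ?orbT.
    * by move=> c1; left; apply: theta_clique.
    case=> few1 /=; rewrite size_rcons /= negbK => op1.
    have [] : clique_or_odd (x :: y :: p2).
    * apply: IH => /=; [by nlia|by nlia| |].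
        by rewrite /ucycle /= xy P2 !inE negb_or xney x2 y2.
      move=> v vin; apply: sL; move: vin; rewrite !(inE, mem_cat, mem_rcons).
      by case/or3P => ->; rewrite ?orbT.
    * move=> c2; left; apply: toC; apply: theta_clique => //.
      apply: clique_perm c2 => v; rewrite !(inE, mem_rcons).
      by case: (v == x); case: (v == y).
    case=> few2 /=; rewrite negbK => op2.
    right; split=> //; split=> //.
      by case: (size p1) op1 sp1 => [|[|[|]]].
    by case: (size p2) op2 sp2 => [|[|[|]]].
  left; apply: toC; have [z E] := size1 _ sp2; rewrite E in th' *.
  exact: theta_triangle.
left; have [z E] := size1 _ sp1; rewrite E in th *.
exact: theta_triangle.
Qed.

Lemma theta_is_clique x p1 y p2 : theta x p1 y p2 ->
  clique (x :: p1 ++ y :: p2).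
Proof.
move=> th; case: (theta_cases th) => // -[few1 few2 [op1 sp1] [op2 sp2]].
have [P1 P2 sz [xney /andP[x1 x2] /andP[y1 y2] /andP[u1 u2] dis]] := theta_facts th.
have [_ uC sL xy /andP[p10 p20]] := th.
case: (boolP (has (fun a => has (e a) p2) p1)) => [/hasP[a ap /hasP[b bp ab]]|no]; last first.
  exfalso; apply: (no_even_theta uC sL p10 p20 _ few1 few2).
    by rewrite /= size_cat addnS /= oddD op1 op2.
  move=> a b ap bp; apply: contra no => ab.
  by apply/hasP; exists a => //; apply/hasP; exists b.
have [P [Q E1]] : exists P, exists Q, p1 = P ++ a :: Q.
  by case/splitPr: ap => P Q; exists P, Q.
have [R [S E2]] : exists R, exists S, p2 = R ++ b :: S.
  by case/splitPr: bp => R S; exists R, S.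
have rotE : rot (size (x :: P)) (x :: p1 ++ y :: p2) =
    a :: (Q ++ y :: R) ++ b :: (S ++ x :: P).
  by rewrite E1 E2 -catA -cat_cons rot_size_cat /= -!catA /= -!catA.
have thab : theta a (Q ++ y :: R) b (S ++ x :: P).
  rewrite /theta -rotE size_rot /ucycle rot_cycle rot_uniq; split=> //.
  - by case: th.
  - by move=> z; rewrite mem_rot; apply: sL.
  - by rewrite -!size_eq0 !size_cat /=; apply/andP; nlia.
case: (theta_cases thab).
  by apply: clique_perm => z; rewrite -rotE mem_rot.
rewrite /odd_theta !size_cat /= => -[_ _ [oQR sQR] [oSP sSP]].
have [Pxa Pay] : path e x (rcons P a) /\ path e a (rcons Q y).
  by move: P1; rewrite E1 rcons_cat -cat_rcons cat_path last_rcons => /andP.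
have [Pyb Pbx] : path e y (rcons R b) /\ path e b (rcons S x).
  by move: P2; rewrite E2 rcons_cat -cat_rcons cat_path last_rcons => /andP.
have xin1 : x \in x :: rcons p1 y by rewrite mem_head.
have xin2 : x \in x :: y :: p2 by rewrite mem_head.
have xa : x != a by apply: contraNneq x1 => ->.
have xb : x != b by apply: contraNneq x2 => ->.
have ya : y != a by apply: contraNneq y1 => ->.
have yb : y != b by apply: contraNneq y2 => ->.
have aneb := edge_neq ab.
have noxa : P != [::] -> e x a -> False.
  case: (P) Pxa E1 => [|h P'] //= /andP[xh _] E1' _ exa.
  have hin : h \in p1 by rewrite E1' inE eqxx.
  apply: (chordless3 few1 xin1 (a := a) (b := h) (c := y)).
  - by rewrite !(inE, mem_rcons) ap hin eqxx !orbT.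
  - by rewrite exa xh xy.
  - move: u1; rewrite E1' /= mem_cat inE !negb_or => /andP[/and3P[_ ha _] _].
    by rewrite (eq_sym a h) ha (eq_sym a y) ya /=; apply: contraNneq y1 => <-.
have noxb : S != [::] -> e x b -> False.
  case/lastP: (S) Pbx E2 => [|S' l] //; rewrite rcons_path last_rcons.
  move=> /andP[_ lx] E2' _ exb.
  have lin : l \in p2 by rewrite E2' !(mem_cat, inE, mem_rcons) eqxx !orbT.
  apply: (chordless3 few2 xin2 (a := y) (b := b) (c := l)).
  - by rewrite !inE bp lin eqxx !orbT.
  - by rewrite xy exb e_sym lx.
  - rewrite yb /=; apply/andP; split; first by apply: contraNneq y2 => ->.
    by move: u2; rewrite E2' cat_uniq /= mem_rcons inE !negb_or => /and3P[_ _ /andP[/andP[-> _]]].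
have szE : size P + size Q + size R + size S + 4 = n.
  by rewrite -sz E1 E2 !size_cat /=; nlia.
have oPQ : odd (size P + (size Q).+1) by rewrite -[_.+1]/(size (a :: Q)) -size_cat -E1.
(* The chords xy and ab both cut the cycle into odd parts, so |P| + |Q| and |Q| + |R| are even, and
   with them |P| + |R|. The cycle x, P, a, b, R reversed, y is therefore even. It is shorter than
   the whole unless Q and S are empty, in which case a, y, x, b is a 4-cycle. The even cycle is a
   clique, and one of the edges xa and xb is then a chord of a chordless half. *)
have parPR : odd (size P + size R) = false.
  by move: oPQ oQR; rewrite !oddD /=; case: (odd (size P)); case: (odd (size Q)); case: (odd (size R)).
exfalso; case: (ltnP 0 (size Q + size S)) => QS.
  have [] : clique_or_odd (x :: P ++ a :: b :: rcons (rev R) y).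
  - apply: IH; rewrite /= ?size_cat /= ?size_rcons ?size_rev; [by nlia|by nlia| |].
      apply/andP; split.
        rewrite /= rcons_cat -cat_rcons cat_path last_rcons Pxa /= ab.
        by rewrite rcons_path path_rev // last_rcons e_sym.
      have -> : x :: P ++ a :: b :: rcons (rev R) y =
          x :: rcons P a ++ rev (y :: rcons R b).
        by rewrite rev_cons rev_rcons /= cat_rcons.
      have /perm_uniq -> : perm_eq (x :: rcons P a ++ rev (y :: rcons R b))
          (x :: rcons P a ++ y :: rcons R b).
        by rewrite perm_cons perm_cat2l perm_rev.
      apply: subseq_uniq (andP uC).2; rewrite E1 E2 -(cat_rcons a) -(cat_rcons b) /= eqxx.
      by apply: cat_subseq; [|rewrite /= eqxx]; apply: prefix_subseq.
    move=> v vin; apply: sL; move: vin; rewrite E1 E2 !(inE, mem_cat, mem_rcons, mem_rev).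
    case/or4P => [->|->|->|]; rewrite ?orbT //.
    by case/or3P => ->; rewrite ?orbT.
  - move=> c5.
    have exa : e x a by apply: c5; rewrite ?mem_head // !(inE, mem_cat) eqxx !orbT.
    have exb : e x b by apply: c5; rewrite ?mem_head // !(inE, mem_cat) eqxx !orbT.
    case: (eqVneq P [::]) => [P0|/noxa/(_ exa)] //.
    case: (eqVneq S [::]) => [S0|/noxb/(_ exb)] //.
    by rewrite P0 S0 in sSP.
  case=> _; rewrite /= size_cat /= size_rcons size_rev !addnS /= negbK.
  by rewrite negbK parPR.
have [Q0 S0] : Q = [::] /\ S = [::].
  by split; apply/eqP; rewrite -size_eq0; nlia.
have P0 : P != [::] by rewrite -size_eq0; move: sSP; rewrite S0 /=; nlia.
subst Q S; move: Pay Pbx => /= /andP[ay _] /andP[bx _].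
have [] : clique_or_odd [:: a; y; x; b].
- apply: IH => /=; [by move: P0; rewrite -size_eq0; move: szE sSP => /=; nlia|by []| |].
    rewrite /ucycle /= ay e_sym xy e_sym bx e_sym ab !inE !negb_or.
    by rewrite (eq_sym a) ya (eq_sym a) xa aneb (eq_sym y) xney yb xb.
  move=> v; rewrite !inE => vin; apply: sL; rewrite !(inE, mem_cat).
  by case/or4P: vin => /eqP->; rewrite ?eqxx ?ap ?bp ?orbT.
- by move=> c6; apply: (noxa P0); apply: c6; rewrite ?inE ?eqxx ?orbT.
by case.
Qed.

End Step.

Theorem cycle_clique_or_odd s : ucycle e s -> 2 < size s -> {subset s <= L} ->
  clique_or_odd s.
Proof.
have [n] := ubnP (size s); elim: n s => // n IHn s.
rewrite ltnS => sn us s2 sL; have [cs uns] := andP us.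
have IH s' : size s' < size s -> 2 < size s' -> ucycle e s' -> {subset s' <= L} ->
    clique_or_odd s'.
  by move=> ss s'2 us' s'L; apply: IHn => //; apply: leq_trans ss sn.
case: (boolP (all (fun x => count (e x) s <= 2) s)) => [/allP few|/allPn[x xs xc]].
  case: (boolP (odd (size s))) => os; first by right.
  have s3 : 3 < size s by case: (size s) s2 os => [|[|[|[|m]]]].
  by case: (no_even_chordless us s3 os sL few).
have [y [ys xy yn yp]] : exists y, [/\ y \in s, e x y, y != next s x & y != prev s x].
  have := xc; rewrite -ltnNge -size_filter => lt.
  case: (boolP (has (fun y => (y != next s x) && (y != prev s x)) [seq y <- s | e x y])).
    by case/hasP => y; rewrite mem_filter => /andP[xy ys] /andP[yn yp]; exists y.
  move=> /hasPn h; exfalso.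
  have : size [seq y <- s | e x y] <= size [:: next s x; prev s x].
    apply: uniq_leq_size => [|y /h]; first exact: filter_uniq.
    by rewrite negb_and !negbK !inE.
  by rewrite leqNgt lt.
have xney := edge_neq xy.
case: (rot_to_arc uns xs ys xney) => i p1 p2 _ _ E.
have un' : uniq (x :: p1 ++ y :: p2) by rewrite -E rot_uniq.
have th : theta (size s) x p1 y p2.
  rewrite /theta -E size_rot /ucycle rot_cycle rot_uniq; split=> //.
    by move=> z; rewrite mem_rot; apply: sL.
  apply/andP; split.
    apply: contraNneq yn => p10; rewrite -(next_rot i uns) E p10.
    by rewrite /= eqxx.
  apply: contraNneq yp => p20; rewrite -(prev_rot i uns) E p20.
  have xE : next (x :: p1 ++ [:: y]) y = x.
    have r := rot_size_cat (x :: p1) [:: y].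
    rewrite -(next_rot (size (x :: p1))) ?r; last by rewrite -p20.
    by rewrite /= eqxx.
  by rewrite -[X in prev _ X]xE prev_next // -p20.
left; apply: clique_perm (theta_is_clique IH th) => z.
by rewrite -E mem_rot.
Qed.

End CliqueOrOdd.
End Cycles.

(** * End blocks and the number of edges *)

Section EndBlock.
Variables (T : finType) (e : rel T).
Hypotheses (e_sym : symmetric e) (e_irr : irreflexive e).
Implicit Types (A B Q : {set T}) (x y z u v w : T).

Definition nbhd A v := [set w in A | e v w].

Lemma clique_path (K : seq T) v s : clique e K -> uniq (v :: s) ->
  {subset v :: s <= K} -> path e v s.
Proof.
move=> cK; elim: s v => //= w s IHs v /andP[vws uws] sub.
have vw : v != w by move: vws; rewrite inE negb_or => /andP[].
rewrite cK ?sub ?inE ?eqxx ?orbT //=; apply: IHs => // z zs.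
by apply: sub; rewrite inE zs orbT.
Qed.

Definition pathIn A v (p : seq T) :=
  [&& path e v p, uniq (v :: p) & all (mem A) (v :: p)].

Lemma pathIn_bound A v p : pathIn A v p -> size p < #|A|.
Proof.
case/and3P=> _ up /allP pA; rewrite cardE.
by apply: (@uniq_leq_size _ (v :: p)) => // z /pA; rewrite mem_enum.
Qed.

(** Two maximisations: the length, and among longest paths the position of a neighbour of the start.
    All neighbours of the start of a longest path lie on it, and having two of them makes the
    position positive. The final clause applies to every longest path, so it can be used after
    rerouting. *)
Lemma longest_path A : A != set0 -> (forall v, v \in A -> 1 < #|nbhd A v|) ->
  exists v p x,
   [/\ pathIn A v p, (x \in p) && e v x, 0 < index x p,
     forall w s, pathIn A w s -> size s <= size p &
     forall w s y, pathIn A w s -> size s = size p -> y \in A -> e w y ->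
       (y \in s) && (index y s <= index x p)].
Proof.
move=> /set0Pn[a aA] deg2.
pose P n := [exists t : n.+1.-tuple T, pathIn A (thead t) (behead t)].
have PP n : reflect (exists v p, pathIn A v p /\ size p = n) (P n).
  apply: (iffP existsP) => [[t pt]|[v [p [vp sp]]]].
    by exists (thead t), (behead t); rewrite size_behead size_tuple.
  have st : size (v :: p) == n.+1 by rewrite /= sp.
  by exists (Tuple st); rewrite (_ : thead _ = v).
have exP : exists n, P n.
  by exists 0; apply/PP; exists a, [::]; rewrite /pathIn /= aA.
have boundP n : P n -> n <= #|A|.
  by case/PP => v [p [/pathIn_bound h <-]]; apply: ltnW.
case: (ex_maxnP exP boundP) => n /PP[v [p [vp spn]]] maxn_.
have max_path w s : pathIn A w s -> size s <= n.
  by move=> ws; apply: maxn_; apply/PP; exists w, s.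
have nbr_in w s y : pathIn A w s -> size s = n -> y \in A -> e w y -> y \in s.
  move=> ws sn yA wy; apply: contraT => ys.
  have := max_path y (w :: s); rewrite /= sn ltnn => h; apply: h.
  case/and3P: ws => pw uw aw; apply/and3P; split.
  - by rewrite /= e_sym wy pw.
  - rewrite cons_uniq uw andbT inE negb_or ys andbT.
    by apply: contraTneq wy => ->; rewrite e_irr.
  - by rewrite /= yA.
pose R m := [exists t : n.+1.-tuple T, pathIn A (thead t) (behead t) &&
   [exists y, (y \in behead t) && (e (thead t) y && (index y (behead t) == m))]].
have RP m : reflect (exists w s y, [/\ pathIn A w s, size s = n, (y \in s) && e w y & index y s = m]) (R m).
  apply: (iffP existsP) => [[t /andP[pt /existsP[y /and3P[ys wy /eqP iy]]]]|[w [s [y [ws sn /andP[ys wy] iy]]]]].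
    exists (thead t), (behead t), y; split=> //; last by rewrite ys.
    by rewrite size_behead size_tuple.
  have st : size (w :: s) == n.+1 by rewrite /= sn.
  exists (Tuple st); rewrite (_ : thead _ = w) // ws /=; apply/existsP; exists y.
  by rewrite ys wy iy /=.
have R0 : forall w s, pathIn A w s -> size s = n -> exists2 m, R m & 0 < m.
  move=> w s ws sn.
  have wA : w \in A by case/and3P: ws => _ _ /andP[].
  have /card_gt1P[y [z [yn zn yz]]] := deg2 w wA.
  move: yn zn; rewrite !inE => /andP[yA wy] /andP[zA wz].
  have ys := nbr_in _ _ _ ws sn yA wy; have zs := nbr_in _ _ _ ws sn zA wz.
  have [iy|iy] := posnP (index y s); last first.
    by exists (index y s) => //; apply/RP; exists w, s, y; rewrite ys wy.
  exists (index z s); first by apply/RP; exists w, s, z; rewrite zs wz.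
  rewrite lt0n; apply: contra yz => /eqP iz.
  by rewrite -(nth_index w ys) -(nth_index w zs) iy iz.
have [m0 Rm0 m0_gt0] := R0 v p vp spn.
have exR : exists m, R m by exists m0.
have boundR m : R m -> m <= n.
  by case/RP => w [s [y [_ <- _ <-]]]; apply: index_size.
case: (ex_maxnP exR boundR) => m /RP[w [s [x [ws sn xs ix]]]] maxR.
exists w, s, x; split=> //.
- by rewrite ix; apply: leq_trans (maxR _ Rm0).
- by move=> w' s' ws'; rewrite sn; apply: max_path ws'.
move=> w' s' y ws'; rewrite sn => sn' yA wy'.
have ys := nbr_in _ _ _ ws' sn' yA wy'; rewrite ys ix /=.
by apply: maxR; apply/RP; exists w', s', y; rewrite ys wy'.
Qed.

(* The last condition of [EndPair] says that [s] and [t] do not become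
   simplicial when [u] and [v] are removed. *)
Inductive end_block A : Prop :=
| EndLeaf v of v \in A & #|nbhd A v| <= 1
| EndPair u v s t of
    [/\ u \in A, v \in A & u != v] &
    [/\ nbhd A u = [set v; s], nbhd A v = [set u; t] & (s \notin [set u; v]) && (t \notin [set u; v])] &
    (s = t \/ {in [set s; t], forall z, exists2 w, w \in nbhd A z :\: [set u; v] &
      {in nbhd A z :\: [set u; v], forall a, a != w -> ~~ e a w}})
| EndClique Q x of [/\ x \in A, x \notin Q, Q \subset A & 2 < #|Q|] &
    {in Q, forall v, nbhd A v = (x |: Q) :\ v}.

Variable L : {set T}.
Hypothesis clique_or_oddL : forall s, ucycle e s -> 2 < size s ->
  {subset s <= L} -> clique_or_odd e s.

(** The longest path is v0, q, x, r with x the farthest neighbour of v0, which closes the cycle v0,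
    q, x. Rerouting the path within this cycle shows that vertices of v0, q have no neighbours off
    it. If the cycle is a clique this holds for all of them; if it is a chordless odd cycle of
    length at least 5 it is shown for v0 and its successor v1, which have degree 2 in A. *)
Lemma end_blockP A : A \subset L -> A != set0 -> end_block A.
Proof.
move=> AL A0.
case: (boolP [forall v in A, 1 < #|nbhd A v|]) => [/forall_inP deg2|]; last first.
  by case/forall_inPn => v vA; rewrite -leqNgt => d1; apply: EndLeaf vA d1.
have [v0 [p [x [v0p /andP[xp v0x] ix maxp maxx]]]] := longest_path A0 deg2.
have /and3P[pth unq /allP pA] := v0p.
have [q [r [pE [sq xq]]]] : exists q r, p = q ++ x :: r /\ (size q = index x p /\ x \notin q).
  case/splitPr: xp unq {v0p maxp maxx ix pth pA} => q r.
  rewrite cons_uniq cat_uniq /= negb_or => /and4P[_ _ /andP[xq _] _].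
  exists q, r; split=> //; split=> //.
  by rewrite index_cat (negbTE xq) /= eqxx addn0.
have vA z : z \in v0 :: p -> z \in A by move/pA.
have qA z : z \in v0 :: rcons q x -> z \in A.
  move=> zq; apply: vA; move: zq; rewrite pE !(inE, mem_rcons, mem_cat).
  by case/or3P => ->; rewrite ?orbT.
have CL : {subset v0 :: rcons q x <= L}.
  by move=> z /qA; apply: (subsetP AL).
have [pq pr] : path e v0 (rcons q x) /\ path e x r.
  by move: pth; rewrite pE -cat_rcons cat_path last_rcons => /andP.
have uC : uniq (v0 :: rcons q x).
  apply: subseq_uniq unq; rewrite pE -cat_rcons /= eqxx; exact: prefix_subseq.
have cC : ucycle e (v0 :: rcons q x).
  by rewrite /ucycle uC andbT /= rcons_path pq last_rcons e_sym.
(* Replacing the segment before x by another one of the same length gives a longest path again, so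
   its start has no neighbour beyond x. *)
have maxq w s y : pathIn A w (s ++ x :: r) -> size s = size q -> y \in A -> e w y ->
    y \in rcons s x.
  move=> ws ss yA wy; have := maxx _ _ y ws; rewrite pE !size_cat /= ss.
  move=> /(_ erefl yA wy) /andP[]; rewrite -pE -sq -ss -cat_rcons mem_cat index_cat.
  case: (y \in rcons s x) => //= _; rewrite size_rcons; nlia.
have nb0 z : z \in A -> e v0 z -> z \in rcons q x.
  by apply: maxq; rewrite -?pE.
(* In a clique, any vertex of v0, q can be made the start while the path from x on is kept. *)
have cl_case : clique e (v0 :: rcons q x) -> end_block A.
  move=> cl.
  have nbQ v z : v \in v0 :: q -> z \in A -> e v z -> z \in v0 :: rcons q x.
    move=> vq zA vz; pose s := rem v (v0 :: q).
    have ps : perm_eq (v :: s) (v0 :: q) by rewrite perm_sym perm_to_rem.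
    have pp : perm_eq (v :: s ++ x :: r) (v0 :: p).
      by rewrite pE -!cat_cons perm_cat2r.
    have : z \in rcons s x.
      apply: (@maxq v) => //; last by have := perm_size ps => /= -[].
      apply/and3P; split.
      - rewrite -cat_rcons cat_path last_rcons pr andbT.
        apply: (clique_path cl).
          rewrite -rcons_cons rcons_uniq (perm_uniq ps) (perm_mem ps).
          by move: uC; rewrite -rcons_cons rcons_uniq.
        move=> y; rewrite -!rcons_cons !mem_rcons !inE => /orP[->//|].
        by rewrite -in_cons (perm_mem ps) inE => ->; rewrite orbT.
      - by rewrite (perm_uniq pp).
      - by apply/allP => y; rewrite (perm_mem pp) => /pA.
    rewrite -rcons_cons !mem_rcons !inE => /orP[->//|zs].
    have : z \in v :: s by rewrite inE zs orbT.
    by rewrite (perm_mem ps) inE => ->; rewrite orbT.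
  have nbE v : v \in v0 :: q -> nbhd A v = (x |: [set y in v0 :: q]) :\ v.
    move=> vq; apply/setP => z; rewrite !inE.
    have vC : v \in v0 :: rcons q x by rewrite -rcons_cons mem_rcons inE vq orbT.
    apply/andP/andP => [[zA vz]|[zv zq]].
      rewrite (edge_neq e_irr _) 1?e_sym //; split=> //.
      by have := nbQ _ _ vq zA vz; rewrite inE mem_rcons inE orbCA.
    have zC : z \in v0 :: rcons q x by rewrite inE mem_rcons inE orbCA.
    by split; [apply: qA | apply: cl => //; rewrite eq_sym].
  have xv0 : x != v0 by rewrite eq_sym (edge_neq e_irr).
  case: (ltnP 1 (size q)) => q1.
    apply: (@EndClique A [set y in v0 :: q] x); last by move=> v; rewrite inE; apply: nbE.
    split; first by apply: vA; rewrite inE xp orbT.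
    - by rewrite !inE negb_or xv0.
    - apply/subsetP => z; rewrite inE => zq; apply: qA.
      by rewrite -rcons_cons mem_rcons inE zq orbT.
    rewrite cardsE (card_uniqP _) //=.
    by move: uC; rewrite -rcons_cons rcons_uniq => /andP[].
  have [v1 qE] : exists v1, q = [:: v1].
    move: ix; rewrite -sq; case: (q) q1 => [|v1 [|]] //= _ _.
    by exists v1.
  have v01 : v0 != v1 by move: uC; rewrite qE /= inE negb_or => /andP[/andP[]].
  have xv1 : x != v1 by move: xq; rewrite qE inE.
  apply: (@EndPair A v0 v1 x x); last by left.
  - split=> //; apply: qA; rewrite ?mem_head //.
    by rewrite qE !inE eqxx !orbT.
  split; last by rewrite !inE negb_or xv0 xv1.
  - rewrite nbE ?mem_head // qE; apply/setP => z; rewrite !inE.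
    case: eqP => [->|_] /=; last by rewrite orbC.
    by rewrite (negbTE v01) eq_sym (negbTE xv0).
  rewrite nbE; last by rewrite qE !inE eqxx orbT.
  rewrite qE; apply/setP => z; rewrite !inE.
  case: (z =P v1) => [->|_] /=; last by rewrite orbF orbC.
  by rewrite eq_sym (negbTE v01) eq_sym (negbTE xv1).
have [|cl|[few oC]] := clique_or_oddL cC _ CL.
- by rewrite /= size_rcons; move: ix; rewrite -sq; nlia.
- exact: cl_case.
move: oC; rewrite /= size_rcons /= negbK => oq.
case: (ltnP 2 (size q)) => sq3; last first.
  have [v1 qE] : exists v1, q = [:: v1].
    by case: (q) oq sq3 => [|v1 [|? [|]]] //; exists v1.
  apply: cl_case => u v; move: pq; rewrite qE /= => /and3P[e01 e1x _].
  rewrite !inE => /or3P[]/eqP-> /or3P[]/eqP->; rewrite ?eqxx //; by rewrite e_sym.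
have [v1 [v2 [v3 [q3 qE]]]] : exists v1 v2 v3 q3, q = v1 :: v2 :: v3 :: q3.
  by case: (q) sq3 => [|v1 [|v2 [|v3 q3]]] // _; exists v1, v2, v3, q3.
have [q' [l qlE]] : exists q' l, v3 :: q3 = rcons q' l.
  by case/lastP: (q3) => [|q' l]; [exists [::], v3 | exists (v3 :: q'), l].
have qlE' : q = v1 :: v2 :: rcons q' l by rewrite qE qlE.
have memC z : (z \in v0 :: rcons q x) = [|| z == v0, z == v1, z == v2, z == x | z \in v3 :: q3].
  by rewrite qE !(inE, mem_rcons); do !bool_congr.
have uall : uniq [:: v0, v1, v2, x, v3 & q3].
  apply: etrans uC; apply: perm_uniq; rewrite qE /= !perm_cons.
  by rewrite perm_sym -cats1 (perm_catC (v3 :: q3)).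
have lin : l \in v3 :: q3 by rewrite qlE mem_rcons mem_head.
move: (uall); rewrite /= !inE !negb_or => /and5P[/and5P[n01 n02 n0x n03 n0q] /and4P[n12 n1x n13 n1q] /and3P[n2x n23 n2q] /andP[nx3 nxq] _].
have lnq z : z \notin v3 :: q3 -> z != l by apply: contraNneq => ->.
have n0l : v0 != l by apply: lnq; rewrite inE negb_or n03.
have n1l : v1 != l by apply: lnq; rewrite inE negb_or n13.
have nxl : x != l by apply: lnq; rewrite inE negb_or nx3.
have [e01 [e12 e23]] : e v0 v1 /\ e v1 v2 /\ e v2 v3.
  by move: pq; rewrite qE /= => /and4P[-> -> ->].
have elx : e l x by move: pq; rewrite qlE' -!rcons_cons rcons_path /= last_rcons => /andP[].
have in0 : v0 \in v0 :: rcons q x by rewrite memC eqxx.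
have in1 : v1 \in v0 :: rcons q x by rewrite memC eqxx orbT.
have in2 : v2 \in v0 :: rcons q x by rewrite memC eqxx !orbT.
have inx : x \in v0 :: rcons q x by rewrite memC eqxx !orbT.
have in3 : v3 \in v0 :: rcons q x by rewrite memC !inE eqxx !orbT.
have inl : l \in v0 :: rcons q x by rewrite memC lin !orbT.
have few2 v a b z : v \in v0 :: rcons q x -> z \in v0 :: rcons q x -> e v z ->
    [&& a \in v0 :: rcons q x, b \in v0 :: rcons q x & a != b] -> e v a -> e v b ->
    (z == a) || (z == b).
  move=> vC zC vz /and3P[aC bC ab] va vb; apply: contraT; rewrite negb_or => /andP[za zb].
  case: (chordless3 few vC (a := z) (b := a) (c := b)).
  - by rewrite zC aC bC.
  - by rewrite vz va vb.
  - by rewrite za zb ab.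
have not1x : ~~ e v1 x.
  apply/negP => e1x; have := few2 v1 v0 v2 x in1 inx e1x.
  rewrite in0 in2 n02 e_sym e01 e12 => /(_ isT isT isT).
  by rewrite eq_sym (negbTE n0x) eq_sym (negbTE n2x).
have not02 : ~~ e v0 v2.
  apply/negP => e02; have := few2 v0 v1 x v2 in0 in2 e02.
  rewrite in1 inx n1x e01 v0x => /(_ isT isT isT).
  by rewrite eq_sym (negbTE n12) (negbTE n2x).
have not0l : ~~ e v0 l.
  apply/negP => e0l; have := few2 v0 v1 x l in0 inl e0l.
  rewrite in1 inx n1x e01 v0x => /(_ isT isT isT).
  by rewrite eq_sym (negbTE n1l) eq_sym (negbTE nxl).
have even_clique s : cycle e s -> uniq s -> {subset s <= A} -> 2 < size s ->
    ~~ odd (size s) -> clique e s.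
  move=> cs us sA s2 evs; have [] // := @clique_or_oddL s _ s2 _.
  - by rewrite /ucycle cs us.
  - by move=> z /sA; apply: (subsetP AL).
  - by case=> _; rewrite (negbTE evs).
have nbv0 : nbhd A v0 = [set v1; x].
  apply/setP => z; rewrite !inE; apply/andP/orP => [[zA v0z]|].
    apply/orP; apply: (few2 v0) => //; last by rewrite in1 inx n1x.
    by rewrite inE nb0 ?orbT.
  by case=> /eqP->; rewrite ?e01 ?v0x; split=> //; apply: qA.
have oq3 : odd (size q3) = false by move: oq; rewrite qE /= !negbK => /negbTE.
(* A neighbour a of v1 off the cycle closes two cycles of different parity, and the even one is a
   clique containing a forbidden chord at v1. For a in r both cycles pass through v1 and x. For a
   off the path, a, v1, v2, ... is again a longest path, so a has a second neighbour b on the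
   cycle. *)
have nbr1 a : a \in A -> e v1 a -> a \in v0 :: rcons q x.
  move=> aA e1a; apply: contraT => aC.
  have a0 : a != v0 by apply: contraNneq aC => ->.
  have a1 : a != v1 by apply: contraNneq aC => ->.
  have [ar|ar] := boolP (a \in r).
    have [r1 [r2 rE]] : exists r1 r2, r = r1 ++ a :: r2.
      by case/splitPr: ar => r1 r2; exists r1, r2.
    have pxa : path e x (rcons r1 a).
      by move: pr; rewrite rE -cat_rcons cat_path => /andP[].
    have subA s : subseq s (v0 :: p) -> {subset s <= A}.
      by move=> sub z /(mem_subseq sub); apply: vA.
    have sub1 : subseq (v0 :: v1 :: x :: rcons r1 a) (v0 :: p).
      have sx : subseq (x :: rcons r1 a) ([:: v2, v3 & q3] ++ x :: r).
        apply: subseq_trans (suffix_subseq _ _); rewrite rE -cat_rcons.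
        exact: (prefix_subseq (x :: rcons r1 a)).
      by rewrite pE qE; apply: (@cat_subseq _ [:: v0; v1] _ [:: v0; v1]).
    have sub2 : subseq (q ++ x :: rcons r1 a) (v0 :: p).
      apply: subseq_trans (subseq_cons _ _); rewrite pE rE -(cat_rcons a).
      by apply: cat_subseq => //; apply: (prefix_subseq (x :: rcons r1 a)).
    have pq' : path e v1 (rcons (v2 :: v3 :: q3) x).
      by move: pq; rewrite qE /= => /andP[].
    exfalso; case/negP: not1x; case: (boolP (odd (size r1))) => or1.
      have cl : clique e (q ++ x :: rcons r1 a).
        apply: even_clique.
        - rewrite qE; change (cycle e (v1 :: (v2 :: v3 :: q3) ++ x :: rcons r1 a)).
          by rewrite cycle_split pq' rcons_path pxa last_rcons e_sym.
        - exact: subseq_uniq sub2 unq.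
        - exact: subA.
        - by rewrite size_cat /= size_rcons; nlia.
        - by rewrite size_cat /= size_rcons oddD oq /= or1.
      by apply: cl; rewrite ?mem_cat ?inE ?eqxx ?orbT // qE inE eqxx.
    have cl : clique e (v1 :: v0 :: x :: rcons r1 a).
      apply: even_clique.
      - by rewrite /= e_sym e01 v0x rcons_path pxa last_rcons e_sym.
      - have := subseq_uniq sub1 unq; rewrite /= !inE !negb_or.
        by rewrite (eq_sym v1 v0) => /and3P[/andP[-> ->] /andP[-> ->] ->].
      - move=> z zin; apply: (subA _ sub1); move: zin; rewrite !inE.
        by case/or3P => ->; rewrite ?orbT.
      - by rewrite /= size_rcons.
      - by rewrite /= size_rcons /= !negbK.
    by apply: cl; rewrite ?inE ?eqxx ?orbT.
  have ap : a \notin p.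
    rewrite pE -cat_rcons mem_cat negb_or ar andbT.
    by move: aC; rewrite inE negb_or => /andP[].
  have anp : a \notin v0 :: p by rewrite inE negb_or a0.
  have pa : pathIn A a (v1 :: v2 :: v3 :: q3 ++ x :: r).
    move: pth unq anp; rewrite pE qE => pth' unq' anp'; apply/and3P; split.
    - by move: pth'; rewrite /= (e_sym a v1) e1a => /andP[].
    - move: unq' anp'; rewrite cons_uniq => /andP[_ u']; rewrite inE negb_or => /andP[_ n'].
      by rewrite cons_uniq u' andbT.
    - apply/allP => z; rewrite inE => /orP[/eqP->//|zin]; apply: vA; rewrite pE qE.
      by rewrite inE zin orbT.
  have /card_gt1P[b1 [b2 [b1n b2n b12]]] := deg2 a aA.
  have [b [bA eab bv1]] : exists b, [/\ b \in A, e a b & b != v1].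
    move: b1n b2n; rewrite !inE => /andP[b1A e1] /andP[b2A e2].
    case: (eqVneq b1 v1) => [b1v|]; last by exists b1.
    by exists b2; split=> //; rewrite -b1v eq_sym.
  have bin : b \in rcons (v1 :: v2 :: v3 :: q3) x.
    by apply: (maxq a) => //; rewrite qE.
  have bin' : b \in rcons (v2 :: v3 :: q3) x.
    by move: bin; rewrite rcons_cons inE (negbTE bv1).
  have bC : b \in v0 :: rcons q x by rewrite inE qE bin orbT.
  have [q1 [q2 rE]] : exists q1 q2, rcons (v2 :: v3 :: q3) x = q1 ++ b :: q2.
    by case/splitPr: bin' => q1 q2; exists q1, q2.
  have pq' : path e v1 (q1 ++ b :: q2).
    by move: pq; rewrite qE -rE /= => /andP[].
  have [pb1 pb2] : path e v1 (rcons q1 b) /\ path e b q2.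
    by move: pq'; rewrite -cat_rcons cat_path last_rcons => /andP.
  have lq2 : last b q2 = x.
    have := last_rcons v1 (v2 :: v3 :: q3) x.
    by rewrite rE last_cat.
  have uq : uniq (v0 :: v1 :: q1 ++ b :: q2) by move: uC; rewrite qE !rcons_cons -rE.
  have aq : a \notin v0 :: v1 :: q1 ++ b :: q2 by move: aC; rewrite qE !rcons_cons -rE.
  have inA z : z \in v0 :: v1 :: q1 ++ b :: q2 -> z \in A.
    by move=> zin; apply: qA; rewrite qE /= -/(rcons (v2 :: v3 :: q3) x) rE.
  have szq : size q1 + size q2 = (size q3).+2.
    have := congr1 size rE; rewrite size_rcons size_cat /=; nlia.
  have xin2 : x \in b :: q2 by rewrite -lq2 mem_last.
  exfalso; case: (boolP (odd (size q1))) => oq1.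
    have cl : clique e (a :: v1 :: rcons q1 b).
      have sub : subseq (v1 :: rcons q1 b) (v0 :: v1 :: q1 ++ b :: q2).
        apply: subseq_trans (subseq_cons _ _).
        by rewrite -cat_rcons /= eqxx prefix_subseq.
      apply: even_clique.
      - by rewrite /= e_sym e1a rcons_path pb1 last_rcons e_sym.
      - rewrite cons_uniq (subseq_uniq sub uq) andbT.
        by apply: contra aq => /(mem_subseq sub).
      - by move=> z; rewrite inE => /orP[/eqP->//|/(mem_subseq sub)/inA].
      - by rewrite /= size_rcons.
      - by rewrite /= size_rcons /= !negbK.
    have e1b : e v1 b.
      by apply: cl; rewrite ?inE ?mem_rcons ?inE ?eqxx ?orbT // eq_sym.
    have := few2 v1 v0 v2 b in1 bC e1b; rewrite in0 in2 n02 e_sym e01 e12 => /(_ isT isT isT).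
    have bv0 : b != v0.
      apply: contraTneq uq => ->.
      by rewrite cons_uniq !(inE, mem_cat) eqxx !orbT.
    have bv2 : b != v2.
      case: (q1) oq1 rE uq => //= h q1' _ [<- _]; apply: contraTneq => ->.
      by rewrite !(inE, mem_cat) eqxx !orbT !andbF.
    by rewrite (negbTE bv0) (negbTE bv2).
  have cl : clique e (v0 :: v1 :: a :: b :: q2).
    have sub : subseq (v0 :: v1 :: b :: q2) (v0 :: v1 :: q1 ++ b :: q2).
      by rewrite /= !eqxx; apply: suffix_subseq.
    have E : v0 :: v1 :: a :: b :: q2 =i a :: v0 :: v1 :: b :: q2.
      by move=> z; rewrite !inE; case: (z == v0); case: (z == v1); case: (z == a).
    apply: even_clique.
    - rewrite /= e01 e1a eab rcons_path pb2 lq2 e_sym //.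
    - have : uniq (a :: v0 :: v1 :: b :: q2).
        rewrite cons_uniq (subseq_uniq sub uq) andbT.
        by apply: contra aq => /(mem_subseq sub).
      apply: etrans; apply: perm_uniq.
      by rewrite -(perm_cat2r (b :: q2)) (perm_catCA [:: v0; v1] [:: a]).
    - by move=> z; rewrite E inE => /orP[/eqP->//|/(mem_subseq sub)/inA].
    - by [].
    - have : odd (size q1 + size q2) = false by rewrite szq /= oq3.
      by rewrite oddD (negbTE oq1) /= => ->.
  by case/negP: not1x; apply: cl; rewrite // !inE ?eqxx ?orbT // -in_cons xin2 !orbT.
have nbv1 : nbhd A v1 = [set v0; v2].
  apply/setP => z; rewrite !inE; apply/andP/orP => [[zA v1z]|].
    apply/orP; apply: (few2 v1) => //; last by rewrite e_sym.
      exact: nbr1.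
    by rewrite in0 in2 n02.
  by case=> /eqP->; rewrite ?e12 1?e_sym ?e01; split=> //; apply: qA.
apply: (@EndPair A v0 v1 x v2).
- by split=> //; apply: qA.
- split=> //.
  by rewrite !inE !negb_or (eq_sym x) n0x (eq_sym x) n1x (eq_sym v2) n02 (eq_sym v2) n12.
(* The exceptional neighbour is the predecessor l of x, respectively the successor v3 of v2. A
   vertex a adjacent to both ends of that cycle edge could be inserted there; the resulting cycle is
   even, hence a clique, and would contain the missing edge v0 l, respectively v0 v2. *)
right=> z; rewrite !inE => /orP[]/eqP->.
  exists l; first by rewrite !inE negb_or (eq_sym l) n0l (eq_sym l) n1l qA //= e_sym elx.
  move=> a; rewrite !inE negb_or => /andP[/andP[a0 a1] /andP[aA exa]] al.
  apply/negP => eal; case/negP: not0l.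
  have aC : a \notin v0 :: rcons q x.
    apply/negP => aC; have := few2 x v0 l a inx aC exa.
    rewrite in0 inl n0l (e_sym x v0) v0x (e_sym x l) elx => /(_ isT isT isT).
    by rewrite (negbTE a0) (negbTE al).
  have [pq0 lq] : path e v0 q /\ last v0 q = l.
    move: pq; rewrite rcons_path => /andP[-> _]; split=> //.
    by rewrite qlE' !last_cons last_rcons.
  have E : v0 :: rcons (rcons q a) x =i a :: v0 :: rcons q x.
    by move=> z'; rewrite !(inE, mem_rcons); case: (z' == v0); case: (z' == x); case: (z' == a).
  have cl : clique e (v0 :: rcons (rcons q a) x).
    apply: even_clique.
    - by rewrite /= !rcons_path !last_rcons pq0 lq (e_sym l a) eal (e_sym a x) exa e_sym.
    - have : uniq (a :: v0 :: rcons q x) by rewrite cons_uniq aC.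
      apply: etrans; apply: perm_uniq.
      rewrite -!cats1 -catA /= -(perm_catCA [:: a] (v0 :: q)) /=.
      exact: perm_refl.
    - by move=> z'; rewrite E inE => /orP[/eqP->//|/qA].
    - by rewrite /= !size_rcons.
    - by rewrite /= !size_rcons /= oq.
  apply: cl; rewrite ?E ?inE ?eqxx ?orbT //.
  by rewrite -in_cons inl orbT.
exists v3; first by rewrite !inE negb_or (eq_sym v3) n03 (eq_sym v3) n13 qA.
move=> a; rewrite !inE negb_or => /andP[/andP[a0 a1] /andP[aA e2a]] a3.
apply/negP => ea3; case/negP: not02.
have aC : a \notin v0 :: rcons q x.
  apply/negP => aC; have := few2 v2 v1 v3 a in2 aC e2a.
  rewrite in1 in3 n13 (e_sym v2 v1) e12 e23 => /(_ isT isT isT).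
  by rewrite (negbTE a1) (negbTE a3).
have E : [:: v0, v1, v2, a & rcons (v3 :: q3) x] =i a :: v0 :: rcons q x.
  move=> z'; rewrite qE !(inE, mem_rcons).
  by case: (z' == v0); case: (z' == v1); case: (z' == v2); case: (z' == a).
have cl : clique e [:: v0, v1, v2, a & rcons (v3 :: q3) x].
  have := pq; rewrite qE /= !rcons_path => /and5P[_ _ _ p3 p4].
  apply: even_clique.
  - by rewrite /= !rcons_path last_rcons e01 e12 e2a ea3 p3 p4 e_sym.
  - have : uniq (a :: v0 :: rcons q x) by rewrite cons_uniq aC.
    apply: etrans; apply: perm_uniq.
    rewrite qE -(perm_catCA [:: a] [:: v0; v1; v2]) /=.
    exact: perm_refl.
  - by move=> z'; rewrite E inE => /orP[/eqP->//|/qA].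
  - by [].
  - by rewrite /= size_rcons /= oq3.
by apply: cl; rewrite ?inE ?eqxx ?orbT.
Qed.
End EndBlock.

(** * Edge counts by removal of end blocks *)

Section EdgeBound.
Variables (T : finType) (e : rel T).
Hypotheses (e_sym : symmetric e) (e_irr : irreflexive e).
Implicit Types (A B Q : {set T}) (x y z u v w : T).
Local Notation nbhd := (nbhd e).

Definition degree_sum A := \sum_(v in A) #|nbhd A v|.

Lemma card_nb A v : #|nbhd A v| = \sum_(w in A) e v w.
Proof.
rewrite -sum1_card (eq_bigl (fun w => (w \in A) && e v w)); last first.
  by move=> w; rewrite inE.
by rewrite big_mkcondr; apply: eq_bigr => w _; case: (e v w).
Qed.

(** An edge inside B is counted at both of its ends by the first term; an edge leaving B is counted
    once by each term. *)
Lemma dsum_setD A B : B \subset A ->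
  degree_sum A = degree_sum (A :\: B) + \sum_(v in B) (#|nbhd A v| + #|nbhd (A :\: B) v|).
Proof.
move=> BA; rewrite big_split /= addnCA.
have E (F : T -> nat) : \sum_(v in A) F v = \sum_(v in B) F v + \sum_(v in A :\: B) F v.
  by rewrite (big_setID B) /= (setIidPr BA).
rewrite {1}/degree_sum E; congr (_ + _).
rewrite (eq_bigr (fun v => #|nbhd B v| + #|nbhd (A :\: B) v|)); last first.
  by move=> v _; rewrite !card_nb E.
rewrite big_split /= addnC; congr (_ + _).
under eq_bigr do rewrite card_nb.
under [in RHS]eq_bigr do rewrite card_nb.
rewrite exchange_big /=; apply: eq_bigr => v _; apply: eq_bigr => w _.
by rewrite e_sym.
Qed.

Lemma nbS A B v : A \subset B -> nbhd A v \subset nbhd B v.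
Proof.
by move=> /subsetP AB; apply/subsetP => w; rewrite !inE => /andP[/AB -> ->].
Qed.

Lemma nbD A B v : [disjoint nbhd A v & B] -> nbhd (A :\: B) v = nbhd A v.
Proof.
move=> /pred0P h; apply/setP => w; rewrite !inE.
by have := h w; rewrite /= !inE; case: (w \in A); case: (e v w); case: (w \in B).
Qed.

Variable k : nat.

(** Together with its neighbours in A, such a vertex spans a K_(k-1). When it is low, of degree k -
    1, it has exactly one neighbour outside A. *)
Definition simplicial A v :=
  (#|nbhd A v| == k - 2) &&
  [forall x in nbhd A v, forall y in nbhd A v, (x != y) ==> e x y].

Lemma simplicialP A v :
  reflect (#|nbhd A v| = k - 2 /\ {in nbhd A v &, forall x y, x != y -> e x y})
    (simplicial A v).
Proof.
apply: (iffP andP) => [[/eqP h1 /forall_inP h2]|[h1 h2]]; split=> //; last 2 first.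
- exact/eqP.
- apply/forall_inP => x xA; apply/forall_inP => y yA; apply/implyP; exact: h2.
by move=> x y /h2/forall_inP h /h/implyP.
Qed.

Definition n_simplicial A := #|[set v in A | simplicial A v]|.
(* Vertices of degree at most 2 can carry a hanging clique on k - 2 vertices:
   for k = 6 each of them is given a reserve [si] to make the induction work. *)
Definition n_low_degree A := #|[set v in A | #|nbhd A v| <= 2]|.

Lemma nlow_setD A B : n_low_degree A <= n_low_degree (A :\: B) + #|B|.
Proof.
rewrite /n_low_degree -cardsUI; apply: leq_trans (leq_addr _ _); apply: subset_leq_card.
apply/subsetP => v; rewrite !inE => /andP[vA d].
case: (v \in B) => //=.
rewrite vA orbF /=; apply: leq_trans d; apply: subset_leq_card.
by apply: nbS; apply: subsetDl.
Qed.

Variable L : {set T}.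
Hypothesis end_blockL : forall A, A \subset L -> A != set0 -> end_block e A.
Hypothesis degL : forall v, v \in L -> #|nbhd L v| < k.
Hypothesis no_cliqueL : forall Q, Q \subset L ->
  {in Q &, forall x y, x != y -> e x y} -> #|Q| = k -> False.
Hypothesis k4 : 4 < k.

(** Each inequality pays for one removal. [Hleaf] covers degree sum 2, one new simplicial vertex and
    one reserve; [Hpair] covers degree sum 6 and two reserves. [Hbig] is for a hanging K_(k-1),
    whose k - 2 removed vertices are simplicial, and [Hsmall] for a smaller hanging clique; both are
    helped by the reserve that the cut vertex x holds once the clique is gone. [Hvertex] starts the
    induction. *)
Variables al be ga si ka : nat.
Hypothesis Hvertex : si + ka <= be.
Hypothesis Hleaf : 2 * al + ga + si <= be.
Hypothesis Hpair : 6 * al + 2 * si <= 2 * be.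
Hypothesis Hbig : al * ((k - 2) * (k - 1)) <= (be + ga) * (k - 2) + si.
Hypothesis Hsmall : forall j, 2 < j -> j < k - 2 ->
  al * (j * (j + 1)) <= be * j + si /\ k <= j + 3.

Theorem edge_bound A : A \subset L -> A != set0 ->
  al * degree_sum A + si * n_low_degree A + ka <= be * #|A| + ga * n_simplicial A.
Proof.
have [n] := ubnP #|A|; elim: n A => // n IHn A; rewrite ltnS => An AL A0.
have IH B : B \subset A -> B != set0 -> A :\: B != set0 ->
    al * degree_sum (A :\: B) + si * n_low_degree (A :\: B) + ka <=
    be * #|A :\: B| + ga * n_simplicial (A :\: B).
  move=> BA B0 AB0; apply: IHn AB0; last first.
    by apply: subset_trans AL; apply: subsetDl.
  apply: leq_trans An; rewrite -(cardsID B A) (setIidPr BA) -[X in X < _]add0n ltn_add2r.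
  by rewrite card_gt0.
have cardA B : B \subset A -> #|A| = #|B| + #|A :\: B|.
  by move=> BA; rewrite -(cardsID B A) (setIidPr BA).
have degA B v : B \subset A -> v \in A -> #|nbhd B v| < k.
  move=> BA vA; apply: leq_ltn_trans (degL (subsetP AL _ vA)).
  by apply: subset_leq_card; apply: nbS; apply: subset_trans BA AL.
have simpD B v : v \in A -> v \notin B -> [disjoint nbhd A v & B] ->
    simplicial (A :\: B) v = simplicial A v.
  by move=> vA vB dis; rewrite /simplicial nbD.
case: (end_blockL AL A0) => [v vA d1|u v s t [uA vA uv] [nu nv /andP[suv tuv]] iso|Q x [xA xQ QA Q3] nQ].
- have vsA : [set v] \subset A by rewrite sub1set.
  have dsE := dsum_setD vsA; rewrite big_set1 in dsE.
  have cE := cardA _ vsA; rewrite cards1 in cE.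
  have lE := nlow_setD A [set v]; rewrite cards1 in lE.
  have d1' : #|nbhd (A :\: [set v]) v| <= #|nbhd A v|.
    by apply: subset_leq_card; apply: nbS; apply: subsetDl.
  have [AE|Av0] := eqVneq (A :\: [set v]) set0.
    have z1 : n_low_degree (A :\: [set v]) = 0.
      by apply/eqP; rewrite cards_eq0 -subset0 AE; apply/subsetP => z; rewrite !inE.
    have z2 : degree_sum (A :\: [set v]) = 0 by rewrite /degree_sum AE big_set0.
    have z3 : #|nbhd A v| = 0.
      apply/eqP; rewrite cards_eq0 -subset0; apply/subsetP => z; rewrite !inE.
      case/andP => zA vz; have : z \in A :\: [set v].
        by rewrite !inE zA eq_sym (edge_neq e_irr vz).
      by rewrite AE inE.
    have z4 : #|A :\: [set v]| = 0 by rewrite AE cards0.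
    move: dsE cE lE; rewrite z1 z2 z4; move: d1'; rewrite z3 => ? ? ? ?.
    have E1 : degree_sum A = 0 by nlia.
    have E2 : #|A| = 1 by nlia.
    have E3 : n_low_degree A <= 1 by nlia.
    rewrite E1 E2; move: Hvertex E3; clear; nia.
  (* Only the neighbour of v, if there is one, can become simplicial. *)
  have qE : n_simplicial (A :\: [set v]) <= n_simplicial A + 1.
    rewrite /n_simplicial; have [t0 t0P] : exists t, nbhd A v \subset [set t].
      have [/set0Pn[t tN]|] := boolP (nbhd A v != set0); last first.
        by rewrite negbK => /eqP ->; exists v; rewrite sub0set.
      by exists t; apply/subsetP => z zN; rewrite inE; apply/eqP; apply: (card_le1_eqP d1).
    apply: (@leq_trans #|t0 |: [set w in A | simplicial A w]|); last first.
      by rewrite cardsU1; case: (_ \notin _); rewrite addnC // leq_add2l.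
    apply: subset_leq_card; apply/subsetP => w; rewrite !inE.
    case: (eqVneq w t0) => //= wt0 /andP[/andP[wv wA]] sw.
    rewrite wA -(simpD [set v] w) ?inE //.
    apply/pred0P => z /=; rewrite !inE; apply/negP => /andP[/andP[zA wz] /eqP zv].
    case/negP: wt0; have := subsetP t0P w; rewrite !inE wA e_sym -zv wz.
    by move=> /(_ isT).
  have := IH _ vsA _ Av0; rewrite -card_gt0 cards1 => /(_ isT).
  move: Hleaf dsE cE lE d1' d1 qE; clear.
  move: (degree_sum A) (degree_sum _) (n_low_degree A) (n_low_degree _) (n_simplicial A) (n_simplicial _) #|A| #|_ :\: _| #|nbhd A v| #|nbhd _ v| => a a' l l' s s' c c' d d'.
  move=> h1 -> -> hl hd' hd hs; nia.
- pose B := [set u; v].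
  have BA : B \subset A by rewrite subUset !sub1set uA vA.
  have cB : #|B| = 2 by rewrite cards2 uv.
  have dsE := dsum_setD BA.
  have cE := cardA _ BA; rewrite cB in cE.
  have lE := nlow_setD A B; rewrite cB in lE.
  have [sA tA] : s \in A /\ t \in A.
    have : s \in nbhd A u by rewrite nu !inE eqxx orbT.
    have : t \in nbhd A v by rewrite nv !inE eqxx orbT.
    by rewrite !inE => /andP[-> _] /andP[-> _].
  have bB : \sum_(w in B) (#|nbhd A w| + #|nbhd (A :\: B) w|) <= 6.
    have n1 w a b : a \in B -> nbhd A w = [set a; b] -> #|nbhd A w| + #|nbhd (A :\: B) w| <= 3.
      move=> aB nE; have h1 : #|nbhd A w| <= 2 by rewrite nE cards2; case: (_ != _).
      have : #|nbhd (A :\: B) w| <= #|[set b]|.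
        apply: subset_leq_card; apply/subsetP => z.
        rewrite [z \in nbhd _ _]inE in_setD => /andP[/andP[zB zA] wz].
        have : z \in nbhd A w by rewrite inE zA.
        by rewrite nE !inE => /orP[/eqP za|//]; rewrite za aB in zB.
      by rewrite cards1; nlia.
    have sumB (F : T -> nat) : \sum_(w in B) F w = F u + F v.
      by rewrite /B big_setU1 ?inE //= big_set1.
    have h1 := n1 u v s _ nu; have h2 := n1 v u t _ nv.
    rewrite sumB; apply: (@leq_add _ _ 3 3); [apply: h1|apply: h2];
    by rewrite !inE eqxx ?orbT.
  have qE : n_simplicial (A :\: B) <= n_simplicial A.
    apply: subset_leq_card; apply/subsetP => w; rewrite inE in_setD.
    case/andP => /andP[wB wA] sw; rewrite inE wA /=.
    have [wst|wst] := boolP (w \in [set s; t]); last first.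
      rewrite -(simpD B) //; apply/pred0P => z /=; apply/negP.
      rewrite !inE => /andP[/andP[zA wz] /orP[]/eqP zE]; case/negP: wst; subst z.
        have : w \in nbhd A u by rewrite inE wA e_sym.
        rewrite nu !inE => /orP[/eqP wv|->] //.
        by rewrite wv !inE eqxx orbT in wB.
      have : w \in nbhd A v by rewrite inE wA e_sym.
      rewrite nv !inE => /orP[/eqP wv|->]; last by rewrite orbT.
      by rewrite wv !inE eqxx in wB.
    (* If s = t, this vertex would have u and v besides k - 2 remaining neighbours, too many for a
       low vertex. Otherwise it has at least two remaining neighbours, which should form a clique,
       although one of them is adjacent to no other. *)
    exfalso; case/simplicialP: sw => cw clw.
    case: iso => [st|iso].
      have wE : w = s by move: wst; rewrite -st !inE orbb => /eqP.
      have su : u \in nbhd A s.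
        rewrite inE uA e_sym; have : s \in nbhd A u by rewrite nu !inE eqxx orbT.
        by rewrite inE => /andP[].
      have sv : v \in nbhd A s.
        rewrite inE vA e_sym; have : s \in nbhd A v by rewrite nv st !inE eqxx orbT.
        by rewrite inE => /andP[].
      have := degA A s (subxx _) sA.
      rewrite (cardsD1 u) su (cardsD1 v) in_setD1 eq_sym uv sv /=.
      have : #|nbhd (A :\: B) s| <= #|nbhd A s :\ u :\ v|.
        apply: subset_leq_card; apply/subsetP => z; rewrite !inE negb_or.
        by case/andP => /andP[/andP[-> ->] ->] ->.
      by rewrite -wE cw; move: k4; nlia.
    have [y yN iy] := iso w wst.
    have NE : nbhd (A :\: B) w = nbhd A w :\: B.
      by apply/setP => z; rewrite !inE -andbA.
    have : 1 < #|nbhd (A :\: B) w| by rewrite cw; move: k4; nlia.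
    case/card_gt1P => a [b [aN bN ab]].
    have [c [cN cy]] : exists c, c \in nbhd (A :\: B) w /\ c != y.
      by case: (eqVneq a y) => [ay|]; [exists b; rewrite -ay eq_sym | exists a].
    have := iy c; rewrite -NE => /(_ cN cy); rewrite clw //.
    by rewrite NE.
  have := IH _ BA; rewrite -card_gt0 cB => /(_ isT).
  have -> : A :\: B != set0.
    apply/set0Pn; exists s; rewrite in_setD suv //.
  move=> /(_ isT).
  move: Hpair dsE cE lE bB qE; clear.
  move: (degree_sum A) (degree_sum _) (n_low_degree A) (n_low_degree _) (n_simplicial A) (n_simplicial _) #|A| #|_ :\: _| (\sum_(w in B) _) => a a' l l' s s' c c' d.
  move=> h1 -> -> hl hd hs; nia.
set j := #|Q| in Q3.
have nbQ v : v \in Q -> #|nbhd A v| = j.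
  move=> vQ; rewrite nQ //; have := cardsU1 x Q.
  by rewrite xQ (cardsD1 v (x |: Q)) in_setU1 vQ orbT -/j !add1n => -[].
have xin v : v \in Q -> x \in nbhd A v.
  move=> vQ; rewrite nQ // !inE eqxx /=; rewrite andbT.
  by apply: contraNneq xQ => ->.
have QN : Q \subset nbhd A x.
  apply/subsetP => v vQ; rewrite inE (subsetP QA) // e_sym.
  by have := xin v vQ; rewrite inE => /andP[].
have jk : j <= k - 2.
  have jlt : j < k.
    have [v vQ] : exists v, v \in Q by apply/card_gt0P; apply: leq_trans Q3.
    by rewrite -(nbQ v vQ); apply: degA => //; apply: (subsetP QA).
  suff : j != k.-1 by move: jlt k4; nlia.
  apply/negP => /eqP jE; apply: (@no_cliqueL (x |: Q)).
  - by rewrite subUset sub1set !(subset_trans _ AL) ?sub1set ?(subsetP AL).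
  - move=> y z; rewrite !inE => /orP[/eqP->|yQ] /orP[/eqP->|zQ] yz.
    + by rewrite eqxx in yz.
    + by have := subsetP QN _ zQ; rewrite inE => /andP[].
    + by rewrite e_sym; have := subsetP QN _ yQ; rewrite inE => /andP[].
    + have : z \in nbhd A y by rewrite nQ // !inE eq_sym yz zQ orbT.
      by rewrite inE => /andP[].
  - by rewrite cardsU1 xQ -/j jE; move: k4; nlia.
have dsE := dsum_setD QA.
have cE := cardA _ QA.
have nbx v : v \in Q -> #|nbhd (A :\: Q) v| = 1.
  move=> vQ; rewrite -(cards1 x); congr #|pred_of_set _|; apply/setP => z.
  have zN : (z \in nbhd A v) = (z != v) && ((z == x) || (z \in Q)) by rewrite nQ // !inE.
  have := zN; rewrite !inE; case: (boolP (z \in Q)) => zQ /=.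
    by move=> _; apply/esym/negbTE; apply: contraNneq xQ => <-.
  move=> ->; rewrite orbF; case: (eqVneq z x) => [->|]; rewrite ?andbF // andbT.
  by apply: contraNneq xQ => ->.
have sQ : \sum_(v in Q) (#|nbhd A v| + #|nbhd (A :\: Q) v|) = j * (j + 1).
  by rewrite (eq_bigr (fun=> j + 1)) ?sum_nat_const // => v vQ; rewrite nbQ ?nbx.
have nxE : #|nbhd (A :\: Q) x| + j < k.
  have := degA A x (subxx _) xA; rewrite -(cardsID Q) (setIidPr QN) -/j addnC.
  suff -> : nbhd (A :\: Q) x = nbhd A x :\: Q by [].
  by apply/setP => z; rewrite !inE andbA.
have otherQ w : w \in A -> w \notin Q -> w != x -> [disjoint nbhd A w & Q].
  move=> wA wQ wx; apply/pred0P => z /=; apply/negP => /andP[wz zQ].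
  have : w \in nbhd A z by move: wz; rewrite !inE wA e_sym => /andP[].
  by rewrite nQ // !inE (negbTE wx) (negbTE wQ) andbF.
have notx : ~~ simplicial (A :\: Q) x.
  by apply/negP => /simplicialP[cx _]; move: nxE Q3; rewrite cx; nlia.
have Qn0 : Q != set0 by rewrite -card_gt0; apply: leq_trans Q3.
have AQ0 : A :\: Q != set0 by apply/set0Pn; exists x; rewrite inE xQ.
(* In A, the vertex x sees all of Q and so has degree above 2, and so has every vertex of Q. Thus x
   is newly counted and nothing is lost. *)
have lowE : #|nbhd (A :\: Q) x| <= 2 -> n_low_degree A + 1 <= n_low_degree (A :\: Q).
  move=> x2; rewrite /n_low_degree (cardsD1 x [set v in A :\: Q | _]) !inE xQ xA x2 addnC leq_add2l.
  apply: subset_leq_card; apply/subsetP => v; rewrite !inE => /andP[vA v2].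
  have vx : v != x.
    apply: contraTneq v2 => ->; rewrite -ltnNge; apply: leq_trans Q3 _.
    exact: subset_leq_card.
  have vQ : v \notin Q by apply: contraTN v2 => vQ; rewrite nbQ // -ltnNge.
  by rewrite vx vQ vA /= nbD // otherQ.
have IHQ := IH Q QA Qn0 AQ0.
case: (ltnP j (k - 2)) => jk2.
  have [Hj k3] := Hsmall Q3 jk2.
  have qE : n_simplicial (A :\: Q) <= n_simplicial A.
    apply: subset_leq_card; apply/subsetP => w; rewrite !inE.
    case/andP => /andP[wQ wA] sw; have wx : w != x by apply: contraTneq sw => ->.
    by rewrite wA -(simpD Q) // otherQ.
  have lE : n_low_degree A + 1 <= n_low_degree (A :\: Q) by apply: lowE; move: nxE k3; nlia.
  move: IHQ Hj dsE cE; rewrite sQ -/j; move: qE lE; clear.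
  move: (degree_sum A) (degree_sum _) (n_low_degree A) (n_low_degree _) (n_simplicial A) (n_simplicial _) #|A| #|_ :\: _| => a a' l l' s s' c c'.
  move=> hs hl h1 h2 -> ->; nia.
have jE : j = k - 2 by move: jk jk2; nlia.
have qE : n_simplicial (A :\: Q) + j <= n_simplicial A.
  have dis : [disjoint [set v in A :\: Q | simplicial (A :\: Q) v] & Q].
    by apply/pred0P => z /=; apply/negP; rewrite !inE => /andP[/andP[/andP[/negP h _] _]].
  rewrite /n_simplicial /j -cardsUI (_ : _ :&: Q = set0) ?cards0 ?addn0; last first.
    by apply/eqP; rewrite setI_eq0.
  apply: subset_leq_card; apply/subsetP => w; rewrite !inE.
  case/orP => [/andP[/andP[wQ wA] sw]|wQ].
    have wx : w != x by apply: contraTneq sw => ->.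
    by rewrite wA -(simpD Q) // otherQ.
  rewrite (subsetP QA) //=; apply/simplicialP; split; first by rewrite nbQ.
  move=> y z; rewrite nQ // !inE => /andP[_ yQ] /andP[_ zQ] yz.
  have key y' z' : y' \in Q -> (z' == x) || (z' \in Q) -> y' != z' -> e y' z'.
    move=> yQ' zQ' yz'; have : z' \in nbhd A y' by rewrite nQ // !inE eq_sym yz'.
    by rewrite inE => /andP[].
  case/orP: yQ => [/eqP yx|yQ]; last exact: key.
  rewrite e_sym; apply: key; rewrite 1?eq_sym //; last by rewrite yx eqxx.
  by case/orP: zQ => // /eqP zx; rewrite yx zx eqxx in yz.
have lE : n_low_degree A + 1 <= n_low_degree (A :\: Q) by apply: lowE; move: nxE jE k4; nlia.
have Hj : al * (j * (j + 1)) <= (be + ga) * j + si.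
  have -> : j + 1 = k - 1 by move: jE k4; nlia.
  by rewrite jE.
move: IHQ Hj dsE cE; rewrite sQ -/j; move: qE lE; clear.
move: (degree_sum A) (degree_sum _) (n_low_degree A) (n_low_degree _) (n_simplicial A) (n_simplicial _) #|A| #|_ :\: _| => a a' l l' s s' c c'.
move=> hs hl h1 h2 -> ->; nia.
Qed.

End EdgeBound.

Section Dist.
Variables (T : finType) (r : rel T) (w : T).

Definition reaches n x := [exists t : n.-tuple T, path r w t && (last w t == x)].
(** Distance from w; the default of [find] gives [#|T|] to unreachable vertices, so the value is
    always at most [#|T|]. *)
Definition bfs_dist x := find (fun n => reaches n x) (iota 0 #|T|).

Lemma dist_max x : bfs_dist x <= #|T|.
Proof. by rewrite -[leqRHS](size_iota 0); apply: find_size. Qed.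

Lemma dist_step x : connect r w x -> x != w ->
  exists z, [/\ connect r w z, r z x & bfs_dist z < bfs_dist x].
Proof.
case/connectP => p0 pp0; case/shortenP: pp0 => p pp up _ xE xw.
have hp : reaches (size p) x.
  by apply/existsP; exists (in_tuple p); rewrite pp xE eqxx.
have sp : size p < #|T|.
  by have := max_card [in w :: p]; rewrite (card_uniqP up).
have hx : has (fun n => reaches n x) (iota 0 #|T|).
  by apply/hasP; exists (size p); rewrite // mem_iota.
have := nth_find 0 hx; have := hx; rewrite has_find size_iota -/(bfs_dist x) => dx.
rewrite nth_iota // add0n => /existsP[t /andP[]].
have st : size t = bfs_dist x by rewrite size_tuple.
case/lastP: (tval t) st => [|q y] sq /=; first by rewrite eq_sym (negbTE xw).
rewrite rcons_path last_rcons => /andP[pq ry] /eqP yx; subst y.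
exists (last w q); split=> //; first by apply/connectP; exists q.
move: sq; rewrite size_rcons => <-; rewrite ltnS leqNgt; apply/negP => lt.
have := before_find 0 lt; rewrite nth_iota; last first.
  by apply: leq_trans lt _; apply: dist_max.
rewrite add0n => /negbT/existsP; apply.
by exists (in_tuple q); rewrite pq eqxx.
Qed.

End Dist.

(** * Gadgets *)

Section Gadgets.
Variables (T : finType) (G : sgraph T) (k : nat).
Hypothesis Gcrit : AT_critical k G.
Local Notation e := (adj G).
Local Notation deg v := #|[set w | adj G v w]|.
Implicit Types (D : {set T * T}) (A C S Y : {set T}) (v w u p x y c : T).

Definition within A : rel T := [rel x y | [&& x \in A, y \in A & adj G x y]].

(* [w] and [u] are twins in [S]: a walk that enters [S] by the arc p -> w can,
   up to cancellation, only leave it through [u], to a vertex of [Y] above [p]. *)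
Record gadget Y S w u p : Prop := Gadget {
  gadget_w : w \in S;
  gadget_u : u \in S;
  gadget_wu : e w u;
  gadget_connect : forall x, x \in S -> connect (within S) w x;
  gadget_wc : forall c, c \in S -> c != u -> e w c -> e u c;
  gadget_uc : forall c, c \in S -> c != w -> e u c -> e w c;
  gadget_p : p \in Y;
  gadget_wp : forall y, y \in Y -> e w y = (y == p);
  gadget_up : forall y, y \in Y -> e u y -> enum_rank p < enum_rank y
}.

(** All edges go upwards in [rho], except that each w is entered from its p, which lies above it.
    The distance from w supplies every vertex of a gadget with an in-neighbour. Once the twin arcs
    are cancelled, w can only continue to u, and u only to vertices of Y above p, so [phi] increases
    along all remaining arcs. *)
Lemma gadgets_reducible Y (TT : {set {set T}}) (cmp : T -> {set T})
    (S : {set T} -> {set T}) (W U P : {set T} -> T) :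
    Y :|: \bigcup_(C in TT) S C != set0 ->
    (forall y, y \in Y -> y \in verts G /\ deg y <= k) ->
    (forall C, C \in TT -> gadget Y (S C) (W C) (U C) (P C)) ->
    (forall C x, C \in TT -> x \in S C ->
       [/\ x \in verts G, deg x < k, x \notin Y & cmp x = C]) ->
    (forall C C' x y, C \in TT -> C' \in TT -> x \in S C -> y \in S C' ->
       e x y -> C = C') ->
    (forall y, y \in Y -> 2 + #|[set C in TT | P C == y]| <=
       #|[set x in \bigcup_(C in TT) S C | e x y]|) ->
  False.
Proof.
set B := \bigcup_(C in TT) S C; set A := Y :|: B.
move=> A0 YP gad SP eSS inY.
have SPc C x (CT : C \in TT) (xS : x \in S C) : cmp x = C by have [] := SP _ _ CT xS.
have SPY C x (CT : C \in TT) (xS : x \in S C) : x \notin Y by have [] := SP _ _ CT xS.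
have memB x : x \in B -> (cmp x \in TT) /\ (x \in S (cmp x)).
  by case/bigcupP => C CT xS; rewrite (SPc _ _ CT xS).
have inB C x : C \in TT -> x \in S C -> x \in B.
  by move=> CT xS; apply/bigcupP; exists C.
have BY x : x \in B -> x \notin Y by case/memB; apply: SPY.
pose N := #|T|.
(* Level 0 for w, 1 for u, then the distance from w shifted by 2; distances are at most N, so N + 3
   places Y on top. [rho] refines the level lexicographically by [enum_rank]. *)
pose lev x := if x \in Y then N + 3 else
  if x == W (cmp x) then 0 else if x == U (cmp x) then 1 else
  2 + bfs_dist (within (S (cmp x))) (W (cmp x)) x.
pose rho x := lev x * N + enum_rank x.
have rho_lev x y : lev x < lev y -> rho x < rho y.
  rewrite /rho => h; apply: (@leq_trans ((lev x).+1 * N)).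
    by rewrite mulSn addnC ltn_add2r.
  by apply: leq_trans (leq_addr _ _); rewrite leq_mul2r h orbT.
have rho_eq x y : lev x = lev y -> (rho x < rho y) = (enum_rank x < enum_rank y).
  by move=> h; rewrite /rho h ltn_add2l.
have rho_inj x y : rho x = rho y -> x = y.
  move=> h; apply: enum_rank_inj; apply: val_inj => /=.
  case: (ltngtP (lev x) (lev y)) => [/rho_lev|/rho_lev|E]; rewrite ?h ?ltnn //.
  by move: h; rewrite /rho E => /addnI.
have lev_lt x y : rho x < rho y -> lev x <= lev y.
  by move=> h; rewrite leqNgt; apply/negP => /rho_lev; rewrite ltnNge ltnW.
pose special x y := [&& y \in B, y == W (cmp y) & x == P (cmp y)].
pose D := [set a | [&& a.1 \in A, a.2 \in A, e a.1 a.2 &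
   special a.1 a.2 || (~~ special a.2 a.1 && (rho a.1 < rho a.2))]].
have DE x y : ((x, y) \in D) = [&& x \in A, y \in A, e x y &
   special x y || (~~ special y x && (rho x < rho y))] by rewrite inE.
have WS C : C \in TT -> W C \in S C by move=> /gad/gadget_w.
have US C : C \in TT -> U C \in S C by move=> /gad/gadget_u.
have WU C : C \in TT -> W C != U C by move=> /gad/gadget_wu/adj_neq.
have cW C : C \in TT -> cmp (W C) = C by move=> CT; apply: SPc (WS _ CT).
have cU C : C \in TT -> cmp (U C) = C by move=> CT; apply: SPc (US _ CT).
have PY C : C \in TT -> P C \in Y by move=> /gad/gadget_p.
have specialP x y : special x y -> exists2 C, C \in TT & x = P C /\ y = W C.
  by case/and3P => /memB[cT _] /eqP yE /eqP xE; exists (cmp y).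
have specialW C : C \in TT -> special (P C) (W C).
  by move=> CT; rewrite /special (inB C) ?WS // cW // !eqxx.
have special_asym x y : special x y -> special y x -> False.
  move=> /specialP[C CT [xE yE]] /specialP[C' CT' [yE' _]].
  by have := SPY _ _ CT (WS _ CT); rewrite -yE yE' PY.
have levW C : C \in TT -> lev (W C) = 0.
  by move=> CT; rewrite /lev (negbTE (SPY _ _ CT (WS _ CT))) cW // eqxx.
have levU C : C \in TT -> lev (U C) = 1.
  move=> CT; rewrite /lev (negbTE (SPY _ _ CT (US _ CT))) cU // eqxx.
  by rewrite eq_sym (negbTE (WU _ CT)).
have levO C x : C \in TT -> x \in S C -> x != W C -> x != U C ->
    lev x = 2 + bfs_dist (within (S C)) (W C) x.
  move=> CT xS xW xU; rewrite /lev (negbTE (SPY _ _ CT xS)) (SPc _ _ CT xS).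
  by rewrite (negbTE xW) (negbTE xU).
have levY y : y \in Y -> lev y = N + 3 by rewrite /lev => ->.
have levB x : x \in B -> lev x < N + 3.
  move=> xB; rewrite /lev (negbTE (BY _ xB)).
  case: ifP => _; first by rewrite addn3.
  case: ifP => _; first by rewrite addn3.
  by have := dist_max (within (S (cmp x))) (W (cmp x)) x; rewrite /N; nlia.
have irrD x : (x, x) \notin D by rewrite DE adj_irr !andbF.
have inW C x : C \in TT -> (x, W C) \in D -> x = P C.
  move=> CT; rewrite DE => /and4P[xA _ exW].
  case/orP => [/and3P[_ _ /eqP->]|/andP[_ lt]]; first by rewrite cW.
  case/setUP: xA => [xY|xB].
    by have := gadget_wp (gad _ CT) xY; rewrite adj_sym exW => /esym/eqP.
  have [cT xS] := memB _ xB.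
  have := eSS _ _ _ _ cT CT xS (WS _ CT) exW => cE; rewrite cE in xS.
  have := lev_lt _ _ lt; rewrite levW // leqn0.
  have xW : x != W C by apply: adj_neq exW.
  have [->|xU] := eqVneq x (U C); first by rewrite levU.
  by rewrite (levO C).
have inU C x : C \in TT -> (x, U C) \in D -> x = W C.
  move=> CT; rewrite DE => /and4P[xA _ exU].
  case/orP => [/and3P[_ /eqP E _]|/andP[_ lt]].
    by rewrite cU // in E; have := WU _ CT; rewrite E eqxx.
  have := lev_lt _ _ lt; rewrite levU //.
  case/setUP: xA => [xY|xB]; first by rewrite levY // addn3.
  have [cT xS] := memB _ xB.
  have := eSS _ _ _ _ cT CT xS (US _ CT) exU => cE; rewrite cE in xS.
  have [-> //|xW] := eqVneq x (W C).
  by rewrite (levO C) // (adj_neq exU).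
have inA C x : C \in TT -> x \in S C -> x \in A.
  by move=> CT xS; rewrite inE (inB C) ?orbT.
have PA C : C \in TT -> P C \in A by move=> /PY h; rewrite inE h.
have ltWO C c : C \in TT -> c \in S C -> c != W C -> rho (W C) < rho c.
  move=> CT cS cW'; apply: rho_lev; rewrite levW //.
  have [->|cU'] := eqVneq c (U C); first by rewrite levU.
  by rewrite (levO C).
have ltUO C c : C \in TT -> c \in S C -> c != W C -> c != U C -> rho (U C) < rho c.
  by move=> CT cS cW' cU'; apply: rho_lev; rewrite levU // (levO C).
have spS C x y : C \in TT -> x \in S C -> y \in S C -> special x y = false.
  move=> CT xS yS; apply/negP => /specialP[C' CT' [xE _]].
  by have := SPY _ _ CT xS; rewrite xE PY.
have arcS C x y : C \in TT -> x \in S C -> y \in S C -> e x y -> rho x < rho y ->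
    (x, y) \in D.
  move=> CT xS yS xy lt.
  by rewrite DE (inA C) // (inA C y) // xy lt (spS C) // (spS C y x).
have wu_arc C : C \in TT -> (W C, U C) \in D.
  move=> CT; apply: (arcS C); rewrite ?WS ?US //; first exact: gadget_wu (gad _ CT).
  by apply: ltWO; rewrite ?US // eq_sym WU.
have outW C c : C \in TT -> (W C, c) \in D -> c \in S C.
  move=> CT; rewrite DE => /and4P[_ cA eWc].
  case/orP => [/specialP[C' CT' [E _]]|/andP[nsp _]].
    by have := SPY _ _ CT (WS _ CT); rewrite E PY.
  case/setUP: cA => [cY|cB].
    have := gadget_wp (gad _ CT) cY; rewrite eWc => /esym/eqP cE.
    by rewrite cE specialW in nsp.
  have [cT cS] := memB _ cB.
  by rewrite (eSS _ _ _ _ CT cT (WS _ CT) cS eWc).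
have arcW C c : C \in TT -> c \in S C -> e (W C) c -> (W C, c) \in D.
  move=> CT cS eWc; apply: (arcS C); rewrite ?WS //.
  by apply: ltWO; rewrite // eq_sym (adj_neq eWc).
pose gs := [seq (W C, U C) | C <- enum TT].
have gsP g : g \in gs -> exists2 C, C \in TT & g = (W C, U C).
  by case/mapP => C; rewrite mem_enum; exists C.
pose big := (\max_x rho x).+1.
have rho_big x : rho x < big by rewrite /big ltnS; apply: leq_bigmax.
(* The factor 3 leaves room for w and u strictly between p and the next vertex of Y; [big] keeps the
   remaining gadget vertices, which retain [rho], below all of these. *)
pose phi x := if x \in Y then big + 3 * enum_rank x else
  if x == W (cmp x) then big + 3 * enum_rank (P (cmp x)) + 1 else
  if x == U (cmp x) then big + 3 * enum_rank (P (cmp x)) + 2 else rho x.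
have phiY y : y \in Y -> phi y = big + 3 * enum_rank y by rewrite /phi => ->.
have phiW C : C \in TT -> phi (W C) = big + 3 * enum_rank (P C) + 1.
  by move=> CT; rewrite /phi (negbTE (SPY _ _ CT (WS _ CT))) cW // eqxx.
have phiU C : C \in TT -> phi (U C) = big + 3 * enum_rank (P C) + 2.
  move=> CT; rewrite /phi (negbTE (SPY _ _ CT (US _ CT))) cU // eqxx.
  by rewrite eq_sym (negbTE (WU _ CT)).
have phiO C x : C \in TT -> x \in S C -> x != W C -> x != U C -> phi x = rho x.
  move=> CT xS xW xU; rewrite /phi (negbTE (SPY _ _ CT xS)) (SPc _ _ CT xS).
  by rewrite (negbTE xW) (negbTE xU).
have sgD : signed_eul D = 1%R.
  apply: (@signed_eul_twins _ gs _ phi) => //.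
  - rewrite pairwise_map; have := enum_uniq TT; rewrite uniq_pairwise.
    apply: (@sub_in_pairwise _ [in TT]); last by apply/allP => C; rewrite mem_enum.
    move=> C C' CT CT' /= ne.
    have dis x y : x \in S C -> y \in S C' -> x != y.
      move=> xS yS; apply: contraNneq ne => xy; apply/eqP.
      by rewrite -(SPc _ _ CT xS) xy (SPc _ _ CT' yS).
    by rewrite !dis ?WS ?US.
  - move=> g /gsP[C CT ->]; split=> /=.
    + rewrite /indeg -(cards1 (P C, W C)).
      apply: subset_leq_card; apply/subsetP => -[x y]; rewrite inE.
      move=> /andP[xyD /eqP /= yE]; rewrite yE in xyD *.
      by rewrite (inW _ _ CT xyD) inE.
    + by move=> x /(inU _ _ CT).
    + exact: wu_arc.
    + move=> c /[dup] /(outW _ _ CT) cS; rewrite DE => /and4P[_ _ eWc _] cU'.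
      have cW' : c != W C by rewrite eq_sym (adj_neq eWc).
      apply: (arcS C); rewrite ?US //; last exact: ltUO.
      exact: (gadget_wc (gad _ CT)).
  move=> [x y] xyD nota /=.
  have := xyD; rewrite DE => /and4P[xA yA exy].
  case/orP => [/specialP[C CT [-> ->]]|/andP[nsp lt]].
    by rewrite phiY ?PY // phiW // addn1.
  have llt := lev_lt _ _ lt.
  case/setUP: yA => [yY|yB].
    rewrite (phiY _ yY); case/setUP: xA => [xY|xB].
      rewrite phiY // ltn_add2l ltn_pmul2l //.
      by rewrite -rho_eq // !levY.
    have [CT xS] := memB _ xB; move: (cmp x) CT xS => C CT xS.
    have [xW|xW] := eqVneq x (W C).
      have := gadget_wp (gad _ CT) yY; rewrite -xW exy => /esym/eqP yE.
      by rewrite yE xW specialW in nsp.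
    have [xU|xU] := eqVneq x (U C).
      rewrite xU phiU // -addnA ltn_add2l.
      have := gadget_up (gad _ CT) yY; rewrite -xU => /(_ exy).
      by move: (enum_rank _ : nat) (enum_rank y : nat) => a b; clear; nlia.
    by rewrite (phiO C) //; apply: leq_trans (rho_big x) (leq_addr _ _).
  have xB : x \in B.
    case/setUP: xA => // xY; move: llt; rewrite (levY _ xY) leqNgt.
    by rewrite levB.
  have [CT yS] := memB _ yB; move: (cmp y) CT yS => C CT yS.
  have [cT xS] := memB _ xB.
  have cE := eSS _ _ _ _ cT CT xS yS exy; rewrite cE in xS.
  have [yW|yW] := eqVneq y (W C).
    by have := SPY _ _ CT xS; rewrite (inW C x CT) ?PY // -yW.
  have nota' : (x, y) \notin twin_arcs D (W C) (U C).
    apply: (nota (W C, U C)); apply/mapP; exists C => //.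
    by rewrite mem_enum.
  have [yU|yU] := eqVneq y (U C).
    rewrite yU (inU C x CT) -?yU // phiW // yU phiU //.
    by rewrite addn1 addn2.
  have nWU : (e (W C) y) -> (x != W C) && (x != U C).
    move=> eWy; apply: contraNT nota'; rewrite -negb_or negbK => h.
    by rewrite inE /= h yU (arcW C).
  have [xW|xW] := eqVneq x (W C).
    by have := nWU; rewrite -xW exy eqxx => /(_ isT).
  have [xU|xU] := eqVneq x (U C).
    have := nWU; rewrite (gadget_uc (gad _ CT)) // -?xU // eqxx andbF.
    by move=> /(_ isT).
  by rewrite (phiO C) // (phiO C y).
apply: (critical_irreducible Gcrit (A := A) (D := D)) => //.
- apply/subsetP => x /setUP[/YP[]//|/memB[cT xS]].
  by have [] := SP _ _ cT xS.
- split=> x y.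
    rewrite !DE (adj_sym G y x).
    case: (x \in A); rewrite ?andbF //=; case: (y \in A) => //=.
    case: (boolP (e x y)) => //= exy.
    case: (boolP (special x y)) => //= nsp1; case: (boolP (special y x)) => //= nsp2.
    apply/orP; case: (ltngtP (rho x) (rho y)) => [|| /rho_inj xy]; auto.
    by rewrite xy adj_irr in exy.
  rewrite !DE; apply/negP => /andP[/and4P[_ _ _ h1] /and4P[_ _ _ h2]].
  case/orP: h1 => [s1|/andP[s1 l1]]; case/orP: h2 => [s2|/andP[s2 l2]].
  + exact: special_asym s1 s2.
  + by rewrite s1 in s2.
  + by rewrite s2 in s1.
  + by have := ltn_trans l1 l2; rewrite ltnn.
- by rewrite sgD oner_neq0.
move=> v /setUP[vY|vB].
  have [_ dv] := YP _ vY; rewrite addnC leq_add //.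
  (* All neighbours of v in B point to v, except the vertices w entered from v, one for each member
     of Z. *)
  have := inY _ vY; set Z := [set C in TT | P C == v].
  set X := [set x in B | e x v] => hv; pose WZ := [set W C | C in Z].
  apply: (@leq_trans #|X :\: WZ|).
    have h1 : #|WZ| <= #|Z| := leq_imset_card _ _.
    have h2 : #|X :&: WZ| <= #|WZ| by apply: subset_leq_card; apply: subsetIr.
    by move: hv (cardsID WZ X) => h3 h4; nlia.
  have inj : injective (fun x : T => (x, v)) by move=> x1 x2 [].
  rewrite /indeg -(card_imset _ inj); apply: subset_leq_card.
  apply/subsetP => a /imsetP[x]; rewrite in_setD => /andP[nW]; rewrite inE => /andP[xB exv] ->.
  rewrite inE /= eqxx andbT DE exv !in_setU xB vY orbT /=.
  have -> : special v x = false.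
    apply/negP => /specialP[C CT [vE xE]]; case/negP: nW.
    by apply/imsetP; exists C; rewrite // inE CT vE eqxx.
  by rewrite /= rho_lev ?orbT // (levY v vY) levB.
have [CT vS] := memB _ vB; move: (cmp v) CT vS => C CT vS.
have [_ dv _ _] := SP _ _ CT vS.
suff : 0 < indeg D v by move: dv; clear; nlia.
apply/indegP; have [->|vW] := eqVneq v (W C).
  exists (P C); rewrite DE PA // (inA C) ?WS // specialW //= andbT.
  by rewrite adj_sym (gadget_wp (gad _ CT)) ?PY.
have [->|vU] := eqVneq v (U C); first by exists (W C); apply: wu_arc.
have [z [zc /and3P[zS _ ezv] lt]] := dist_step (gadget_connect (gad _ CT) vS) vW.
exists z; apply: (arcS C) => //.
have [->|zW] := eqVneq z (W C); first exact: ltWO.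
have [->|zU] := eqVneq z (U C); first exact: ltUO.
by apply: rho_lev; rewrite (levO C) // (levO C) // ltn_add2l.
Qed.

End Gadgets.

(** * Balanced choice of one of two ends *)

Section Balanced.
Variables (I : finType) (T : eqType).

(* Viewing i as an edge joining f1 i and f2 i, this is a balanced orientation;
   two edges at a common end are split off and replaced by a single one. *)
Lemma balanced_choice (TT : {set I}) (f1 f2 : I -> T) :
  exists g : I -> T, (forall i, i \in TT -> g i = f1 i \/ g i = f2 i) /\
    forall y, 2 * \sum_(i in TT) (g i == y) <=
      \sum_(i in TT) (f1 i == y) + \sum_(i in TT) (f2 i == y) + 1.
Proof.
have [n] := ubnP #|TT|; elim: n TT f1 f2 => // n IHn TT f1 f2; rewrite ltnS => TTn.
have [TT0|[i iT]] := set_0Vmem TT.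
  by exists f1; split=> [i|y]; [left | rewrite TT0 !big_set0].
have lt_n : #|TT :\ i| < n by apply: leq_trans TTn; rewrite (cardsD1 i TT) iT.
have D1 (F : I -> nat) : \sum_(x in TT) F x = F i + \sum_(x in TT :\ i) F x.
  by rewrite (big_setD1 i).
case: (boolP [exists j in TT :\ i, (f1 j == f1 i) || (f2 j == f1 i)]); last first.
  move=> /exists_inPn no; have [g [gf gl]] := IHn (TT :\ i) f1 f2 lt_n.
  exists (fun x => if x == i then f1 i else g x); split.
    by move=> x xT; case: (eqVneq x i) => [->|xi]; [left | apply: gf; rewrite !inE xi].
  move=> y; rewrite !D1 eqxx.
  have -> : \sum_(x in TT :\ i) ((if x == i then f1 i else g x) == y) =
            \sum_(x in TT :\ i) (g x == y).
    by apply: eq_bigr => x; rewrite !inE => /andP[/negbTE ->].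
  have := gl y; have [yE|_] := eqVneq (f1 i) y; last by nlia.
  suff -> : \sum_(x in TT :\ i) (g x == y) = 0 by nlia.
  apply: big1 => x xT; apply/eqP; rewrite eqb0 -yE.
  have := no x xT; rewrite negb_or => /andP[n1 n2].
  by case: (gf x xT) => ->.
case/exists_inP => j jT ji.
have jD1 (F : I -> nat) : \sum_(x in TT :\ i) F x = F j + \sum_(x in TT :\ i :\ j) F x.
  by rewrite (big_setD1 j).
pose oth := if f1 j == f1 i then f2 j else f1 j.
have othE y : (f1 j == y) + (f2 j == y) = (f1 i == y) + (oth == y).
  by rewrite /oth; case: eqP ji => [->|_ /= /eqP ->] //; rewrite addnC.
pose h1 x := if x == j then f2 i else f1 x.
pose h2 x := if x == j then oth else f2 x.
have [g' [gf gl]] := IHn (TT :\ i) h1 h2 lt_n.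
have jneq (h : I -> T) z y : \sum_(x in TT :\ i :\ j) ((if x == j then z else h x) == y) =
    \sum_(x in TT :\ i :\ j) (h x == y).
  by apply: eq_bigr => x; rewrite !inE => /andP[/negbTE ->].
have gj : g' j = f2 i \/ g' j = oth.
  by have := gf j jT; rewrite /h1 /h2 eqxx.
have [ij jTT] : j != i /\ j \in TT by move: jT; rewrite !inE => /andP.
have gf' x : x \in TT -> x != i -> x != j -> g' x = f1 x \/ g' x = f2 x.
  by move=> xT xi xj; have := gf x; rewrite /h1 /h2 (negbTE xj) !inE xi xT; apply.
have othP : oth = f1 j \/ oth = f2 j by rewrite /oth; case: ifP; auto.
have f1iP : f1 i = f1 j \/ f1 i = f2 j by case/orP: ji => /eqP ->; auto.
(* The merged edge joins [f2 i] and [oth]. If it chooses [oth], this is left to j and i takes the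
   common end [f1 i]; otherwise i takes [f2 i] and j the common end. Either way the common end is
   chosen exactly once by i and j. *)
case: (eqVneq (g' j) oth) => [gjE|gjN].
  exists (fun x => if x == i then f1 i else g' x); split.
    move=> x xT; case: (eqVneq x i) => [->|xi]; first by left.
    by case: (eqVneq x j) => [->|xj]; [rewrite gjE | apply: gf'].
  move=> y; rewrite !D1 eqxx.
  have -> : \sum_(x in TT :\ i) ((if x == i then f1 i else g' x) == y) =
            \sum_(x in TT :\ i) (g' x == y).
    by apply: eq_bigr => x; rewrite !inE => /andP[/negbTE ->].
  have := gl y; rewrite !jD1 /h1 /h2 eqxx !jneq; have := othE y.
  by nlia.
have gjE : g' j = f2 i by case: gj => // gjE; rewrite gjE eqxx in gjN.
exists (fun x => if x == i then f2 i else if x == j then f1 i else g' x); split.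
  move=> x xT; case: (eqVneq x i) => [->|xi]; first by right.
  by case: (eqVneq x j) => [->|xj]; [exact: f1iP | apply: gf'].
move=> y; rewrite !D1 eqxx !jD1 (negbTE ij) eqxx.
have -> : \sum_(x in TT :\ i :\ j) ((if x == i then f2 i else if x == j then f1 i else g' x) == y) =
          \sum_(x in TT :\ i :\ j) (g' x == y).
  by apply: eq_bigr => x; rewrite !inE => /and3P[/negbTE -> /negbTE ->].
have := gl y; rewrite !jD1 /h1 /h2 eqxx !jneq gjE; have := othE y.
by nlia.
Qed.

End Balanced.

(** * Cliques on k - 1 low vertices *)

Section LowVertices.
Variables (T : finType) (G : sgraph T) (k : nat).
Hypothesis Gcrit : AT_critical k G.
Hypothesis GnotK : ~ is_complete_graph k G.
Hypothesis k4 : 4 < k.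
Local Notation e := (adj G).
Local Notation deg v := #|[set w | adj G v w]|.
Implicit Types (A C S Y K Q : {set T}) (v w u p x y c : T).

Definition low := [set v in verts G | deg v < k].
Local Notation L := low.

Let e_sym : symmetric e := adj_sym G.
Let e_irr : irreflexive e := adj_irr G.

Lemma in_nb A v w : (w \in nbhd e A v) = (w \in A) && e v w.
Proof. by rewrite inE. Qed.

Lemma low_deg v : v \in L -> deg v = k.-1.
Proof.
by rewrite inE => /andP[vV dv]; have := min_degree Gcrit vV; move: dv k4; nlia.
Qed.

Lemma low_cycle s : ucycle e s -> 2 < size s -> {subset s <= L} ->
  clique_or_odd e s.
Proof.
apply: (@cycle_clique_or_odd _ e e_sym e_irr (mem L)) => {}s x y us s3 os sL xs ys chord.
apply: (no_even_cycle Gcrit (ltnW k4) us s3 os _ xs ys chord) => v /sL.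
by rewrite inE => /andP[].
Qed.

Lemma low_no_clique Q : Q \subset L -> {in Q &, forall x y, x != y -> e x y} ->
  #|Q| = k -> False.
Proof.
move=> QL cl cQ; have [v vQ] : exists v, v \in Q.
  by apply/card_gt0P; rewrite cQ; move: k4; nlia.
have k3 : 3 < k by move: k4; nlia.
have dL w : w \in Q -> deg w < k by move/(subsetP QL); rewrite inE => /andP[].
apply: (no_clique Gcrit GnotK k3 _ cl cQ vQ) => [|| w wQ _].
- by apply: subset_trans QL _; apply/subsetP => w; rewrite inE => /andP[].
- by apply: ltnW; apply: dL.
- exact: dL.
Qed.

Lemma nbL_lt v : v \in L -> #|nbhd e L v| < k.
Proof.
rewrite inE => /andP[_]; apply: leq_ltn_trans; apply: subset_leq_card.
by apply/subsetP => w; rewrite !inE => /andP[].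
Qed.

Definition low_clique K := [&& K \subset L, #|K| == k.-1 &
  [forall x in K, forall y in K, (x != y) ==> e x y]].

Lemma low_cliqueP K : reflect [/\ K \subset L, #|K| = k.-1 &
   {in K &, forall x y, x != y -> e x y}] (low_clique K).
Proof.
apply: (iffP and3P) => [[h1 /eqP h2 /forall_inP h3]|[h1 h2 h3]]; split=> //.
- by move=> x y /h3/forall_inP h /h/implyP.
- exact/eqP.
by apply/forall_inP => x xA; apply/forall_inP => y yA; apply/implyP; exact: h3.
Qed.

Definition closed_nbhd v := v |: nbhd e L v.
Local Notation simp := (simplicial e k L).

Lemma simplicial_low_clique v : v \in L -> simp v -> low_clique (closed_nbhd v).
Proof.
move=> vL /simplicialP[c cl]; apply/low_cliqueP; split.
- rewrite subUset sub1set vL /=; apply/subsetP => w; by rewrite inE => /andP[].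
- by rewrite cardsU1 c !inE e_irr andbF /=; move: k4; nlia.
move=> x y; rewrite !in_setU1 => /orP[/eqP->|xN] /orP[/eqP->|yN] xy.
- by rewrite eqxx in xy.
- by move: yN; rewrite inE => /andP[].
- by rewrite e_sym; move: xN; rewrite inE => /andP[].
- exact: cl.
Qed.

Lemma low_clique_simp K v : low_clique K -> v \in K -> #|nbhd e L v| = k - 2 ->
  simp v /\ closed_nbhd v = K.
Proof.
move=> /low_cliqueP[KL cK cl] vK c.
have sub : K :\ v \subset nbhd e L v.
  apply/subsetP => w; rewrite !inE => /andP[wv wK].
  by rewrite cl 1?eq_sym // andbT; have := subsetP KL _ wK; rewrite inE.
have E : nbhd e L v = K :\ v.
  apply/esym/eqP; rewrite eqEcard sub c.
  by move: cK; rewrite (cardsD1 v) vK; move: k4; nlia.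
split; last by rewrite /closed_nbhd E setD1K.
apply/simplicialP; split=> //; rewrite E => x y; rewrite !inE => /andP[_ xK] /andP[_ yK].
exact: cl.
Qed.

Lemma low_clique_nbL K v : low_clique K -> v \in K -> k - 2 <= #|nbhd e L v|.
Proof.
move=> /low_cliqueP[KL cK cl] vK.
have sub : K :\ v \subset nbhd e L v.
  apply/subsetP => w; rewrite !inE => /andP[wv wK].
  by rewrite cl 1?eq_sym // andbT; have := subsetP KL _ wK; rewrite inE.
have := subset_leq_card sub; move: cK; rewrite (cardsD1 v) vK; nlia.
Qed.

Lemma simp_nbc K v : low_clique K -> simp v -> v \in K -> closed_nbhd v = K.
Proof. by move=> KK /simplicialP[c _] vK; have [] := low_clique_simp KK vK c. Qed.

(** A common vertex z has fewer than k low neighbours but sees both cliques, so these share at least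
    two vertices z1, z2. Then a, z1, b, z2 is a 4-cycle of low vertices, hence a clique, and ab is
    an edge. *)
Lemma nbc_disjoint a b : a \in L -> b \in L -> simp a -> simp b -> closed_nbhd a != closed_nbhd b ->
  [disjoint closed_nbhd a & closed_nbhd b].
Proof.
move=> aL bL sa sb; apply: contraR => /pred0Pn[z /= /andP[za zb]].
have Ka := simplicial_low_clique aL sa; have Kb := simplicial_low_clique bL sb.
have [aE|aN] := boolP (a \in closed_nbhd b); first by rewrite (simp_nbc Kb sa aE).
have [bE|bN] := boolP (b \in closed_nbhd a); first by rewrite (simp_nbc Ka sb bE).
exfalso; have /low_cliqueP[KaL ca cla] := Ka; have /low_cliqueP[KbL cb clb] := Kb.
have sub : closed_nbhd a :|: closed_nbhd b \subset closed_nbhd z.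
  apply/subsetP => x; rewrite in_setU => xab; rewrite in_setU1.
  case: (eqVneq x z) => //= xz.
  rewrite inE; apply/andP; split.
    by case/orP: xab => [/(subsetP KaL)|/(subsetP KbL)].
  by case/orP: xab => xin; [apply: cla | apply: clb]; rewrite // eq_sym.
have zL : z \in L := subsetP KaL _ za.
have cz : #|closed_nbhd z| <= k.
  by rewrite cardsU1 !inE e_irr andbF /= add1n; apply: nbL_lt.
have : 1 < #|closed_nbhd a :&: closed_nbhd b|.
  have := subset_leq_card sub; rewrite cardsU ca cb; move: cz k4; nlia.
case/card_gt1P => z1 [z2 [z1i z2i z12]].
move: z1i z2i; rewrite !in_setI => /andP[z1a z1b] /andP[z2a z2b].
have aa : a \in closed_nbhd a by rewrite in_setU1 eqxx.
have bb : b \in closed_nbhd b by rewrite in_setU1 eqxx.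
have az1 : a != z1 by apply: contraNneq aN => ->.
have az2 : a != z2 by apply: contraNneq aN => ->.
have bz1 : b != z1 by apply: contraNneq bN => ->.
have bz2 : b != z2 by apply: contraNneq bN => ->.
have ab : a != b by apply: contraNneq aN => ->.
have [|||/(_ a b)|[]] // := @low_cycle [:: a; z1; b; z2].
- rewrite /ucycle /= (cla a z1) // (clb z1 b) // 1?eq_sym // (clb b z2) // (cla z2 a) // 1?eq_sym //.
  by rewrite !inE !negb_or az1 ab az2 (eq_sym z1 b) bz1 z12 bz2.
- by move=> x; rewrite !in_cons in_nil orbF => /or4P[]/eqP-> //; apply: (subsetP KaL).
rewrite !inE !eqxx !orbT => /(_ isT isT ab) eab.
by case/negP: aN; rewrite in_setU1 in_nb aL e_sym eab orbT.
Qed.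

(** The path from t to t' closes up with all of K to a cycle of low vertices on which c' has three
    neighbours in K. It is not chordless, hence a clique, and t together with K is a K_k. *)
Lemma low_clique_no_ear K c c' t t' : low_clique K -> c \in K -> c' \in K -> c != c' ->
  t \in L :\: K -> e c t -> e c' t' -> connect (within G (L :\: K)) t t' -> False.
Proof.
move=> KK cK c'K cc' tLK ct c't'; case/connectP => p0 pp0; case/shortenP: pp0 => p pp up _ t'E.
have /low_cliqueP[KL cKk cl] := KK.
pose rest := enum (K :\ c :\ c').
have memr z : (z \in rest) = (z \in K :\ c :\ c') by rewrite mem_enum.
have szr : size rest = k - 3.
  rewrite -cardE; move: cKk; rewrite (cardsD1 c) cK (cardsD1 c') !inE eq_sym cc' c'K /=.
  by move: k4; nlia.
have mempL z : z \in t :: p -> z \in L :\: K.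
  rewrite inE => /orP[/eqP->//|]; elim: p (t) pp {up t'E} => //= y p IHp t0 /andP[/and3P[_ yLK _] pp].
  by rewrite inE => /orP[/eqP->//|]; apply: (IHp _ pp).
have epp : path e t p by apply: sub_path pp => x y /and3P[].
have memr' z : z \in rest -> [/\ z != c', z != c & z \in K].
  by rewrite memr !inE => /and3P[].
have pathK s v : uniq (v :: s) -> {subset v :: s <= K} -> path e v s.
  move=> us sub; apply: (@clique_path _ _ (enum K)) => // [x y|z /sub]; last by rewrite mem_enum.
  by rewrite !mem_enum; apply: cl.
have ucr : uniq (c' :: rcons rest c).
  rewrite /= mem_rcons inE rcons_uniq !memr !inE !eqxx (eq_sym c' c) (negbTE cc') /= ?andbF /=.
  exact: enum_uniq.
have subr : {subset c' :: rcons rest c <= K}.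
  by move=> z; rewrite !(inE, mem_rcons) => /or3P[/eqP->|/eqP->|/memr'[]].
have cyc : ucycle e (t :: p ++ c' :: rcons rest c).
  apply/andP; split.
    rewrite /= rcons_cat /= cat_path epp /= -t'E (e_sym t' c') c't' /=.
    by rewrite rcons_path last_rcons ct pathK.
  rewrite -cat_cons cat_uniq up ucr andbT; apply/hasPn => z /subr zK.
  by apply/negP => /mempL; rewrite in_setD zK.
have sz : size (t :: p ++ c' :: rcons rest c) = size p + k.-1.+1.
  by rewrite /= size_cat /= size_rcons szr; move: k4; nlia.
have sL : {subset t :: p ++ c' :: rcons rest c <= L}.
  move=> z; rewrite -cat_cons mem_cat => /orP[/mempL|/subr /(subsetP KL)//].
  by rewrite in_setD => /andP[].
have : 1 < #|K :\ c :\ c'| by rewrite cardE szr; move: k4; nlia.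
case/card_gt1P => r1 [r2 [r1r r2r r12]].
rewrite -!memr in r1r r2r.
have inC z : z \in c' :: rcons rest c -> z \in t :: p ++ c' :: rcons rest c.
  by move=> zin; rewrite -cat_cons mem_cat zin orbT.
have inr z : z \in rest -> z \in c' :: rcons rest c.
  by move=> zr; rewrite !(inE, mem_rcons) zr !orbT.
have [c'C cC] : c' \in t :: p ++ c' :: rcons rest c /\ c \in t :: p ++ c' :: rcons rest c.
  by split; apply: inC; rewrite !(inE, mem_rcons) eqxx ?orbT.
have tC : t \in t :: p ++ c' :: rcons rest c by rewrite mem_head.
have tK : t \notin K by move: tLK; rewrite in_setD => /andP[].
have s2 : 2 < size (t :: p ++ c' :: rcons rest c) by rewrite sz; move: k4; nlia.
have [clq|[few _]] := low_cycle cyc s2 sL.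
  apply: (@low_no_clique (t |: K)).
  - by rewrite subUset sub1set KL andbT; move: tLK; rewrite in_setD => /andP[].
  - have tz z : z \in K -> e t z.
      move=> zK; apply: clq => //; last by apply: contraNneq tK => ->.
      apply: inC; rewrite !(inE, mem_rcons) memr !inE zK andbT.
      by case: (z == c'); case: (z == c).
    move=> x y; rewrite !in_setU1 => /orP[/eqP->|xK] /orP[/eqP->|yK] xy.
    + by rewrite eqxx in xy.
    + exact: tz.
    + by rewrite e_sym; apply: tz.
    + exact: cl.
  - by rewrite cardsU1 tK cKk; move: k4; nlia.
have [r1c' r1c r1K] := memr' _ r1r; have [r2c' r2c r2K] := memr' _ r2r.
apply: (chordless3 few c'C (a := c) (b := r1) (c := r2)).
- by rewrite cC !inC ?inr.
- by rewrite !cl // eq_sym.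
- by rewrite eq_sym r1c eq_sym r2c r12.
Qed.

Definition reach_off K x := [set z | connect (within G (L :\: K)) x z].

End LowVertices.

(** * Entrances to a component through its leaf cliques *)

Section Core.
Variables (T : finType) (G : sgraph T) (k : nat).
Hypothesis Gcrit : AT_critical k G.
Hypothesis GnotK : ~ is_complete_graph k G.
Hypothesis k4 : 4 < k.
Local Notation e := (adj G).
Local Notation deg v := #|[set w | adj G v w]|.
Local Notation L := (low G k).
Local Notation low_clique := (low_clique G k).
Local Notation closed_nbhd := (closed_nbhd G k).
Local Notation simp := (simplicial (adj G) k (low G k)).
Local Notation reach_off := (reach_off G k).
Implicit Types (A B C S K Q : {set T}) (v w u p x y c : T).

Let e_sym : symmetric e := adj_sym G.
Let e_irr : irreflexive e := adj_irr G.

Lemma low_verts v : v \in L -> v \in verts G.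
Proof. by rewrite inE => /andP[]. Qed.

Lemma within_sym A : symmetric (within G A).
Proof. by move=> x y; rewrite /within /= adj_sym andbCA. Qed.

Lemma connect_within_sym A : connect_sym (within G A).
Proof. exact: sym_connect_sym (within_sym A). Qed.

Lemma connect_withinS A B x y : A \subset B ->
  connect (within G A) x y -> connect (within G B) x y.
Proof.
move=> AB; apply: connect_sub => a b /= /and3P[aA bA ab].
by apply: connect1; rewrite /within /= !(subsetP AB).
Qed.

(** If y sees all of K, together they form a K_k. Otherwise K is entered from y at a neighbour w,
    paired with a non-neighbour u; three neighbours in K would pay for the arc y -> w and for the
    in-degree 2 of y. *)
Lemma low_clique_nbrs K y : low_clique K -> y \in verts G -> y \notin L -> deg y <= k ->
  #|[set w in K | e y w]| <= 2.
Proof.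
move=> KK yV yL dy; have /low_cliqueP[KL cK cl] := KK.
have yK : y \notin K by apply: contra yL; apply: (subsetP KL).
rewrite leqNgt; apply/negP => gt2.
have [all|] := boolP [forall u in K, e u y].
  have ally u : u \in K -> e u y by move=> uK; apply: (forall_inP all).
  apply: (no_clique Gcrit GnotK (ltnW k4) (A := y |: K) (y := y)) => //.
  - rewrite subUset sub1set yV /=; apply: subset_trans KL _.
    by apply/subsetP => z; apply: low_verts.
  - move=> a b; rewrite !in_setU1 => /orP[/eqP->|aK] /orP[/eqP->|bK] ab.
    + by rewrite eqxx in ab.
    + by rewrite e_sym ally.
    + exact: ally.
    + exact: cl.
  - by rewrite cardsU1 yK cK; move: k4; nlia.
  - by rewrite in_setU1 eqxx.
  - move=> v; rewrite in_setU1 => /orP[/eqP->|vK _]; first by rewrite eqxx.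
    by have := subsetP KL _ vK; rewrite inE => /andP[].
case/forall_inPn => u uK uy.
have [w] : exists w, w \in [set w in K | e y w].
  by apply/card_gt0P; apply: leq_trans gt2.
rewrite inE => /andP[wK yw].
have wu : w != u by apply: contraNneq uy => <-; rewrite e_sym.
apply: (gadgets_reducible Gcrit (Y := [set y]) (TT := [set K]) (cmp := fun=> K)
   (S := id) (W := fun=> w) (U := fun=> u) (P := fun=> y)).
- by apply/set0Pn; exists y; rewrite !inE eqxx.
- by move=> z; rewrite inE => /eqP->.
- move=> C; rewrite inE => /eqP->; split=> //.
  + exact: cl.
  + move=> x xK; have [->|xw] := eqVneq x w; first exact: connect0.
    by apply: connect1; rewrite /within /= wK xK cl // eq_sym.
  + by move=> c cK' cu _; apply: cl; rewrite // eq_sym.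
  + by move=> c cK' cw _; apply: cl; rewrite // eq_sym.
  + by rewrite inE.
  + by move=> z; rewrite inE => /eqP->; rewrite e_sym yw eqxx.
  + by move=> z; rewrite inE => /eqP->; rewrite (negbTE uy).
- move=> C x /set1P-> xK; split=> //.
  + by apply: low_verts; apply: (subsetP KL).
  + by have := subsetP KL _ xK; rewrite inE => /andP[].
  + by rewrite inE; apply: contraNneq yK => <-.
- by move=> C C' x z /set1P-> /set1P->.
- move=> z; rewrite inE => /eqP->; rewrite big_set1.
  have -> : [set C in [set K] | y == y] = [set K].
    by apply/setP => C; rewrite !inE eqxx andbT.
  rewrite cards1; apply: leq_trans gt2 _; apply: subset_leq_card.
  by apply/subsetP => x; rewrite !inE e_sym.
Qed.

Variable Y : {set T}.
Hypothesis YP : forall y, y \in Y -> [/\ y \in verts G, y \notin L & deg y <= k].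

(* An attached vertex lies in a K_(k-1) of low vertices, and its only other
   neighbour is in [Y]. *)
Definition attached := [set v in L | simp v && [exists y in Y, e v y]].

Lemma attP v : reflect [/\ v \in L, simp v & exists2 y, y \in Y & e v y] (v \in attached).
Proof.
rewrite [v \in attached]in_set; apply: (iffP and3P) => [[vL sv /exists_inP[y]]|[vL sv [y yY vy]]].
  by split=> //; exists y.
by split=> //; apply/exists_inP; exists y.
Qed.

Lemma att_uniq v y y' : v \in attached -> y \in Y -> y' \in Y -> e v y -> e v y' ->
  y = y'.
Proof.
case/attP => vL /simplicialP[c _] _ yY y'Y vy vy'; apply/eqP/negPn/negP => yy'.
have [_ yL _] := YP yY; have [_ y'L _] := YP y'Y.
have yN : y \notin nbhd e L v by rewrite in_nb (negbTE yL).
have y'N : y' \notin nbhd e L v by rewrite in_nb (negbTE y'L).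
have : y |: (y' |: nbhd e L v) \subset [set w | e v w].
  rewrite !subUset !sub1set !inE vy vy' /=; apply/subsetP => w.
  by rewrite in_nb inE => /andP[].
move/subset_leq_card; rewrite !cardsU1 y'N in_setU1 negb_or yy' yN c.
by rewrite (low_deg Gcrit k4 vL) /=; move: k4; nlia.
Qed.

(** For an attached v this is its unique neighbour in [Y]; the default v occurs only when v has no
    neighbour there. *)
Definition high v := odflt v [pick y in Y | e v y].

Lemma highP v : v \in attached -> high v \in Y /\ e v (high v).
Proof.
case/attP => _ _ [y yY vy]; rewrite /high; case: pickP => [z /andP[]//|/(_ y)].
by rewrite yY vy.
Qed.

Lemma high_uniq v y : v \in attached -> y \in Y -> e v y = (y == high v).
Proof.
move=> va yY; have [hY vh] := highP va.
by apply/idP/eqP => [vy|->//]; apply: att_uniq va yY hY vy vh.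
Qed.

Lemma att_nbc v K : v \in attached -> low_clique K -> v \in K -> nbhd e L v = K :\ v.
Proof.
case/attP => vL sv _ KK vK; rewrite -(simp_nbc k4 KK sv vK) /closed_nbhd setU1K //.
by rewrite in_nb e_irr andbF.
Qed.

(** K already accounts for k - 2 of the k - 1 neighbours of u, so y is the only other one. *)
Lemma K_att u y K : low_clique K -> u \in K -> y \in Y -> e u y -> u \in attached.
Proof.
move=> KK uK yY uy; have /low_cliqueP[KL cK cl] := KK; have uL := subsetP KL _ uK.
have [_ yL _] := YP yY.
have yN : y \notin nbhd e L u by rewrite in_nb (negbTE yL).
have : y |: nbhd e L u \subset [set w | e u w].
  rewrite subUset sub1set inE uy /=; apply/subsetP => w.
  by rewrite in_nb inE => /andP[].
move/subset_leq_card; rewrite cardsU1 yN (low_deg Gcrit k4 uL) => le.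
have ge := low_clique_nbL k4 KK uK; have c : #|nbhd e L u| = k - 2 by move: le ge k4; rewrite /=; nlia.
have [su _] := low_clique_simp k4 KK uK c.
by apply/attP; split=> //; exists y.
Qed.

(** Any two of these vertices are twins within S. *)
Definition inner K S := [set v in K | [forall x in S :\: K, ~~ e v x]].

(* If some inner vertex u is not attached then every attached w of the clique
   can be paired with it. Otherwise u is an inner vertex with the largest
   neighbour in [Y], which it shares with at most one other vertex. *)
Lemma K_options K S : low_clique K -> K \subset S -> S \subset L ->
    {in K & S, forall w x, connect (within G S) w x} ->
  exists O : {set T}, [/\ O \subset K :&: attached,
    forall w, w \in O -> exists u, gadget G Y S w u (high w) &
    minn #|K :&: attached| (#|inner K S| - 2) <= #|O|].
Proof.
move=> KK KS SL con; have /low_cliqueP[KL cK cl] := KK.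
have innerP v x : v \in inner K S -> x \in S -> e v x -> x \in K.
  rewrite inE => /andP[vK /forall_inP h] xS vx; apply: contraT => xK.
  by have := h x; rewrite inE xK xS vx => /(_ isT).
have innerK v : v \in inner K S -> v \in K by rewrite inE => /andP[].
have attI w : w \in K -> w \in attached -> w \in inner K S.
  move=> wK wa; rewrite inE wK; apply/forall_inP => x; rewrite inE => /andP[xK xS].
  apply/negP => wx; have : x \in nbhd e L w by rewrite in_nb wx (subsetP SL).
  by rewrite (att_nbc wa KK wK) inE (negbTE xK) andbF.
have gad w u : w \in K -> w \in attached -> u \in inner K S -> w != u ->
    (forall y, y \in Y -> e u y -> enum_rank (high w) < enum_rank y) ->
    gadget G Y S w u (high w).
  move=> wK wa uI wu hu; have uK := innerK _ uI; have wI := attI _ wK wa.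
  split=> //; try exact: (subsetP KS).
  - exact: cl.
  - by move=> x xS; apply: con.
  - by move=> c cS cu wc; apply: cl; [ | exact: innerP wI cS wc | rewrite eq_sym].
  - by move=> c cS cw uc; apply: cl; [ | exact: innerP uI cS uc | rewrite eq_sym].
  - by have [] := highP wa.
  - by move=> y yY; apply: high_uniq.
have [I0|I0] := eqVneq (inner K S) set0.
  exists set0; split; rewrite ?sub0set //; first by move=> w; rewrite inE.
  by rewrite I0 cards0 minn0.
case: (boolP (inner K S \subset attached)) => [IA|/subsetPn[u uI ua]]; last first.
  exists (K :&: attached); split=> //; last exact: geq_minl.
  move=> w; rewrite in_setI => /andP[wK wa]; exists u; apply: gad => //.
    by apply: contraNneq ua => <-.
  by move=> y yY uy; rewrite (K_att KK (innerK _ uI) yY uy) in ua.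
have [u0 u0I] := set0Pn _ I0.
case: (arg_maxnP (fun v => enum_rank (high v) : nat) u0I) => u uI max_u.
have [hY uh] := highP (subsetP IA _ uI).
pose O := [set v in inner K S | high v != high u].
exists O; split.
- apply/subsetP => v; rewrite [v \in O]inE => /andP[vI _].
  by rewrite in_setI innerK // (subsetP IA).
- move=> w; rewrite [w \in O]inE => /andP[wI wu]; exists u.
  have wa := subsetP IA _ wI; apply: gad => //; first exact: innerK.
    by apply: contraNneq wu => ->.
  move=> y yY; rewrite (high_uniq (subsetP IA _ uI) yY) => /eqP->.
  rewrite ltn_neqAle; apply/andP; split; last exact: max_u wI.
  by apply: contra wu => /eqP h; apply/eqP; apply: enum_rank_inj; apply: val_inj.
have [hV hL hd] := YP hY.
have c2 := low_clique_nbrs KK hV hL hd.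
have : inner K S \subset O :|: [set w in K | e (high u) w].
  apply/subsetP => v vI; rewrite in_setU [v \in O]inE vI /=.
  case: (eqVneq (high v) (high u)) => //= <-.
  rewrite inE innerK // e_sym; have [] := highP (subsetP IA _ vI) => _ -> //.
move/subset_leq_card; rewrite cardsU.
by move: c2; set a := #|O|; set b := #|[set w in K | _]|; set c := #|inner K S|; nlia.
Qed.

Section Component.
Variable C : {set T}.
Hypothesis CL : C \subset L.
Hypothesis Ccon : {in C &, forall x y, connect (within G L) x y}.
Hypothesis Cclosed : forall x z, x \in C -> z \in L -> e x z -> z \in C.
Local Notation A := (C :&: attached).

Lemma attA_K a : a \in A -> [/\ low_clique (closed_nbhd a), a \in closed_nbhd a & closed_nbhd a \subset C].
Proof.
rewrite in_setI => /andP[aC /attP[aL sa _]]; split.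
- exact: (simplicial_low_clique k4).
- by rewrite in_setU1 eqxx.
apply/subsetP => z; rewrite in_setU1 => /orP[/eqP->//|].
by rewrite in_nb => /andP[zL az]; apply: Cclosed aC zL az.
Qed.

Lemma attA_disjoint a b : a \in A -> b \in A -> closed_nbhd a != closed_nbhd b ->
  [disjoint closed_nbhd a & closed_nbhd b].
Proof.
rewrite !in_setI => /andP[_ /attP[aL sa _]] /andP[_ /attP[bL sb _]].
exact: (nbc_disjoint Gcrit k4).
Qed.

Lemma RK_in K x z : x \in L :\: K -> z \in reach_off K x -> z \in L :\: K.
Proof.
move=> xLK; rewrite inE => /connectP[p pp ->].
elim: p x xLK pp => //= y p IHp x _ /andP[/and3P[_ yLK _] pp].
exact: IHp pp.
Qed.

Lemma RK_step K x z t : z \in reach_off K x -> z \in L :\: K -> t \in L :\: K ->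
  e z t -> t \in reach_off K x.
Proof.
rewrite ![_ \in reach_off _ _]inE => xz zLK tLK zt.
by apply: connect_trans xz _; apply: connect1; rewrite /within /= zLK tLK.
Qed.

Lemma RK_exit K a0 a : a0 \in C -> a \in C -> a0 \notin K -> a \in K ->
  exists t c, [/\ t \in reach_off K a0, c \in K, c \in C & e t c].
Proof.
move=> a0C aC a0K aK; have a0LK : a0 \in L :\: K by rewrite in_setD a0K (subsetP CL).
have a0R : a0 \in reach_off K a0 by rewrite inE connect0.
case/connectP: (Ccon a0C aC) => p; move: a0C a0R {a0K}.
have: forall x, x \in C -> x \in reach_off K a0 -> path (within G L) x p -> a = last x p ->
   exists t c, [/\ t \in reach_off K a0, c \in K, c \in C & e t c].
  elim: p => [|y p IHp] x xC xR /= => [_ ax|/andP[/and3P[_ yL xy] pp] ax].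
    by have := RK_in a0LK xR; rewrite -ax in_setD aK.
  have yC := Cclosed xC yL xy.
  have [yK|yK] := boolP (y \in K); first by exists x, y.
  apply: (IHp y) => //; apply: RK_step xy => //; first exact: RK_in xR.
  by rewrite in_setD yK.
by move=> h a0C a0R; apply: h.
Qed.

(** Choose a so that the set reachable from a0 off its clique is largest. If some attached b outside
    that clique were not reached, its whole clique would be missed; avoiding the clique of b
    instead, one reaches everything reached before and also a vertex of the clique of a, against
    maximality. *)
Lemma leaf_clique a0 : a0 \in A -> (exists2 a, a \in A & closed_nbhd a != closed_nbhd a0) ->
  exists a, [/\ a \in A, closed_nbhd a != closed_nbhd a0 & A :\: closed_nbhd a \subset reach_off (closed_nbhd a) a0].
Proof.
move=> a0A [a1 a1A a1n].
pose P := [pred a | (a \in A) && (closed_nbhd a != closed_nbhd a0)].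
have P1 : P a1 by rewrite /= a1A.
case: (arg_maxnP (fun a => #|reach_off (closed_nbhd a) a0|) P1) => a /andP[aA an] max_a.
exists a; split=> //; apply/subsetP => b; rewrite in_setD => /andP[bK bA].
apply: contraT => bR; exfalso.
have [aK aa aC] := attA_K aA; have [bK' bb bC] := attA_K bA.
have [a0K a0a0 a0C] := attA_K a0A.
have ba : closed_nbhd b != closed_nbhd a by apply: contraNneq bK => <-.
have dba := attA_disjoint bA aA ba.
have a0nK : a0 \notin closed_nbhd a.
  by have /pred0P/(_ a0)/= := attA_disjoint aA a0A an; rewrite a0a0 andbT => ->.
have inLK z : z \in closed_nbhd b -> z \in L :\: closed_nbhd a.
  move=> zb; rewrite in_setD (subsetP CL) ?(subsetP bC) // andbT.
  by have /pred0P/(_ z)/= := dba; rewrite zb /= => ->.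
have bclq : {in closed_nbhd b &, forall x y, x != y -> e x y} by case/low_cliqueP: bK'.
have a0LK : a0 \in L :\: closed_nbhd a by rewrite in_setD a0nK (subsetP CL) ?(subsetP a0C).
have noRb z : z \in closed_nbhd b -> z \notin reach_off (closed_nbhd a) a0.
  move=> zb; apply: contra bR => zR; have [<-//|zneb] := eqVneq z b.
  by apply: RK_step zR (inLK _ zb) (inLK _ bb) _; apply: bclq.
have bn : closed_nbhd b != closed_nbhd a0.
  apply/eqP => E; have := noRb a0; rewrite E a0a0 => /(_ isT).
  by rewrite inE connect0.
have Rsub : reach_off (closed_nbhd a) a0 \subset reach_off (closed_nbhd b) a0.
  apply/subsetP => z; rewrite inE => /connectP[p pp ->].
  have a0R : a0 \in reach_off (closed_nbhd a) a0 by rewrite inE connect0.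
  have a0R' : a0 \in reach_off (closed_nbhd b) a0 by rewrite inE connect0.
  have : forall x, x \in reach_off (closed_nbhd a) a0 -> x \in reach_off (closed_nbhd b) a0 ->
      path (within G (L :\: closed_nbhd a)) x p -> last x p \in reach_off (closed_nbhd b) a0.
    elim: p {pp} => //= y p IHp x xR xR' /andP[/and3P[xLK yLK xy] pp].
    have yR := RK_step xR xLK yLK xy.
    have inL' v : v \in reach_off (closed_nbhd a) a0 -> v \in L :\: closed_nbhd b.
      move=> vR; have := RK_in a0LK vR; rewrite !in_setD => /andP[_ ->].
      by rewrite andbT; apply/negP => /noRb; rewrite vR.
    by apply: IHp => //; apply: RK_step xR' (inL' _ xR) (inL' _ yR) xy.
  by apply.
have [t [c [tR cK cC tc]]] := RK_exit (subsetP a0C _ a0a0) (subsetP aC _ aa) a0nK aa.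
have cR : c \notin reach_off (closed_nbhd a) a0.
  by apply/negP => /(RK_in a0LK); rewrite in_setD cK.
have nb_b v : v \in reach_off (closed_nbhd a) a0 -> v \in L :\: closed_nbhd b.
  move=> vR; have := RK_in a0LK vR; rewrite !in_setD => /andP[_ ->].
  by rewrite andbT; apply/negP => /noRb; rewrite vR.
have cR' : c \in reach_off (closed_nbhd b) a0.
  apply: RK_step (subsetP Rsub _ tR) (nb_b _ tR) _ tc.
  rewrite in_setD (subsetP CL _ cC) andbT; apply/negP => cb.
  by have /pred0P/(_ c)/= := dba; rewrite cb cK.
have := max_a b; rewrite /= bA bn => /(_ isT); apply/negP; rewrite -ltnNge.
have : c |: reach_off (closed_nbhd a) a0 \subset reach_off (closed_nbhd b) a0 by rewrite subUset sub1set cR'.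
by move/subset_leq_card; rewrite cardsU1 cR.
Qed.

(** S must contain all attached vertices of C, since their edges supply the in-degrees in [Y]. *)
Definition option_at w := w \in A /\
  exists S u, [/\ S \subset C, A \subset S & gadget G Y S w u (high w)].

(** S consists of the leaf clique K and all that is reachable from a0 off K. As there is no ear, at
    most one vertex of K has neighbours in the rest of S, so at least k - 2 vertices are inner and
    at least one entrance remains. *)
Lemma leaf_option a0 a : a0 \in A -> a \in A -> closed_nbhd a != closed_nbhd a0 ->
  A :\: closed_nbhd a \subset reach_off (closed_nbhd a) a0 -> exists2 w, w \in closed_nbhd a & option_at w.
Proof.
move=> a0A aA an Asub.
have [aK aa aC] := attA_K aA; have [a0K a0a0 a0C] := attA_K a0A.
have a0nK : a0 \notin closed_nbhd a.
  by have /pred0P/(_ a0)/= := attA_disjoint aA a0A an; rewrite a0a0 andbT => ->.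
have a0LK : a0 \in L :\: closed_nbhd a by rewrite in_setD a0nK (subsetP CL) ?(subsetP a0C).
have [t [c [tR cK cC tc]]] := RK_exit (subsetP a0C _ a0a0) (subsetP aC _ aa) a0nK aa.
set K := closed_nbhd a in aK aa aC an a0nK a0LK tR cK Asub *.
set R := reach_off K a0 in tR Asub *.
pose S := K :|: R; have /low_cliqueP[KL cKk cl] := aK.
have RC : R \subset C.
  apply/subsetP => z; rewrite inE => /connectP[p pp ->].
  have : forall x, x \in C -> path (within G (L :\: K)) x p -> last x p \in C.
    elim: p {pp} => //= y p IHp x xC /andP[/and3P[_ yLK xy] pp].
    apply: IHp => //; apply: Cclosed xC _ xy.
    by move: yLK; rewrite in_setD => /andP[].
  by apply => //; apply: (subsetP a0C).
have SC : S \subset C by rewrite subUset aC.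
have KS : K \subset S by apply: subsetUl.
have RS : R \subset S by apply: subsetUr.
have conR x : x \in R -> connect (within G R) a0 x.
  rewrite inE => /connectP[p pp ->].
  have a0R : a0 \in R by rewrite inE connect0.
  have : forall x, x \in R -> path (within G (L :\: K)) x p ->
      connect (within G R) x (last x p).
    elim: p {pp} => //= y p IHp z zR /andP[/and3P[zLK yLK zy] pp].
    have yR : y \in R by apply: RK_step zR zLK yLK zy.
    by apply: connect_trans (IHp _ yR pp); apply: connect1; rewrite /within /= zR yR.
  by apply.
have con : {in K & S, forall w x, connect (within G S) w x}.
  have conK x y : x \in K -> y \in K -> connect (within G S) x y.
    move=> xK yK; have [->|xy] := eqVneq x y; first exact: connect0.
    by apply: connect1; rewrite /within /= !(subsetP KS) // cl.
  move=> w x wK; rewrite in_setU => /orP[|xR]; first exact: conK.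
  apply: (connect_trans (conK _ _ wK cK)); apply: (@connect_trans _ _ t).
    by apply: connect1; rewrite /within /= (subsetP KS) // (subsetP RS) // e_sym.
  apply: (connect_withinS RS); apply: connect_trans (conR _ xR).
  by rewrite connect_within_sym; apply: conR.
have [O [OK gO cO]] := K_options aK KS (subset_trans SC CL) con.
have Ain : 0 < #|K :&: attached|.
  by apply/card_gt0P; exists a; rewrite in_setI aa; move: aA; rewrite in_setI => /andP[].
have inn : k - 2 <= #|inner K S|.
  have : #|K :\: inner K S| <= 1.
    apply/card_le1_eqP => x y xN yN; apply/eqP/negPn/negP => xy.
    have outP z : z \in K :\: inner K S -> z \in K /\ exists2 z', z' \in R & e z z'.
      rewrite in_setD inE => /andP[+ zK]; rewrite zK /= => /forall_inPn[z'].
      case/setDP => z'S z'K /negPn zz'.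
      have z'R : z' \in R by case/setUP: z'S => // z'K'; rewrite z'K' in z'K.
      by split=> //; exists z'.
    have [xK [x' x'R xx']] := outP _ xN; have [yK [y' y'R yy']] := outP _ yN.
    have x'LK := RK_in a0LK x'R.
    apply: (low_clique_no_ear Gcrit GnotK k4 aK xK yK _ x'LK xx' yy').
      by rewrite eq_sym.
    apply: (@connect_trans _ _ a0).
      by rewrite connect_within_sym; move: x'R; rewrite inE.
    by move: y'R; rewrite inE.
  have := cardsID (inner K S) K; rewrite (setIidPr _); last first.
    by apply/subsetP => z; rewrite inE => /andP[].
  rewrite cKk; move: k4; nlia.
have : 0 < #|O|.
  by apply: leq_trans cO; rewrite leq_min Ain; move: inn k4; nlia.
case/card_gt0P => w wO; exists w.
  by have := subsetP OK _ wO; rewrite in_setI => /andP[].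
have := subsetP OK _ wO; rewrite in_setI => /andP[wK wa].
split; first by rewrite in_setI wa (subsetP aC).
have [u gu] := gO w wO; exists S, u; split=> //.
apply/subsetP => z zA; rewrite in_setU; case: (boolP (z \in K)) => //= zK.
by apply: (subsetP Asub); rewrite in_setD zK.
Qed.

(** If all attached vertices share a clique, S is that clique and all its k - 1 vertices are inner.
    Otherwise a leaf clique seen from a, and then a leaf clique seen from the first one, are
    disjoint and give one entrance each. *)
Lemma two_options : 2 < #|A| ->
  exists w1 w2, [/\ w1 != w2, option_at w1 & option_at w2].
Proof.
move=> A3; have [a aA] : exists a, a \in A by apply/card_gt0P; apply: leq_trans A3.
have [aK aa aC] := attA_K aA.
case: (boolP [forall b in A, closed_nbhd b == closed_nbhd a]) => [/forall_inP same|].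
  have AK : A \subset closed_nbhd a.
    apply/subsetP => b bA; rewrite -(eqP (same b bA)).
    by have [] := attA_K bA.
  have /low_cliqueP[KL cKk cl] := aK.
  have con : {in closed_nbhd a & closed_nbhd a, forall w x, connect (within G (closed_nbhd a)) w x}.
    move=> x y xK yK; have [->|xy] := eqVneq x y; first exact: connect0.
    by apply: connect1; rewrite /within /= xK yK cl.
  have [O [OK gO cO]] := K_options aK (subxx _) KL con.
  have : 1 < #|O|.
    apply: leq_trans cO; rewrite leq_min; apply/andP; split.
      apply: leq_trans (ltnW A3) _; apply: subset_leq_card.
      by apply/subsetP => z zA; rewrite in_setI (subsetP AK) //; move: zA; rewrite in_setI => /andP[].
    have -> : inner (closed_nbhd a) (closed_nbhd a) = closed_nbhd a.
      apply/setP => z; rewrite inE setDv; case: (z \in closed_nbhd a) => //=.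
      by apply/forall_inP => x; rewrite inE.
    by rewrite cKk; move: k4; nlia.
  case/card_gt1P => w1 [w2 [w1O w2O w12]]; exists w1, w2; split=> //.
    have := subsetP OK _ w1O; rewrite in_setI => /andP[wK wa].
    split; first by rewrite in_setI wa (subsetP aC).
    by have [u gu] := gO _ w1O; exists (closed_nbhd a), u.
  have := subsetP OK _ w2O; rewrite in_setI => /andP[wK wa].
  split; first by rewrite in_setI wa (subsetP aC).
  by have [u gu] := gO _ w2O; exists (closed_nbhd a), u.
case/forall_inPn => b bA ba.
have [|a1 [a1A a1n a1sub]] := @leaf_clique a aA; first by exists b.
have [w1 w1K o1] := leaf_option aA a1A a1n a1sub.
have [|a2 [a2A a2n a2sub]] := @leaf_clique a1 a1A; first by exists a; rewrite // eq_sym.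
have [w2 w2K o2] := leaf_option a1A a2A a2n a2sub.
exists w1, w2; split=> //.
have /pred0P/(_ w2)/= := attA_disjoint a2A a1A a2n; rewrite w2K /=.
by apply: contraFneq => <-.
Qed.

End Component.
End Core.

(** * Discharging *)

Section Discharging.
Variables (T : finType) (G : sgraph T) (k : nat).
Hypothesis Gcrit : AT_critical k G.
Hypothesis GnotK : ~ is_complete_graph k G.
Hypotheses (k4 : 4 < k) (k6 : k <= 6).
Local Notation e := (adj G).
Local Notation deg v := #|[set w | adj G v w]|.
Local Notation L := (low G k).
Local Notation simp := (simplicial (adj G) k (low G k)).
Implicit Types (A B C S K Q Y F : {set T}) (v w u p x y c : T).
Implicit Types (TT : {set {set T}}).

Let e_sym : symmetric e := adj_sym G.
Let e_irr : irreflexive e := adj_irr G.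

Definition component v := [set x | connect (within G L) v x].

Lemma comp_refl v : v \in component v.
Proof. by rewrite inE connect0. Qed.

Lemma comp_sub v : v \in L -> component v \subset L.
Proof.
move=> vL; apply/subsetP => x; rewrite inE => /connectP[p pp ->].
elim: p v vL pp => //= y p IHp v _ /andP[/and3P[_ yL _] pp].
exact: IHp pp.
Qed.

Lemma comp_eq v x : x \in component v -> component x = component v.
Proof.
rewrite inE => vx; apply/setP => z; rewrite !inE.
by rewrite (same_connect (connect_within_sym G L) vx).
Qed.

Lemma comp_con v : {in component v &, forall x y, connect (within G L) x y}.
Proof.
move=> x y xC yC; move: yC; rewrite -(comp_eq xC) inE //.
Qed.

Lemma comp_closed v x z : v \in L -> x \in component v -> z \in L -> e x z -> z \in component v.
Proof.
move=> vL xC zL xz; have xL := subsetP (comp_sub vL) _ xC.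
rewrite -(comp_eq xC) inE; apply: connect1; by rewrite /within /= xL zL.
Qed.

Definition components := [set component v | v in L].

Lemma compsP C x : C \in components -> x \in C -> x \in L /\ C = component x.
Proof.
case/imsetP => v vL -> xC; split; last by rewrite (comp_eq xC).
exact: (subsetP (comp_sub vL)).
Qed.

Lemma no_core Y TT :
    (forall y, y \in Y -> [/\ y \in verts G, y \notin L & deg y <= k]) ->
    TT \subset components -> (Y != set0) || (TT != set0) ->
    (forall C, C \in TT -> 2 < #|C :&: attached G k Y|) ->
    (forall y, y \in Y ->
       4 < #|[set w in \bigcup_(C in TT) (C :&: attached G k Y) | e y w]|) -> False.
Proof.
move=> YP TTc n0 TT3 Y5.
pose hi := high G Y.
have [t0 _] : exists t0 : T, true.
  case/orP: n0 => /set0Pn[z zin]; first by exists z.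
  have : 0 < #|z :&: attached G k Y| by apply: ltnW; apply: ltnW; apply: TT3.
  by case/card_gt0P => t _; exists t.
have opts C : exists p : T * T, C \in TT ->
    [/\ p.1 != p.2, option_at G k Y C p.1 & option_at G k Y C p.2].
  case: (boolP (C \in TT)) => [CT|_]; last by exists (t0, t0).
  have /imsetP[v vL CE] := subsetP TTc _ CT.
  have [w1 [w2 [w12 o1 o2]]] : exists w1 w2, [/\ w1 != w2, option_at G k Y C w1 & option_at G k Y C w2].
    rewrite CE in TT3 CT *; apply: (two_options Gcrit GnotK k4 YP (comp_sub vL)).
    - exact: comp_con.
    - by move=> x z; apply: comp_closed.
    - exact: TT3.
  by exists (w1, w2).
have [ww wwP] := fin_all_exists opts.
have [g [gP gl]] := balanced_choice TT (fun C => hi (ww C).1) (fun C => hi (ww C).2).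
have gad C : exists q : T * (T * {set T}), C \in TT ->
    [/\ q.2.2 \subset C, C :&: attached G k Y \subset q.2.2, hi q.1 = g C &
        gadget G Y q.2.2 q.1 q.2.1 (hi q.1)].
  case: (boolP (C \in TT)) => [CT|_]; last by exists (t0, (t0, set0)).
  have [_ [_ [S1 [u1 [s1 a1 g1]]]] [_ [S2 [u2 [s2 a2 g2]]]]] := wwP C CT.
  by case: (gP C CT) => ->; [exists ((ww C).1, (u1, S1)) | exists ((ww C).2, (u2, S2))].
have [gg ggP] := fin_all_exists gad.
have TTL C x : C \in TT -> x \in C -> x \in L /\ C = component x.
  by move=> CT; apply: compsP; apply: (subsetP TTc).
apply: (gadgets_reducible Gcrit (Y := Y) (TT := TT) (cmp := component)
  (S := fun C => (gg C).2.2) (W := fun C => (gg C).1) (U := fun C => (gg C).2.1)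
  (P := fun C => hi (gg C).1)).
- case/orP: n0 => [/set0Pn[y yY]|/set0Pn[C CT]].
    by apply/set0Pn; exists y; rewrite inE yY.
  have [_ _ _ gC] := ggP C CT.
  apply/set0Pn; exists (gg C).1; rewrite inE; apply/orP; right.
  by apply/bigcupP; exists C => //; apply: gadget_w gC.
- by move=> y /YP[].
- by move=> C /ggP[].
- move=> C x CT xS; have [SC _ _ _] := ggP C CT.
  have [xL CE] := TTL _ _ CT (subsetP SC _ xS).
  have := xL; rewrite inE => /andP[xV dx]; split=> //.
  by apply/negP => /YP[_]; rewrite xL.
- move=> C C' x y CT CT' xS yS xy.
  have [SC _ _ _] := ggP C CT; have [SC' _ _ _] := ggP C' CT'.
  have [xL CE] := TTL _ _ CT (subsetP SC _ xS).
  have [yL CE'] := TTL _ _ CT' (subsetP SC' _ yS).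
  rewrite CE CE'; symmetry; apply: comp_eq; apply: comp_closed xL (comp_refl x) yL xy.
(* Two for the in-degree, and at most three for the components entered from y: the offered entrances
   adjacent to y are distinct, so there are at most k <= 6 of them, and twice the number chosen is
   at most 6 + 1. *)
move=> y yY; apply: (@leq_trans 5); last first.
  apply: leq_trans (Y5 y yY) _; apply: subset_leq_card; apply/subsetP => w.
  rewrite [w \in _]inE => /andP[/bigcupP[C CT wA] yw].
  rewrite inE e_sym yw andbT; apply/bigcupP; exists C => //.
  by have [_ sub _ _] := ggP C CT; apply: (subsetP sub).
have cardE (f : {set T} -> T) : \sum_(C in TT) (f C == y) = #|[set C in TT | f C == y]|.
  by rewrite -sum1dep_card big_mkcondr; apply: eq_bigr => C _; case: eqP.
have -> : #|[set C in TT | hi (gg C).1 == y]| = #|[set C in TT | g C == y]|.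
  apply: eq_card => C; rewrite !inE; case: (boolP (C \in TT)) => //= CT.
  by have [_ _ -> _] := ggP C CT.
have := gl y; rewrite !cardE.
set Z1 := [set C in TT | hi _ == y]; set Z2 := [set C in TT | hi _ == y].
have inj (f : {set T} -> T) : (forall C, C \in TT -> f C \in C) -> {in TT &, injective f}.
  move=> fC C C' CT CT' E; have [_ ->] := TTL _ _ CT (fC _ CT).
  by have [_ ->] := TTL _ _ CT' (fC _ CT'); rewrite E.
have w1C C : C \in TT -> (ww C).1 \in C :&: attached G k Y by move=> /wwP[_ []].
have w2C C : C \in TT -> (ww C).2 \in C :&: attached G k Y by move=> /wwP[_ _ []].
have w1C' C : C \in TT -> (ww C).1 \in C by move=> /w1C; rewrite in_setI => /andP[].
have w2C' C : C \in TT -> (ww C).2 \in C by move=> /w2C; rewrite in_setI => /andP[].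
have hiE C w : w \in C :&: attached G k Y -> hi w = y -> e y w.
  rewrite in_setI => /andP[_ wa] <-; rewrite e_sym.
  by have [] := highP wa.
have c1 : #|[set (ww C).1 | C in Z1]| = #|Z1|.
  apply: card_in_imset => C C' /setIdP[CT _] /setIdP[CT' _].
  exact: (inj (fun C => (ww C).1)).
have c2 : #|[set (ww C).2 | C in Z2]| = #|Z2|.
  apply: card_in_imset => C C' /setIdP[CT _] /setIdP[CT' _].
  exact: (inj (fun C => (ww C).2)).
have : [set (ww C).1 | C in Z1] :|: [set (ww C).2 | C in Z2] \subset [set w | e y w].
  apply/subsetP => w; rewrite in_setU => /orP[]/imsetP[C /setIdP[CT /eqP h] ->];
    rewrite inE; apply: (hiE C) => //; [exact: w1C | exact: w2C].
move/subset_leq_card; rewrite cardsU c1 c2 (_ : _ :&: _ = set0) ?cards0 ?subn0; last first.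
  apply/setP => w; rewrite !inE; apply/negP.
  move=> /andP[/imsetP[C /setIdP[CT _] wE] /imsetP[C' /setIdP[CT' _] wE']].
  have [_ CE] := TTL _ _ CT (w1C' _ CT); have [_ CE'] := TTL _ _ CT' (w2C' _ CT').
  have CC : C = C' by rewrite CE CE' -wE -wE'.
  by have [/negP[]] := wwP C CT; rewrite -wE CC -wE'.
have [_ _ dy] := YP y yY.
move: dy k6; set d := #|[set w | _]|; set a := #|Z1|; set b := #|Z2|; set c := #|_|.
by move=> h1 h2 h3 h4; nlia.
Qed.

(** F is the set of attached vertices that receive the extra charge from [Y]. A component with at
    most two attached vertices may go unpaid and is dropped; a vertex y with at most four attached
    neighbours in the remaining components pays them all and is dropped, which also shrinks
    [attached]. Payments do not interfere, since an attached vertex has only one neighbour in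
    [Y]. *)
Lemma payment Y TT :
    (forall y, y \in Y -> [/\ y \in verts G, y \notin L & deg y <= k]) ->
    TT \subset components ->
  exists F : {set T}, [/\ F \subset attached G k Y,
    forall y, y \in Y -> #|[set w in F | e y w]| <= 4 &
    forall C, C \in TT -> #|(C :&: attached G k Y) :\: F| <= 2].
Proof.
have [n] := ubnP (#|Y| + #|TT|); elim: n Y TT => // n IHn Y TT.
rewrite ltnS => sz YP TTc.
have [|noC] := boolP [exists C in TT, #|C :&: attached G k Y| <= 2].
  case/exists_inP => C CT c2; have [||F [F1 F2 F3]] := IHn Y (TT :\ C) _ YP _.
  - by move: sz; rewrite (cardsD1 C TT) CT; nlia.
  - by apply: subset_trans TTc; apply: subsetDl.
  exists F; split=> // C' C'T; have [->|ne] := eqVneq C' C; last by apply: F3; rewrite !inE ne.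
  by apply: leq_trans c2; apply: subset_leq_card; apply: subsetDl.
set X := fun y => [set w in \bigcup_(C in TT) (C :&: attached G k Y) | e y w].
have [|noy] := boolP [exists y in Y, #|X y| <= 4].
  case/exists_inP => y yY y4; have [||F [F1 F2 F3]] := IHn (Y :\ y) TT _ _ TTc.
  - by move: sz; rewrite (cardsD1 y Y) yY; nlia.
  - by move=> z /setD1P[_ /YP].
  have attS : attached G k (Y :\ y) \subset attached G k Y.
    apply/subsetP => w /attP[wL sw [z /setD1P[_ zY] wz]].
    by apply/attP; split=> //; exists z.
  have XA : X y \subset attached G k Y.
    apply/subsetP => w; rewrite inE => /andP[/bigcupP[C _]].
    by rewrite in_setI => /andP[].
  have auniq := att_uniq Gcrit k4 YP.
  exists (F :|: X y); split.
  - by rewrite subUset XA andbT; apply: subset_trans attS.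
  - move=> z zY; have [->|zy] := eqVneq z y.
      apply: leq_trans y4; apply: subset_leq_card; apply/subsetP => w.
      rewrite inE => /andP[/setUP[wF|//] yw].
      have wa := subsetP F1 _ wF; have /attP[_ _ [z' /setD1P[z'y z'Y] wz']] := wa.
      have := auniq w z' y (subsetP attS _ wa) z'Y yY wz'.
      by rewrite e_sym yw => /(_ isT) E; rewrite E eqxx in z'y.
    have zY' : z \in Y :\ y by rewrite !inE zy.
    apply: leq_trans (F2 z zY'); apply: subset_leq_card; apply/subsetP => w.
    rewrite inE => /andP[/setUP[wF|wX] zw]; first by rewrite inE wF.
    have yw : e y w by move: wX; rewrite inE => /andP[].
    have := auniq w z y (subsetP XA _ wX) zY yY.
    rewrite e_sym zw e_sym yw => /(_ isT isT) E; by rewrite E eqxx in zy.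
  - move=> C CT; apply: leq_trans (F3 C CT); apply: subset_leq_card.
    apply/subsetP => w; rewrite in_setD in_setU negb_or => /andP[/andP[wF wX]].
    rewrite in_setI => /andP[wC wa]; rewrite in_setD wF in_setI wC /=.
    have /attP[wL sw [z zY wz]] := wa; apply/attP; split=> //; exists z => //.
    rewrite !inE zY andbT; apply: contraNneq wX => zy; rewrite inE -zy e_sym wz andbT.
    by apply/bigcupP; exists C; rewrite // in_setI wC.
have [|] := boolP ((Y != set0) || (TT != set0)); last first.
  rewrite negb_or !negbK => /andP[/eqP Y0 /eqP T0]; exists set0; split.
  - exact: sub0set.
  - by move=> y; rewrite Y0 inE.
  - by move=> C; rewrite T0 inE.
move=> n0; exfalso; apply: (no_core YP TTc n0).
  by move=> C CT; rewrite ltnNge; apply: contra noC => h; apply/exists_inP; exists C.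
by move=> y yY; rewrite ltnNge; apply: contra noy => h; apply/exists_inP; exists y.
Qed.

(** In units where exceeding degree k - 1 by one is worth M, every vertex must end with N, so N / M
    is the gain over average degree k - 1. [HN] is the balance at a low vertex, [HM] at a vertex of
    degree k, [Hhigh] at larger degrees; [Hka] lets a component miss two extra charges. *)
Variables al be ga si ka N M : nat.
Hypothesis Hvertex : si + ka <= be.
Hypothesis Hleaf : 2 * al + ga + si <= be.
Hypothesis Hpair : 6 * al + 2 * si <= 2 * be.
Hypothesis Hbig : al * ((k - 2) * (k - 1)) <= (be + ga) * (k - 2) + si.
Hypothesis Hsmall : forall j, 2 < j -> j < k - 2 ->
  al * (j * (j + 1)) <= be * j + si /\ k <= j + 3.
Hypothesis Hka : 2 * ga <= ka.
Hypothesis HN : al * k.-1 = be + N.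
Hypothesis HM : M = al * k + 4 * ga + N.
Hypothesis Hhigh : forall d, k < d -> N + (al + ga) * d + M * k.-1 <= M * d.

Lemma comps_partition (f : T -> nat) :
  \sum_(v in L) f v = \sum_(C in components) \sum_(v in C) f v.
Proof.
rewrite (partition_big component (mem components)) /=; last first.
  by move=> v vL; apply/imsetP; exists v.
apply: eq_bigr => C CT; apply: eq_bigl => v; apply/andP/idP => [[vL /eqP <-]|vC].
  exact: comp_refl.
by have [vL CE] := compsP CT vC; rewrite vL -CE.
Qed.

Lemma comp_nb C v : C \in components -> v \in C -> nbhd e C v = nbhd e L v.
Proof.
move=> CT vC; have [vL CE] := compsP CT vC; apply/setP => w; rewrite !in_nb.
apply/andP/andP => [[wC vw]|[wL vw]]; split=> //.
  by have [] := compsP CT wC.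
by rewrite CE; apply: comp_closed vL (comp_refl v) wL vw.
Qed.

Lemma comp_bound C : C \in components ->
  al * \sum_(v in C) #|nbhd e L v| + ka <= be * #|C| + ga * #|[set v in C | simp v]|.
Proof.
move=> CT; have [v vL CE] := imsetP CT.
have CL : C \subset L by rewrite CE; apply: comp_sub.
have C0 : C != set0 by apply/set0Pn; exists v; rewrite CE comp_refl.
have := @edge_bound T e e_sym e_irr k L
   (fun A AL An0 => end_blockP e_sym e_irr (low_cycle Gcrit k4) AL An0)
   (@nbL_lt _ G k) (low_no_clique Gcrit GnotK k4) k4
   al be ga si ka Hvertex Hleaf Hpair Hbig Hsmall C CL C0.
have -> : degree_sum e C = \sum_(v in C) #|nbhd e L v|.
  by apply: eq_bigr => w wC; rewrite comp_nb.
have -> : n_simplicial e k C = #|[set v in C | simp v]|.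
  apply: eq_card => w; rewrite !inE; case: (boolP (w \in C)) => //= wC.
  by rewrite /simplicial comp_nb.
by apply: leq_trans; rewrite leq_add2r leq_addr.
Qed.

Lemma card_sum A (P : pred T) : #|[set v in A | P v]| = \sum_(v in A) P v.
Proof.
by rewrite -sum1dep_card big_mkcondr; apply: eq_bigr => v _; case: (P v).
Qed.

Lemma high_degree y : y \in verts G -> y \notin L -> k <= deg y.
Proof. by rewrite inE => -> /=; rewrite -leqNgt. Qed.

Lemma simp_high v : v \in L -> simp v -> #|[set y in verts G :\: L | e v y]| = 1.
Proof.
move=> vL /simplicialP[c _].
have := cardsID L [set w | e v w]; rewrite (low_deg Gcrit k4 vL).
have -> : [set w | e v w] :&: L = nbhd e L v.
  by apply/setP => w; rewrite in_nb in_setI andbC inE.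
have -> : [set w | e v w] :\: L = [set y in verts G :\: L | e v y].
  apply/setP => w; rewrite in_setD [in RHS]inE in_setD -andbA.
  rewrite [w \in [set _ | _]]inE; case: (boolP (e v w)) => vw; rewrite ?andbF //.
  by rewrite e_sym in vw; rewrite (adj_verts vw).
by rewrite c; move: k4; nlia.
Qed.

Theorem discharging : (N + M * k.-1) * #|verts G| <= M * (2 * #|edges G|).
Proof.
pose H := verts G :\: L; pose YK := [set y in H | deg y == k].
have YP y : y \in YK -> [/\ y \in verts G, y \notin L & deg y <= k].
  by rewrite [y \in YK]inE => /andP[/setDP[yV yL] /eqP ->].
have [F [FA F4 F2]] := payment YP (subxx components).
(* [PF] collects the simplicial vertices that receive the extra charge: those chosen in F, and those
   whose high neighbour has degree above k and can pay all its neighbours by [Hhigh]. *)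
pose SQ := [set v in L | simp v]; pose PF := F :|: (SQ :\: attached G k YK).
have attSQ : attached G k YK \subset SQ.
  by apply/subsetP => v /attP[vL sv _]; rewrite inE vL.
have PFS : PF \subset SQ.
  by rewrite subUset (subset_trans FA attSQ) subsetDl.
have LV : L \subset verts G by apply/subsetP => v; apply: low_verts.
have splitV (f : T -> nat) : \sum_(v in verts G) f v = \sum_(v in L) f v + \sum_(v in H) f v.
  by rewrite (big_setID L) /= (setIidPr LV).
have dbl (A B : {set T}) : \sum_(v in A) #|[set w in B | e v w]| = \sum_(w in B) #|[set v in A | e w v]|.
  under eq_bigr do rewrite card_sum; under [RHS]eq_bigr do rewrite card_sum.
  by rewrite exchange_big; apply: eq_bigr => w _; apply: eq_bigr => v _; rewrite e_sym.
have payy y : y \in H -> al * #|nbhd e L y| + ga * #|[set w in PF | e y w]| + N + M * k.-1 <= M * deg y.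
  move=> yH; have /setDP[yV yL] := yH.
  have dL : #|nbhd e L y| <= deg y.
    by apply: subset_leq_card; apply/subsetP => w; rewrite in_nb inE => /andP[].
  have dP : #|[set w in PF | e y w]| <= deg y.
    by apply: subset_leq_card; apply/subsetP => w; rewrite !inE => /andP[].
  have := high_degree yV yL; rewrite leq_eqVlt => /orP[/eqP dk|dk]; last first.
    have := Hhigh dk; move: dL dP; clear.
    by move: (deg y) #|nbhd e L y| #|_| => d a b; nia.
  have yYK : y \in YK by rewrite inE yH -dk eqxx.
  have p4 : #|[set w in PF | e y w]| <= 4.
    apply: leq_trans (F4 y yYK); apply: subset_leq_card; apply/subsetP => w.
    rewrite inE => /andP[/setUP[wF|/setDP[wS wa]] yw]; first by rewrite inE wF.
    case/negP: wa; move: wS; rewrite inE => /andP[wL sw].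
    by apply/attP; split=> //; exists y; rewrite // e_sym.
  have -> : M * deg y = M * k.-1 + M by rewrite -dk; move: k4; case: (k) => // m _ /=; nia.
  move: HM dL p4; rewrite -dk; clear; move: #|nbhd e L y| #|_| => a b; nia.
have sumH : al * \sum_(y in H) #|nbhd e L y| + ga * \sum_(y in H) #|[set w in PF | e y w]|
    + (N + M * k.-1) * #|H| <= M * \sum_(y in H) deg y.
  have -> : (N + M * k.-1) * #|H| = \sum_(y in H) (N + M * k.-1).
    by rewrite sum_nat_const mulnC.
  rewrite !big_distrr -!big_split /=; apply: leq_sum => y /payy; nlia.
have sum1 : \sum_(y in H) #|nbhd e L y| + \sum_(v in L) #|nbhd e L v| = k.-1 * #|L|.
  rewrite (dbl H L : \sum_(y in H) #|nbhd e L y| = _) -big_split mulnC -sum_nat_const /=.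
  apply: eq_bigr => v vL; rewrite -(low_deg Gcrit k4 vL) addnC.
  rewrite -(cardsID L [set w | e v w]); congr (_ + _); apply: eq_card => w.
    by rewrite in_nb in_setI andbC [in RHS]inE.
  rewrite in_setD [in LHS]inE /H in_setD [w \in [set _ | _]]inE -andbA.
  case: (boolP (e v w)) => vw; rewrite ?andbF //.
  by rewrite e_sym in vw; rewrite (adj_verts vw).
have sum2 : \sum_(y in H) #|[set w in PF | e y w]| = #|PF|.
  rewrite dbl -sum1_card; apply: eq_bigr => w /(subsetP PFS).
  by move=> /setIdP[wL sw]; apply: simp_high.
have sum3 : al * \sum_(v in L) #|nbhd e L v| + ka * #|components| <= be * #|L| + ga * #|SQ|.
  have -> : #|L| = \sum_(C in components) #|C|.
    rewrite -sum1_card comps_partition; apply: eq_bigr => C _.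
    by rewrite sum1_card.
  have -> : #|SQ| = \sum_(C in components) #|[set v in C | simp v]|.
    rewrite card_sum comps_partition; apply: eq_bigr => C _.
    by rewrite card_sum.
  have -> : ka * #|components| = \sum_(C in components) ka by rewrite sum_nat_const mulnC.
  rewrite comps_partition !big_distrr -!big_split /=.
  by apply: leq_sum => C CT; apply: comp_bound.
have sum4 : #|SQ| <= #|PF| + 2 * #|components|.
  rewrite -(cardsID PF SQ) (setIidPr PFS) leq_add2l.
  have -> : SQ :\: PF = [set v in L | v \in SQ :\: PF].
    apply/setP => v; rewrite [in RHS]inE; apply/idP/andP => [h|[]//].
    by split=> //; move: h => /setDP[/setIdP[]].
  rewrite card_sum comps_partition mulnC -sum_nat_const; apply: leq_sum => C CT.
  rewrite -card_sum; apply: leq_trans (F2 C CT); apply: subset_leq_card.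
  apply/subsetP => v /setIdP[vC /setDP[vS]].
  rewrite /PF in_setU in_setD vS andbT negb_or negbK => /andP[vF va].
  by rewrite in_setD vF in_setI vC.
have sumV : \sum_(v in verts G) deg v = k.-1 * #|L| + \sum_(v in H) deg v.
  rewrite splitV; congr (_ + _); rewrite mulnC -sum_nat_const.
  by apply: eq_bigr => v; apply: low_deg.
have cardV : #|verts G| = #|L| + #|H|.
  by rewrite -!sum1_card splitV !sum1_card.
rewrite -handshake sumV cardV.
move: sumH sum1 sum2 sum3 sum4 HN Hka; clear.
move: (\sum_(y in H) #|nbhd e L y|) (\sum_(y in H) #|[set w in PF | _]|).
move: (\sum_(v in L) #|nbhd e L v|) (\sum_(v in H) #|_|).
move: #|L| #|H| #|PF| #|SQ| #|components| => l h p q c dL D x y.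
move=> sH s1 s2 s3 s4 hN hka; subst y.
have E : al * x + al * dL = be * l + N * l.
  by rewrite -mulnDr s1 mulnA hN mulnDl.
nia.
Qed.

End Discharging.

(** * The numerical cases k = 5 and k = 6 *)

(** Without vertices the degree condition is void and AT would be 0. *)
Lemma critical_nonempty (T : finType) (G : sgraph T) k :
  AT_critical k G -> 0 < k -> 0 < #|verts G|.
Proof.
case=> + _; rewrite /AT; case: ex_minnP => m /existsP[D /and3P[oD sD _]] min_m <- m0.
rewrite lt0n; apply: contraTneq m0 => V0; rewrite -leqNgt; apply: min_m.
apply/existsP; exists D; rewrite oD sD /=; apply/forall_inP => x.
by rewrite (card0_eq V0).
Qed.

(* The weights come from (p, h) = (1, 1), where the bound is 4 + 1/10. *)
Lemma critical5_edges (T : finType) (G : sgraph T) :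
  AT_critical 5 G -> ~ is_complete_graph 5 G ->
  41 * #|verts G| <= 10 * (2 * #|edges G|).
Proof.
move=> crit notK.
(* With [al] = 1, the weights [be], [ga], [N], [M] are k - 3 + p, h, 2 - p and k + 2 + 4h - p. No j
   lies strictly between 2 and k - 2 = 3, so the reserve [si] is 0. *)
apply: (@discharging T G 5 crit notK isT isT 1 3 1 0 3 1 10) => //.
- by move=> j j3 jk; have := leq_trans j3 jk.
- by move=> d; lia.
Qed.

(* The weights come from (p, h) = (13/17, 18/17), where the bound is 5 + 7/65. *)
Lemma critical6_edges (T : finType) (G : sgraph T) :
  AT_critical 6 G -> ~ is_complete_graph 6 G ->
  996 * #|verts G| <= 195 * (2 * #|edges G|).
Proof.
move=> crit notK.
(* The same expressions, multiplied by 17. The reserve 12 is exactly what a hanging K_4 lacks, 17 ·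
   12 = 64 · 3 + 12, and [ka] = 64 - 12 is the most that [Hvertex] allows. *)
apply: (@discharging T G 6 crit notK isT isT 17 64 18 12 52 21 195) => //.
- by move=> j j3 jk; have -> : j = 3 by lia.
- by move=> d; lia.
Qed.

Import Order.TTheory GRing.Theory Num.Theory.
Local Open Scope ring_scope.

Lemma avg_degree_ge (R : realType) (T : finType) (G : sgraph T) (a b : nat) :
  (0 < #|verts G|)%N -> (0 < b)%N ->
  (a * #|verts G| <= b * (2 * #|edges G|))%N -> a%:R / b%:R <= avg_degree R G.
Proof.
move=> V0 b0 h; rewrite /avg_degree ler_pdivrMr ?ltr0n // mulrAC ler_pdivlMr ?ltr0n //.
by rewrite mulrC -!natrM ler_nat; move: h; lia.
Qed.

(* Hden makes the displayed bound meaningful. It follows from H7 when 0 <= h k,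
   but not in general, and the bound fails without it: k = 5, p k = 6,
   h k = - 26 / 100, f k = - 74 / 100 satisfy H1-H7 and give 104 <= d(G). *)
Theorem theorem4p3 (R : realType) (k : nat) (p f h : nat -> R)
  (Hk : k = 5%N \/ k = 6%N)
  (H1 : f k >= (k%:R - 1) * (1 - p k - h k))
  (H2 : p k >= 3 / (k%:R - 2))
  (H3 : p k >= h k + 5 - k%:R)
  (H4 : p k >= (2 + h k) / (k%:R - 2))
  (H5 : (k%:R - 1) * p k + (k%:R - 3) * h k >= k%:R + 1)
  (H6 : h k + 1 + f k <= 0)
  (H7 : p k + (k%:R - 5) * h k <= k%:R + 1)
  (Hden : 0 < k%:R + 2 + 4 * h k - p k)
  (T : finType) (G : sgraph T) (Gcrit : AT_critical k G)
  (GnotK : ~ is_complete_graph k G) :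
  avg_degree R G >= k%:R - 1 + (2 - p k) / (k%:R + 2 + 4 * h k - p k).
Proof.
have V0 : (0 < #|verts G|)%N.
  by apply: (critical_nonempty Gcrit); case: Hk => ->.
case: Hk => kE; subst k.
  apply: (le_trans _ (@avg_degree_ge R T G 41 10 V0 isT (critical5_edges Gcrit GnotK))).
  (* Cleared of denominators this is 9p + 4h >= 13, the sum of [H2] and twice [H5]. *)
  have : (2 - p 5%N) / (5%:R + 2 + 4 * h 5%N - p 5%N) <= 1 / 10.
    by move: H2; rewrite !ler_pdivrMr //; lra.
  lra.
apply: (le_trans _ (@avg_degree_ge R T G 996 195 V0 isT (critical6_edges Gcrit GnotK))).
(* Cleared of denominators this is 58p + 28h >= 74: twice [H4] in the form 4p >= 2 + h, plus ten
   times [H5]. *)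
have : (2 - p 6%N) / (6%:R + 2 + 4 * h 6%N - p 6%N) <= 7 / 65.
  by move: H4; rewrite !ler_pdivrMr //; lra.
lra.
Qed.
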